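(* Let $n\ge 3$ and let $M\subset\mathbb{R}^{n+1}$ be a compact connected smooth embedded hypersurface with the induced Riemannian metric $g$. Suppose $M$ admits a Killing vector field $\xi$ (with respect to $g$) with $g(\xi,\xi)\equiv 1$. Then $n+1=2N$ is even, $M$ is diffeomorphic to the sphere $S^{n}$, and, after applying a rigid motion of $\mathbb{R}^{n+1}$ and a linear isometric identification $\mathbb{R}^{n+1}\cong\mathbb{C}^N$, $M$ is the complex ellipsoid $$\{(z_1,\dots,z_N)\in\mathbb{C}^N:\ |\omega_1 z_1|^2+|\omega_2 z_2|^2+\cdots+|\omega_N z_N|^2=1\}$$ for some nonzero real numbers $\omega_1,\dots,\omega_N$, and $\xi$ is the restriction to $M$ of the vector field $(z_1,\dots,z_N)\mapsto(i\omega_1 z_1,\dots,i\omega_N z_N)$. Moreover, if $A$ denotes the shape operator of $M$ with respect to a unit normal field and the function $g(A\xi,\xi)$ is constant on $M$, then $\omega_1^2=\omega_2^2=\cdots=\omega_N^2$, so $M$ is a round hypersphere (of constant curvature) $|z_1|^2+\cdots+|z_N|^2=1/\omega_1^2$.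
   Context: The shape operator $A$ of a hypersurface with unit normal field $\nu$ is $A(X)=-D_X\nu$, where $D$ is the Euclidean derivative. A Killing vector field of a Riemannian manifold is a vector field whose flow consists of isometries. *)

(* Defs.v *)
From HB Require Import structures.
From mathcomp Require Import all_boot all_order all_algebra.
From mathcomp Require Import all_classical all_reals all_analysis.
Set Implicit Arguments. Unset Strict Implicit. Unset Printing Implicit Defensive.
Import Order.TTheory GRing.Theory Num.Theory.
Import numFieldNormedType.Exports.
Local Open Scope classical_set_scope.
Local Open Scope ring_scope.

Section Defs.
Variable R : realType.

Definition dot (m : nat) (u v : 'rV[R]_m) : R := \sum_(i < m) u 0 i * v 0 i.

Fixpoint iterD (V W : normedModType R) (vs : seq V) (f : V -> W) : V -> W :=
  match vs with
  | [::] => f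
  | v :: vs' => fun x => 'D_v (iterD vs' f) x
  end.

Definition smooth_on (V W : normedModType R) (U : set V) (f : V -> W) : Prop :=
  open U /\ forall (vs : seq V) (x : V), U x ->
    {for x, continuous (iterD vs f)} /\ forall v : V, derivable (iterD vs f) x v.

Definition local_ext (V W : normedModType R) (S : set V) (f : V -> W) (p : V)
  (U : set V) (F : V -> W) : Prop :=
  U p /\ smooth_on U F /\ (forall x, S x -> U x -> F x = f x).

Definition smooth_map_on (V W : normedModType R) (S : set V) (f : V -> W) : Prop :=
  forall p, S p -> exists U F, @local_ext V W S f p U F.

Definition local_def (m : nat) (M : set 'rV[R]_m) (p : 'rV[R]_m)
  (U : set 'rV[R]_m) (phi : 'rV[R]_m -> R) : Prop :=
  U p /\ smooth_on U phi /\
  (forall x, U x -> exists v, 'D_v phi x != 0) /\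
  (forall x, U x -> (M x <-> phi x = 0)).

Definition hypersurface (m : nat) (M : set 'rV[R]_m) : Prop :=
  forall p, M p -> exists U phi, local_def M p U phi.

Definition tangent (m : nat) (M : set 'rV[R]_m) (p v : 'rV[R]_m) : Prop :=
  exists U phi, local_def M p U phi /\ 'D_v phi p = 0.

Definition vector_field (m : nat) (M : set 'rV[R]_m) (xi : 'rV[R]_m -> 'rV[R]_m) : Prop :=
  smooth_map_on M xi /\ forall p, M p -> tangent M p (xi p).

Definition isometry_of (m : nat) (M : set 'rV[R]_m) (f : 'rV[R]_m -> 'rV[R]_m) : Prop :=
  (forall p, M p -> M (f p)) /\ smooth_map_on M f /\
  forall p v U F, M p -> tangent M p v -> local_ext M f p U F ->
    dot ('D_v F p) ('D_v F p) = dot v v.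

Definition flow_of (m : nat) (M : set 'rV[R]_m) (xi : 'rV[R]_m -> 'rV[R]_m)
  (Phi : R -> 'rV[R]_m -> 'rV[R]_m) : Prop :=
  forall p, M p ->
    Phi 0 p = p /\
    (forall t, M (Phi t p)) /\
    (forall s t, Phi s (Phi t p) = Phi (s + t) p) /\
    (forall t, derivable (fun s => Phi s p) t 1 /\
               'D_1 (fun s => Phi s p) t = xi (Phi t p)).

Definition killing (m : nat) (M : set 'rV[R]_m) (xi : 'rV[R]_m -> 'rV[R]_m) : Prop :=
  vector_field M xi /\
  exists Phi, flow_of M xi Phi /\ forall t, isometry_of M (Phi t).

Definition unit_sphere (m : nat) : set 'rV[R]_m := [set x | dot x x = 1].

Definition diffeomorphic (m : nat) (M S : set 'rV[R]_m) : Prop :=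
  exists f g : 'rV[R]_m -> 'rV[R]_m,
    (forall x, M x -> S (f x)) /\ (forall y, S y -> M (g y)) /\
    (forall x, M x -> g (f x) = x) /\ (forall y, S y -> f (g y) = y) /\
    smooth_map_on M f /\ smooth_map_on S g.

(* nat-indexed coordinate y_i (0 outside range).  R^(2N) is identified with
   C^N via z_k = y_(2k) + i y_(2k+1). *)
Definition coord (m : nat) (y : 'rV[R]_m.+1) (i : nat) : R :=
  if (i < m.+1)%N then y 0 (inord i) else 0.

Definition cellipsoid (m N : nat) (omega : nat -> R) : set 'rV[R]_m.+1 :=
  [set y | \sum_(k < N) (omega k) ^+ 2 *
      ((coord y (2 * k)%N) ^+ 2 + (coord y (2 * k).+1) ^+ 2) = 1].

(* the vector field z |-> (i omega_1 z_1, ..., i omega_N z_N) in real coordinates *)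
Definition rot_field (m : nat) (omega : nat -> R) (y : 'rV[R]_m.+1) : 'rV[R]_m.+1 :=
  \row_(i < m.+1)
    (if odd i then omega i./2 * coord y i.-1 else - (omega i./2 * coord y i.+1)).

Definition unit_normal (m : nat) (M : set 'rV[R]_m) (nu : 'rV[R]_m -> 'rV[R]_m) : Prop :=
  smooth_map_on M nu /\
  forall p, M p -> dot (nu p) (nu p) = 1 /\ forall v, tangent M p v -> dot (nu p) v = 0.

(* g(A xi, xi) = - <D_xi nu, xi> is constant on M (computed with any smooth
   local extension of nu) *)
Definition shape_xi_const (m : nat) (M : set 'rV[R]_m) (nu xi : 'rV[R]_m -> 'rV[R]_m) : Prop :=
  exists c : R, forall p U F, M p -> local_ext M nu p U F ->
    - dot ('D_(xi p) F p) (xi p) = c.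

End Defs.

(* Main.v *)
(**
A unit Killing field [xi] on a hypersurface [M] is an infinitesimal isometric bending.  In a graph
chart, writing [w] for the component of [xi] along the transverse direction and [f] for the graph
function, the Killing equation determines all second derivatives of [xi] from [w], [f] and their
derivatives, and the symmetry of third derivatives gives the linearised Gauss equation
[f_bc w_ad + f_ad w_bc = f_bd w_ac + f_ac w_bd].  Where the Hessian of [f] is definite, three
mutually orthogonal directions (this is where [n >= 3] enters) force the Hessian of [w] to vanish, so
that [xi = x B + c] locally with [B] skew.  Differentiating [|xi| = 1] twice shows that definiteness
only depends on [B] being injective; it holds at the point of [M] farthest from the origin, hence by
connectedness on all of [M].  Then [M] is open and closed in the connected ellipsoid [|x B + c| = 1],
and the normal form of [B] gives the complex coordinates.  Finally, if [nu] is a unit normal then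
[xi B = g(A xi, xi) nu], so a constant [g(A xi, xi)] makes [|xi B|] constant and all frequencies equal
up to sign.
*)
Require Import Defs.
From HB Require Import structures.
From mathcomp Require Import all_boot all_order all_algebra.
From mathcomp Require Import all_classical all_reals all_analysis.
From mathcomp Require Import ring lra zify.
Set Implicit Arguments. Unset Strict Implicit. Unset Printing Implicit Defensive.
Import Order.TTheory GRing.Theory Num.Theory.
Import numFieldNormedType.Exports.
Local Open Scope classical_set_scope.
Local Open Scope ring_scope.

(** * Smooth functions *)

Section SmoothFunctions.
Variable R : realType.

(** The obstacle at the start is that [killing] speaks of a flow whose time-t maps are smooth in
    space one at a time, with no joint smoothness; the Killing equation has to be extracted from
    finite chords. After that everything is a pointwise computation with ordinary directional
    derivatives. In place of the Levi-Civita connection stands [nab], the derivative along the lift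
    of a fixed ambient vector; these operators commute, so no Christoffel symbols appear. The price
    is one redundant direction [e], along which all of them vanish. Passing from local to global
    needs a condition that is open and survives limits. [nondegenerate] asks that the derivative of
    [xi] be injective on tangent vectors: the identity [<d_a xi, d_b xi> = f_ab w_xi], with [w_xi]
    the derivative of [w] along [xi], then makes every [f_aa] with [a] transverse to the kernel
    direction [e] nonzero, and where [xi = x B + c] holds nearby, or on points accumulating at the
    given one, the condition follows from injectivity of [B]. *)

Lemma dist_le_of_common (eps A B C : R) :
  `|A - B| < eps / 2 -> `|A - C| < eps / 2 -> `|C - B| <= eps.
Proof. by rewrite !ltr_norml ler_norml; lra. Qed.

Lemma is_derive0_segment (k : R -> R) :
  (forall t : R, 0 <= t <= 1 -> is_derive t (1 : R) k 0) -> k 1 = k 0.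
Proof.
move=> dk; have [||c _ /eqP] := @MVT_segment R k (fun=> 0) 0 1 ler01.
- by move=> t /subset_itv_oo_cc; rewrite in_itv; exact: dk.
- apply: continuous_in_subspaceT => t; rewrite inE /= in_itv => /dk[dt _].
  by apply: differentiable_continuous; apply/derivable1_diffP.
by rewrite mul0r subr_eq0 => /eqP.
Qed.

(** If [L > 0], then [k1], which vanishes at 0, is positive just to the right of 0, and the mean
    value theorem pushes [k] above its maximum. *)
Lemma second_derive_max (k k1 : R -> R) (d L : R) : 0 < d ->
  (forall t, t \in `]- d, d[ -> is_derive t (1 : R) k (k1 t)) ->
  is_derive (0 : R) (1 : R) k1 L ->
  (forall t, t \in `]- d, d[ -> k t <= k 0) -> L <= 0.
Proof.
move=> dpos dk dk1 kmax.
have k10 : k1 0 = 0.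
  have dd : - d < d by rewrite gtrN.
  have d0 : (0 : R) \in `]- d, d[ by rewrite in_itv /= oppr_lt0 dpos.
  have [_ <-] := dk 0 d0.
  have [|_ //] := @derive1_at_max _ k (- d) d 0 (ltW dd) _ d0 kmax.
  by move=> t /dk[].
rewrite leNgt; apply/negP => Lpos.
have [dk1' Dk1] := dk1.
have : \forall t \near (0 : R)^', 0 < t^-1 *: (k1 (t *: (1 : R) + 0) - k1 0).
  have C : (fun t : R => t^-1 *: (k1 (t *: (1 : R) + 0) - k1 0)) @ 0^' --> L.
    by rewrite -Dk1; exact: dk1'.
  exact: (cvgr_gt L C 0 Lpos).
rewrite k10; under eq_near do rewrite addr0 subr0 [_ *: 1]mulr1.
move=> /nbhs_ballP[dd /= dd0 Hdd].
pose s := Num.min d dd / 2.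
have md0 : 0 < Num.min d dd by rewrite lt_min dpos.
have s0 : 0 < s by rewrite divr_gt0.
have sm : s < Num.min d dd by rewrite ltr_pdivrMr// ltr_pMr// ltr1n.
have sd : s < d by apply: lt_le_trans sm _; rewrite ge_min lexx.
have sdd : s < dd by apply: lt_le_trans sm _; rewrite ge_min lexx orbT.
have ind (t : R) : t \in `[0, s] -> t \in `]- d, d[.
  rewrite !in_itv /= => /andP[t0 ts]; rewrite (le_lt_trans ts sd) andbT.
  by rewrite (lt_le_trans _ t0)// oppr_lt0.
have dks (t : R) : t \in `]0, s[ -> is_derive t (1 : R) k (k1 t).
  by move=> /subset_itv_oo_cc/ind/dk.
have cks : {within `[0, s], continuous k}.
  apply: continuous_in_subspaceT => t; rewrite inE /= => /ind/dk[dt _].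
  by apply: differentiable_continuous; apply/derivable1_diffP.
have [c] := MVT s0 dks cks.
rewrite in_itv /= subr0 => /andP[c0 cs] E.
have : 0 < c^-1 *: k1 c.
  apply: Hdd; last by rewrite /= gt_eqF.
  by rewrite -ball_normE /= sub0r normrN gtr0_norm// (lt_trans cs).
rewrite pmulr_rgt0 ?invr_gt0// => k1c.
have : k s <= k 0 by apply/kmax/ind; rewrite in_itv /= lexx ltW.
by rewrite -subr_le0 E leNgt mulr_gt0.
Qed.

(** * Derivatives along lines and smoothness of finite order *)

Section Germs.
Variables (V : normedModType R).
Implicit Types (f g : V -> R) (U : set V).

Lemma continuous_for_ball (W : normedModType R) (f : W -> R) x (eps : R) :
  {for x, continuous f} -> 0 < eps ->
  exists2 d : R, 0 < d & forall y, `|y - x| < d -> `|f y - f x| < eps.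
Proof.
move=> /cvgrPdist_lt /(_ _) cf e0; have /nbhs_ballP[d /= d0 H] := cf _ e0.
exists d => // y xy; rewrite distrC; apply: H.
by rewrite -ball_normE /= distrC.
Qed.

Lemma continuous_for_sum (T : topologicalType) (I : Type) (r : seq I) (F : I -> T -> R) x :
  (forall i, {for x, continuous (F i)}) ->
  {for x, continuous (fun y => \sum_(i <- r) F i y)}.
Proof.
move=> cF; elim: r => [|i r IH].
  by rewrite (_ : (fun y => _) = cst 0); [exact: cst_continuous | apply/funext => y; rewrite big_nil].
rewrite (_ : (fun y => _) = (fun y => F i y + \sum_(i <- r) F i y)).
  by apply: continuousD; [exact: cF | exact: IH].
by apply/funext => y; rewrite big_cons.
Qed.

Lemma continuous_for_prod (T : topologicalType) (I : Type) (r : seq I) (F : I -> T -> R) x :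
  (forall i, {for x, continuous (F i)}) ->
  {for x, continuous (fun y => \prod_(i <- r) F i y)}.
Proof.
move=> cF; elim: r => [|i r IH].
  by rewrite (_ : (fun y => _) = cst 1); [exact: cst_continuous | apply/funext => y; rewrite big_nil].
rewrite (_ : (fun y => _) = (fun y => F i y * \prod_(i <- r) F i y)).
  by apply: continuousM; [exact: cF | exact: IH].
by apply/funext => y; rewrite big_cons.
Qed.

Lemma open_ball_sub U x : open U -> U x ->
  exists2 d : R, 0 < d & forall y, `|y - x| < d -> U y.
Proof.
move=> oU Ux; have /nbhs_ballP[d /= d0 H] : nbhs x U by apply: open_nbhs_nbhs.
by exists d => // y xy; apply: H; rewrite -ball_normE /= distrC.
Qed.

Lemma derive_funD f g x v : derivable f x v -> derivable g x v ->
  'D_v (fun y => f y + g y) x = 'D_v f x + 'D_v g x.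
Proof. exact: deriveD. Qed.

Lemma derive_funN f x v : derivable f x v -> 'D_v (fun y => - f y) x = - 'D_v f x.
Proof. exact: deriveN. Qed.

Lemma derive_funM f g x v : derivable f x v -> derivable g x v ->
  'D_v (fun y => f y * g y) x = f x * 'D_v g x + g x * 'D_v f x.
Proof. exact: deriveM. Qed.

Lemma derive_funV f x v : f x != 0 -> derivable f x v ->
  'D_v (fun y => (f y)^-1) x = - (f x ^- 2 * 'D_v f x).
Proof. by move=> f0 df; rewrite deriveV// /GRing.scale /= mulNr. Qed.

Lemma is_derive_line (W : normedModType R) (f : V -> W) x v t :
  derivable f (x + t *: v) v ->
  is_derive t (1 : R) (fun s : R => f (x + s *: v)) ('D_v f (x + t *: v)).
Proof.
move=> df.
have E : (fun h : R => h^-1 *: (f (x + (h *: (1 : R) + t) *: v) - f (x + t *: v)))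
   = (fun h : R => h^-1 *: (f (h *: v + (x + t *: v)) - f (x + t *: v))).
  apply/funext => h; congr (_ *: (f _ - _)).
  by rewrite [h *: 1]mulr1 scalerDl addrCA.
by split; [rewrite /derivable E | rewrite /derive E].
Qed.

(** The intermediate point is recorded as a fraction [k] of [t], so that one statement covers both
    signs of [t] as well as [t = 0]. *)
Lemma line_MVT f x v (t : R) :
  (forall k, 0 <= k <= 1 -> derivable f (x + (k * t) *: v) v) ->
  exists2 k, 0 <= k <= 1 & f (x + t *: v) - f x = t * 'D_v f (x + (k * t) *: v).
Proof.
move=> df; pose g s := f (x + s *: v).
pose P s := exists2 k, 0 <= k <= 1 & s = k * t.
have dg s : P s -> is_derive s (1 : R) g ('D_v f (x + s *: v)).
  by move=> [k k01 ->]; apply/is_derive_line/df.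
have cg s : P s -> {for s, continuous g}.
  move=> /dg [dgs _]; apply: differentiable_continuous.
  by apply/derivable1_diffP.
have g0 : g 0 = f x by rewrite /g scale0r addr0.
have [t0|t0|t0] := ltgtP t 0; last first.
- exists 0; rewrite ?lexx ?ler01//.
  by rewrite t0 scale0r addr0 subrr mul0r.
- have B s : s \in `[0, t] -> P s.
    rewrite in_itv /= => /andP[s0 st]; exists (s / t); last by rewrite divfK ?gt_eqF.
    by rewrite divr_ge0 ?(ltW t0)//= ler_pdivrMr// mul1r.
  have [||c /B [k k01 ->] E] := @MVT_segment _ g (fun s => 'D_v f (x + s *: v)) 0 t (ltW t0).
  + by move=> s /subset_itv_oo_cc/B/dg.
  + by apply: continuous_in_subspaceT => s; rewrite inE /= => /B/cg.
  by exists k => //; rewrite -g0 E subr0 mulrC.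
- have B s : s \in `[t, 0] -> P s.
    rewrite in_itv /= => /andP[ts s0]; exists (s / t); last by rewrite divfK ?lt_eqF.
    by rewrite ler_ndivlMr// mul0r s0 ler_ndivrMr// mul1r.
  have [||c /B [k k01 ->] E] := @MVT_segment _ g (fun s => 'D_v f (x + s *: v)) t 0 (ltW t0).
  + by move=> s /subset_itv_oo_cc/B/dg.
  + by apply: continuous_in_subspaceT => s; rewrite inE /= => /B/cg.
  by exists k => //; rewrite -g0 -opprB E sub0r mulrN opprK mulrC.
Qed.

(** Unlike [iterD], which adds derivatives on the outside, [Ck] peels off the innermost one; in this
    order the product and quotient rules fit an induction on [k]. *)
Fixpoint Ck k U f : Prop :=
  (forall x, U x -> {for x, continuous f}) /\
  if k is k'.+1 then
    forall v, (forall x, U x -> derivable f x v) /\ Ck k' U ('D_v f)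
  else True.

Lemma iterD_rcons (W : normedModType R) vs v (f : V -> W) :
  Defs.iterD (rcons vs v) f = Defs.iterD vs ('D_v f).
Proof. by elim: vs => //= a vs ->. Qed.

Lemma smooth_onP U f : smooth_on U f <-> open U /\ forall k, Ck k U f.
Proof.
split=> [[oU sf]|[oU sf]]; split=> //.
  move=> k; elim: k f sf => [|k IH] f sf /=.
    by split=> // x Ux; have [] := sf [::] x Ux.
  split=> [x Ux|v]; first by have [] := sf [::] x Ux.
  split=> [x Ux|]; first by have [_] := sf [::] x Ux.
  by apply: IH => vs x Ux; have := sf (rcons vs v) x Ux; rewrite iterD_rcons.
move=> vs; elim/last_ind: vs f sf => [|vs v IH] f sf x Ux /=.
  split; first by have [] := sf 0%N => + _; apply.
  by move=> v; have [_ /(_ v) []] := sf 1%N => + _; apply.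
rewrite iterD_rcons; apply: IH => // k.
by have [_ /(_ v) []] := sf k.+1.
Qed.

Lemma near_open U x (P : V -> Prop) : open U -> U x ->
  (forall y, U y -> P y) -> \near x, P x.
Proof.
by move=> oU Ux H; apply: filterS H _; apply: open_nbhs_nbhs.
Qed.

Lemma Ck_ext k U f g : open U -> (forall x, U x -> f x = g x) ->
  Ck k U f -> Ck k U g.
Proof.
move=> oU; elim: k f g => [|k IH] f g fg /= [cf df]; (split; last first).
- by [].
- move=> x Ux; rewrite /prop_for /continuous_at -fg//; apply: cvg_trans (cf x Ux).
  by apply: near_eq_cvg; apply: near_open Ux _ => // y /fg.
- move=> v; have [dv /IH Cv] := df v; split=> [x Ux|].
    by apply: near_eq_derivable (dv x Ux); apply: near_open Ux _.
  by apply: Cv => x Ux; apply: near_eq_derive; apply: near_open Ux _.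
- move=> x Ux; rewrite /prop_for /continuous_at -fg//; apply: cvg_trans (cf x Ux).
  by apply: near_eq_cvg; apply: near_open Ux _ => // y /fg.
Qed.

Lemma Ck_le k U f : Ck k.+1 U f -> Ck k U f.
Proof.
elim: k f => [|k IH] f; first by case.
by move=> [cf df]; split=> // v; have [dv /IH] := df v.
Qed.

Lemma Ck_add k U f g : open U -> Ck k U f -> Ck k U g ->
  Ck k U (fun x => f x + g x).
Proof.
move=> oU; elim: k f g => [|k IH] f g [cf df] [cg dg]; split=> //;
  try by move=> x Ux; apply: continuousD; [exact: cf | exact: cg].
move=> v; have [dfv Cf] := df v; have [dgv Cg] := dg v; split=> [x Ux|].
  by apply: derivableD; [exact: dfv | exact: dgv].
apply: Ck_ext (IH _ _ Cf Cg) => // x Ux.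
by rewrite deriveD//; [exact: dfv | exact: dgv].
Qed.

Lemma Ck_mul k U f g : open U -> Ck k U f -> Ck k U g ->
  Ck k U (fun x => f x * g x).
Proof.
move=> oU; elim: k f g => [|k IH] f g Hf Hg; have [cf df] := Hf;
  have [cg dg] := Hg; split=> //;
  try by move=> x Ux; apply: continuousM; [exact: cf | exact: cg].
move=> v; have [dfv Cf] := df v; have [dgv Cg] := dg v; split=> [x Ux|].
  by apply: derivableM; [exact: dfv | exact: dgv].
have Kf := Ck_le Hf; have Kg := Ck_le Hg.
apply: Ck_ext (Ck_add oU (IH _ _ Kf Cg) (IH _ _ Kg Cf)) => // x Ux.
by symmetry; exact: deriveM (dfv x Ux) (dgv x Ux).
Qed.

Lemma Ck_cst k U (c : R) : Ck k U (fun=> c).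
Proof.
elim: k c => [|k IH] c; split=> //; try by move=> x _; apply: cst_continuous.
move=> v; split=> [x _|]; first exact: derivable_cst.
rewrite (_ : 'D_v _ = fun=> 0); first exact: IH.
by apply/funext => x; exact: derive_cst.
Qed.

Lemma Ck_inv k U f : open U -> (forall x, U x -> f x != 0) -> Ck k U f ->
  Ck k U (fun x => (f x)^-1).
Proof.
move=> oU f0; elim: k => [|k IH] Hf; have [cf df] := Hf; split=> //;
  try by move=> x Ux; apply: continuousV; [exact: f0 | exact: cf].
move=> v; have [dfv Cf] := df v; split=> [x Ux|].
  by apply: derivableV; [exact: f0 | exact: dfv].
have K := IH (Ck_le Hf).
apply: Ck_ext (Ck_mul oU (Ck_cst k U (-1)) (Ck_mul oU (Ck_mul oU K K) Cf)) => // x Ux.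
rewrite deriveV//; [|exact: f0 | exact: dfv].
by rewrite mulN1r scaleNr -exprVn expr2.
Qed.

End Germs.

Section Algebra.
Variables (V : normedModType R).
Implicit Types (f g : V -> R) (U : set V).

Lemma smooth_open U f : smooth_on U f -> open U. Proof. by case. Qed.

Lemma smooth_continuous U f x : smooth_on U f -> U x -> {for x, continuous f}.
Proof. by move=> [_ sf] Ux; have [] := sf [::] x Ux. Qed.

Lemma smooth_derivable U f x v : smooth_on U f -> U x -> derivable f x v.
Proof. by move=> [_ sf] Ux; have [_] := sf [::] x Ux. Qed.

Lemma smooth_derive U f v : smooth_on U f -> smooth_on U ('D_v f).
Proof.
move=> [oU sf]; split=> // vs x Ux.
by have := sf (rcons vs v) x Ux; rewrite iterD_rcons.
Qed.

Lemma smooth_eq U f g : (forall x, U x -> f x = g x) -> smooth_on U f -> smooth_on U g.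
Proof.
move=> fg /smooth_onP[oU sf]; apply/smooth_onP; split=> // k.
exact: Ck_ext (sf k).
Qed.

Lemma smooth_sub (W : normedModType R) U U' (f : V -> W) :
  open U' -> (forall x, U' x -> U x) -> smooth_on U f -> smooth_on U' f.
Proof. by move=> oU sU [_ sf]; split=> // vs x /sU; apply: sf. Qed.

Lemma smooth_add U f g : smooth_on U f -> smooth_on U g -> smooth_on U (fun x => f x + g x).
Proof.
move=> /smooth_onP[oU sf] /smooth_onP[_ sg]; apply/smooth_onP; split=> // k.
exact: Ck_add.
Qed.

Lemma smooth_mul U f g : smooth_on U f -> smooth_on U g -> smooth_on U (fun x => f x * g x).
Proof.
move=> /smooth_onP[oU sf] /smooth_onP[_ sg]; apply/smooth_onP; split=> // k.
exact: Ck_mul.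
Qed.

Lemma smooth_cst U (c : R) : open U -> smooth_on U (fun=> c).
Proof. by move=> oU; apply/smooth_onP; split=> // k; exact: Ck_cst. Qed.

Lemma smooth_opp U f : smooth_on U f -> smooth_on U (fun x => - f x).
Proof.
move=> sf; apply: smooth_eq (smooth_mul (smooth_cst (-1) (smooth_open sf)) sf) => x _.
by rewrite mulN1r.
Qed.

Lemma smooth_inv U f : (forall x, U x -> f x != 0) -> smooth_on U f ->
  smooth_on U (fun x => (f x)^-1).
Proof.
move=> f0 /smooth_onP[oU sf]; apply/smooth_onP; split=> // k.
exact: Ck_inv.
Qed.

Lemma smooth_sum (I : Type) (r : seq I) (F : I -> V -> R) U : open U ->
  (forall i, smooth_on U (F i)) -> smooth_on U (fun x => \sum_(i <- r) F i x).
Proof.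
move=> oU sF; elim: r => [|i r IH].
  by apply: smooth_eq (smooth_cst 0 oU) => x _; rewrite big_nil.
by apply: smooth_eq (smooth_add (sF i) IH) => x _; rewrite big_cons.
Qed.

End Algebra.

(** * Differentiability, chain rule and symmetry of second derivatives on row vectors *)

Section RowVectors.
Variable m : nat.
Local Notation V := 'rV[R]_m.
Implicit Types (f g : V -> R) (U : set V).

Lemma is_derive_coord i (y v : V) : is_derive y v (fun x : V => x 0 i) (v 0 i).
Proof.
have D : derivable (fun x : V => x) y v by exact: derivable_id.
split; first by move/derivable_mxP: D; apply.
by have := derive_id y v; rewrite (derive_mx D) => /matrixP/(_ 0 i); rewrite mxE.
Qed.

Lemma smooth_coord U i : open U -> smooth_on U (fun x : V => x 0 i).
Proof.
move=> oU; split=> // vs x Ux.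
have lin v y := is_derive_coord i y v.
suff : vs = [::] \/ exists c, Defs.iterD vs (fun x : V => x 0 i) = cst c.
  case=> [->|[c ->]]; split => /=; [exact: coord_continuous| |exact: cst_continuous|].
    by move=> v; have [] := lin v x.
  by move=> v; exact: derivable_cst.
case/lastP: vs => [|vs v]; [by left | right].
rewrite iterD_rcons (_ : 'D_v _ = cst (v 0 i)); last first.
  by apply/funext => y; have [_ ->] := lin v y.
elim: vs (v 0 i) => [|u vs IH] c; first by exists c.
have [d /= ->] := IH c; exists 0.
by apply/funext => y; rewrite derive_cst.
Qed.

Lemma ler_coord_norm (x : V) i : `|x 0 i| <= `|x|.
Proof.
rewrite [leRHS]/Num.Def.normr /= mx_normrE.
by apply: le_trans; last exact: (le_bigmax _ _ (0, i)).
Qed.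

Lemma norm_le_coord (x : V) (c : R) : 0 <= c -> (forall i, `|x 0 i| <= c) -> `|x| <= c.
Proof.
move=> c0 H; rewrite [leLHS]/Num.Def.normr /= mx_normrE.
by apply: bigmax_le => // -[i j] _ /=; rewrite ord1.
Qed.

(** The increment is split along the edges of a coordinate path from [x] to [x + h]; on each edge
    the mean value theorem and the continuity of one partial derivative apply. *)
Lemma C1_differentiable f x :
  (\near x, forall v, derivable f x v) ->
  (forall v, {for x, continuous ('D_v f)}) -> differentiable f x.
Proof.
move=> df cf.
pose df0 (h : V) : R := \sum_i h 0 i * 'D_('e_i) f x.
have df0_lin : linear df0.
  move=> a u v; rewrite /df0 scaler_sumr -big_split; apply: eq_bigr => i _ /=.
  by rewrite !mxE mulrDl -mulrA.
pose L : {linear V -> R} := HB.pack df0 (GRing.isLinear.Build _ _ _ _ df0 df0_lin).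
have cL : continuous L.
  move=> y; apply: continuous_for_sum => i.
  by apply: continuousM; [exact: coord_continuous | exact: cst_continuous].
have E : f \o shift x = cst (f x) + L +o_ (0 : V) id.
  apply/eqaddoP => eps e0 /=.
  have /nbhs_ballP[d0 /= d00 H0] := df.
  (* Dividing by [m.+1] instead of [m] stays meaningful for [m = 0]; the [m] edges then contribute
     at most [eps] times the norm of [h]. *)
  have m1 : 0 < m.+1%:R :> R by rewrite ltr0n.
  have ed : 0 < eps / m.+1%:R by rewrite divr_gt0.
  have : exists2 d1 : R, 0 < d1 & forall i y, `|y - x| < d1 ->
      `|'D_('e_i) f y - 'D_('e_i) f x| < eps / m.+1%:R.
    have /choice[d Hd] : forall i, exists d : R, 0 < d /\ forall y, `|y - x| < d ->
        `|'D_('e_i) f y - 'D_('e_i) f x| < eps / m.+1%:R.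
      by move=> i; have [d ? ?] := continuous_for_ball (cf 'e_i) ed; exists d.
    exists (\big[Num.min/1]_i d i).
      elim/big_ind: _ => [|a b a0 b0|i _] //; first by rewrite lt_min a0.
      by have [] := Hd i.
    move=> i y yd; apply: (Hd i).2; apply: (lt_le_trans yd).
    by rewrite (bigD1 i) //= ge_min lexx.
  move=> [d1 d10 H1].
  near=> h.
  have hd0 : `|h| < d0.
    by near: h; apply: (@nbhs0_lt R V).
  have hd1 : `|h| < d1.
    by near: h; apply: (@nbhs0_lt R V).
  (* The vertices of the coordinate path: [S k] keeps the first [k] coordinates of [h]. *)
  pose S k : V := \row_j (if (j < k)%N then h 0 j else 0).
  have SS (k : 'I_m) : S k.+1 = S k + h 0 k *: 'e_k.
    apply/rowP => j; rewrite !mxE eqxx /= ltnS leq_eqVlt -val_eqE.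
    have [jk|] := eqVneq (val j) k.
      by rewrite jk ltnn /= mulr1 add0r (val_inj jk).
    by rewrite mulr0 addr0.
  have Sb (k : 'I_m) c : `|c| <= `|h 0 k| -> `|(x + S k + c *: 'e_k) - x| <= `|h|.
    move=> ch; rewrite addrC !addrA addNr add0r.
    apply: norm_le_coord => // j; rewrite !mxE eqxx /= -val_eqE.
    have [jk|jk] := eqVneq (val j) k.
      by rewrite jk ltnn /= mulr1 add0r (le_trans ch)// ler_coord_norm.
    rewrite mulr0 addr0; case: ifP => _; first exact: ler_coord_norm.
    by rewrite normr0.
  have tel : f (x + h) - f x = \sum_(k < m) (f (x + S k.+1) - f (x + S k)).
    rewrite -(big_mkord xpredT (fun k => f (x + S k.+1) - f (x + S k))).
    rewrite telescope_sumr//; congr (f _ - f _).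
      by congr (_ + _); apply/rowP => j; rewrite mxE ltn_ord.
    by rewrite -[LHS]addr0; congr (_ + _); apply/rowP => j; rewrite !mxE ltn0.
  have -> : (f \o shift x - (cst (f x) + L)) h =
      \sum_(k < m) (f (x + S k.+1) - f (x + S k) - h 0 k * 'D_('e_k) f x).
    rewrite sumrB -tel; change (f (h + x) - (f x + df0 h) = f (x + h) - f x - df0 h).
    by rewrite opprD addrA [h + x]addrC.
  apply: (@le_trans _ _ (\sum_(k < m) `|h| * (eps / m.+1%:R))).
    apply: (le_trans (ler_norm_sum _ _ _)); apply: ler_sum => k _.
    rewrite SS addrA.
    have kb c : 0 <= c <= 1 -> `|c * h 0 k| <= `|h 0 k|.
      by move=> /andP[c0 c1]; rewrite normrM (ger0_norm c0) ler_piMl.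
    have [|c ch ->] := @line_MVT V f (x + S k) 'e_k (h 0 k).
      move=> s sh; apply: H0; rewrite -ball_normE /= distrC.
      exact: le_lt_trans (Sb _ _ (kb _ sh)) hd0.
    rewrite -mulrBr normrM ler_pM//; first exact: ler_coord_norm.
    by apply/ltW/H1; apply: le_lt_trans (Sb _ _ (kb _ ch)) hd1.
  rewrite sumr_const card_ord -[leLHS]mulr_natr -mulrA [leLHS]mulrC ler_wpM2r//.
  by rewrite mulrAC ler_pdivrMr// ler_wpM2l ?(ltW e0)// ler_nat.
have dE : 'd f x = df0 :> (V -> R) by exact: (@diff_unique _ _ _ f L x cL E).
apply/diff_locallyP; rewrite dE; split=> //.
Unshelve. all: by end_near. Qed.

Lemma smooth_differentiable U f x : smooth_on U f -> U x -> differentiable f x.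
Proof.
move=> sf Ux; apply: C1_differentiable => [|v].
  by apply: near_open Ux _ => [|y Uy v]; [exact: smooth_open sf | exact: smooth_derivable sf Uy].
exact: smooth_continuous (smooth_derive v sf) Ux.
Qed.

Lemma derive_dirD U f x u v : smooth_on U f -> U x ->
  'D_(u + v) f x = 'D_u f x + 'D_v f x.
Proof.
by move=> sf Ux; have df := smooth_differentiable sf Ux; rewrite !deriveE// linearD.
Qed.

Lemma derive_dirZ U f x c v : smooth_on U f -> U x ->
  'D_(c *: v) f x = c * 'D_v f x.
Proof.
by move=> sf Ux; have df := smooth_differentiable sf Ux; rewrite !deriveE// linearZ.
Qed.

Lemma derive_dir_sum U f x v : smooth_on U f -> U x ->
  'D_v f x = \sum_i v 0 i * 'D_('e_i) f x.
Proof.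
move=> sf Ux; have df := smooth_differentiable sf Ux.
rewrite deriveE// [in LHS](row_sum_delta v) linear_sum; apply: eq_bigr => i _.
by rewrite linearZ deriveE.
Qed.

(** Only a directional derivative of [c] is given, so [c] is restricted to the line through [h] in
    direction [v]; in one variable derivability is differentiability and the chain rule applies. *)
Lemma is_derive_comp (W : normedModType R) U f (c : W -> V) (h v : W) (u : V) :
  smooth_on U f -> U (c h) -> is_derive h v c u ->
  is_derive h v (fun y => f (c y)) ('D_u f (c h)).
Proof.
move=> sf Uc [dc cu].
pose k (t : R) := c (t *: v + h).
have dk : derivable k 0 1 by exact: ((derivable1P c h v).1 dc).
have k0 : k 0 = c h by rewrite /k scale0r add0r.
have Dk : 'D_1 k 0 = u.
  have E : (fun t : R => t^-1 *: (k (t *: (1 : R) + 0) - k 0)) =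
      (fun t => t^-1 *: (c (t *: v + h) - c h)).
    by apply/funext => t; rewrite /k addr0 scale0r add0r [t *: 1]mulr1.
  by rewrite -cu /derive E.
have df : differentiable f (k 0) by rewrite k0; exact: smooth_differentiable sf Uc.
have dkd : differentiable k 0 by apply/derivable1_diffP.
have dfk : differentiable (f \o k) 0 by exact: differentiable_comp.
have D : 'D_1 (f \o k) 0 = 'D_u f (c h).
  by rewrite deriveE// diff_comp//= -[X in 'd f _ X](deriveE _ dkd) Dk -deriveE// k0.
split; first by apply: (derivable1P _ h v).2; exact: diff_derivable dfk.
have E : (fun t : R => t^-1 *: ((f \o k) (t *: (1 : R) + 0) - (f \o k) 0)) =
    (fun t => t^-1 *: (f (c (t *: v + h)) - f (c h))).
  by apply/funext => t; rewrite /= /k addr0 scale0r add0r [t *: 1]mulr1.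
by rewrite -D /derive E.
Qed.

Lemma derive_comm U f x u v : smooth_on U f -> U x ->
  'D_u ('D_v f) x = 'D_v ('D_u f) x.
Proof.
move=> sf Ux; have oU := smooth_open sf.
have [d0 d00 HU] := open_ball_sub oU Ux.
(* the second difference of [f] at scale [t] is [t^2] times each mixed derivative at a nearby point *)
have key (a b : V) (t : R) : 0 < t -> t * (`|a| + `|b|) < d0 ->
    exists2 y, `|y - x| <= t * (`|a| + `|b|) &
      f (x + t *: a + t *: b) - f (x + t *: a) - (f (x + t *: b) - f x) =
        t * (t * 'D_b ('D_a f) y).
  move=> t0 td.
  have nb k l : 0 <= k <= 1 -> 0 <= l <= 1 ->
      `|x + (k * t) *: a + (l * t) *: b - x| <= t * (`|a| + `|b|).
    move=> /andP[k0 k1] /andP[l0 l1]; rewrite addrC !addrA addNr add0r.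
    apply: le_trans (ler_normD _ _) _; rewrite !normrZ.
    rewrite (ger0_norm k0) (ger0_norm l0) (gtr0_norm t0) mulrDr; apply: lerD; rewrite -mulrA ler_piMl//;
    by rewrite mulr_ge0// ltW.
  have UU k l : 0 <= k <= 1 -> 0 <= l <= 1 -> U (x + (k * t) *: a + (l * t) *: b).
    by move=> k01 l01; apply: HU; apply: le_lt_trans (nb _ _ k01 l01) td.
  have o01 : 0 <= (1 : R) <= 1 by rewrite ler01 lexx.
  have z01 : 0 <= (0 : R) <= 1 by rewrite ler01 lexx.
  pose g y := f (y + t *: b) - f y.
  have dg k : 0 <= k <= 1 -> is_derive (x + (k * t) *: a) a g
      ('D_a f (x + (k * t) *: a + t *: b) - 'D_a f (x + (k * t) *: a)).
    move=> k01; apply: is_deriveB.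
      have := @is_derive_comp V U f (fun y => y + t *: b) (x + (k * t) *: a) a a sf.
      have := UU k 1 k01 o01; rewrite mul1r => Ui /(_ Ui); apply.
      by apply: is_derive_eq; rewrite addr0.
    apply/derivableP; apply: smooth_derivable sf _.
    by have := UU k 0 k01 z01; rewrite mul0r scale0r addr0.
  have [|k k01 E] := @line_MVT V g x a t; first by move=> k /dg[].
  have [|l l01 F] := @line_MVT V ('D_a f) (x + (k * t) *: a) b t.
    by move=> l l01; apply: smooth_derivable (smooth_derive a sf) (UU _ _ k01 l01).
  exists (x + (k * t) *: a + (l * t) *: b); first exact: nb.
  have [_ D] := dg k k01; move: E; rewrite D F /g => <-.
  by rewrite addrAC.
have suv := smooth_derive u (smooth_derive v sf).
have svu := smooth_derive v (smooth_derive u sf).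
apply/eqP; rewrite -subr_eq0 -normr_le0; apply/ler_addgt0Pl => eps e0; rewrite addr0.
have e2 : 0 < eps / 2 by rewrite divr_gt0.
have [d1 d10 H1] := continuous_for_ball (smooth_continuous suv Ux) e2.
have [d2 d20 H2] := continuous_for_ball (smooth_continuous svu Ux) e2.
pose N := `|u| + `|v| + 1; have N0 : 0 < N by rewrite ltr_wpDl// addr_ge0.
pose d := Num.min d0 (Num.min d1 d2).
have dpos : 0 < d by rewrite !lt_min d00 d10.
pose t := d / (2 * N); have t0 : 0 < t by rewrite divr_gt0// mulr_gt0.
have td : t * (`|u| + `|v|) < d.
  have tN : t * N = d / 2 by rewrite /t; field; rewrite gt_eqF.
  apply: (@lt_trans _ _ (d / 2)); last by rewrite ltr_pdivrMr// ltr_pMr ?ltr1n.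
  by rewrite -tN ltr_pM2l// /N ltrDl.
have [|y1 y1d E1] := key u v t t0; first by apply: lt_le_trans td _; rewrite ge_min lexx.
rewrite [`|u| + _]addrC in td.
have [|y2 y2d E2] := key v u t t0; first by apply: lt_le_trans td _; rewrite ge_min lexx.
have EE : 'D_v ('D_u f) y1 = 'D_u ('D_v f) y2.
  have tt : forall A B : R, t * (t * A) = t * (t * B) -> A = B.
    by move=> A B; do 2 (move=> /(mulfI (lt0r_neq0 t0))).
  apply: tt; apply: etrans (esym E1) (etrans _ E2).
  have -> : x + t *: v + t *: u = x + t *: u + t *: v by exact: addrAC.
  by rewrite !opprB addrACA [- f (x + t *: u) - _]addrC addrACA.
have A1 : `|'D_v ('D_u f) y1 - 'D_v ('D_u f) x| < eps / 2.
  apply: H2; apply: le_lt_trans y1d _; rewrite addrC; apply: lt_le_trans td _.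
  by rewrite !ge_min lexx !orbT.
have A2 : `|'D_u ('D_v f) y2 - 'D_u ('D_v f) x| < eps / 2.
  apply: H1; apply: le_lt_trans y2d _; apply: lt_le_trans td _.
  by rewrite !ge_min lexx !orbT.
by apply: (dist_le_of_common A1); rewrite EE.
Qed.

End RowVectors.

Section VectorValued.
Variables (W : normedModType R) (k : nat).
Implicit Types (F : W -> 'rV[R]_k) (U : set W).

Lemma derive_coord F x v i : derivable F x v ->
  'D_v F x 0 i = 'D_v (fun y => F y 0 i) x.
Proof. by move=> /derive_mx ->; rewrite mxE. Qed.

Lemma smooth_row_coord U F i : smooth_on U F -> smooth_on U (fun x => F x 0 i).
Proof.
move=> [oU sF]; split=> // vs x Ux.
have E : forall ws y, U y -> Defs.iterD ws (fun x => F x 0 i) y = Defs.iterD ws F y 0 i.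
  elim=> [|w ws IH] y Uy //=.
  rewrite derive_coord; last by have [_] := sF ws y Uy.
  by apply: near_eq_derive; apply: near_open Uy _.
have [cF dF] := sF vs x Ux; split.
  rewrite /prop_for /continuous_at E//.
  apply: cvg_trans (near_eq_cvg _) _; last first.
    apply: (@continuous_comp _ _ _ (Defs.iterD vs F) (fun y : 'rV[R]_k => y 0 i)) cF _.
    exact: coord_continuous.
  by apply: near_open Ux _ => // y Uy /=; rewrite E.
move=> v; have /derivable_mxP/(_ 0 i) := dF v.
by apply: near_eq_derivable; apply: near_open Ux _ => // y Uy; rewrite E.
Qed.

End VectorValued.

End SmoothFunctions.

Arguments smooth_derivable {R V U f x} v _ _.

(** * The Euclidean inner product *)

Section Dot.
Variables (R : realType) (m : nat).
Local Notation V := 'rV[R]_m.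
Implicit Types (u v w x : V) (B : 'M[R]_m).

Lemma dotC u v : dot u v = dot v u.
Proof. by apply: eq_bigr => i _; rewrite mulrC. Qed.

Lemma dotDl u v w : dot (u + v) w = dot u w + dot v w.
Proof. by rewrite -big_split; apply: eq_bigr => i _; rewrite mxE mulrDl. Qed.

Lemma dotZl (k : R) u v : dot (k *: u) v = k * dot u v.
Proof. by rewrite /dot mulr_sumr; apply: eq_bigr => i _; rewrite mxE mulrA. Qed.

Lemma dotDr u v w : dot w (u + v) = dot w u + dot w v.
Proof. by rewrite !(dotC w) dotDl. Qed.

Lemma dotZr (k : R) u v : dot v (k *: u) = k * dot v u.
Proof. by rewrite !(dotC v) dotZl. Qed.

Lemma dotNl u v : dot (- u) v = - dot u v.
Proof. by rewrite -scaleN1r dotZl mulN1r. Qed.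

Lemma dotNr u v : dot v (- u) = - dot v u.
Proof. by rewrite -scaleN1r dotZr mulN1r. Qed.

Lemma dotBl u v w : dot (u - v) w = dot u w - dot v w.
Proof. by rewrite dotDl dotNl. Qed.

Lemma dotBr u v w : dot w (u - v) = dot w u - dot w v.
Proof. by rewrite dotDr dotNr. Qed.

Lemma dot0l u : dot 0 u = 0.
Proof. by rewrite /dot big1// => i _; rewrite mxE mul0r. Qed.

Lemma dot0r u : dot u 0 = 0.
Proof. by rewrite dotC dot0l. Qed.

Lemma dot_ge0 u : 0 <= dot u u.
Proof. by apply: sumr_ge0 => i _; rewrite -expr2 sqr_ge0. Qed.

Lemma dot_eq0 u : dot u u = 0 -> u = 0.
Proof.
move=> u0; apply/rowP => i; rewrite mxE; apply/eqP; rewrite -sqrf_eq0 expr2.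
have H j : true -> 0 <= u 0 j * u 0 j by rewrite -expr2 sqr_ge0.
by rewrite (psumr_eq0P H u0 (i := i)).
Qed.

Lemma dot_neq0 u : u != 0 -> 0 < dot u u.
Proof. by move=> u0; rewrite lt_def dot_ge0 andbT; apply: contraNneq u0 => /dot_eq0 ->. Qed.

Lemma dot_delta i u : dot 'e_i u = u 0 i.
Proof.
rewrite /dot (bigD1 i)//= mxE !eqxx mul1r big1 ?addr0// => j ji.
by rewrite mxE eqxx (negPf ji) mul0r.
Qed.

Lemma dot_ext u v : (forall a, dot a u = dot a v) -> u = v.
Proof. by move=> H; apply/rowP => i; rewrite -!dot_delta H. Qed.

Lemma dot_mx u v : dot u v = (u *m v^T) 0 0.
Proof. by rewrite mxE; apply: eq_bigr => i _; rewrite mxE. Qed.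

Lemma dot_mulmxl u v B : dot (u *m B) v = dot u (v *m B^T).
Proof. by rewrite !dot_mx trmx_mul trmxK mulmxA. Qed.

Lemma dot_skew u v B : B^T = - B -> dot (u *m B) v = - dot u (v *m B).
Proof. by move=> BT; rewrite dot_mulmxl BT mulmxN dotNr. Qed.

Lemma dot_skew0 u B : B^T = - B -> dot (u *m B) u = 0.
Proof.
move=> BT; have := dot_skew u u BT; rewrite [dot u (u *m B)]dotC => /eqP.
by rewrite -addr_eq0 -mulr2n mulrn_eq0 /= => /eqP.
Qed.

Lemma abs_coord_le1 u i : dot u u = 1 -> `|u 0 i| <= 1.
Proof.
move=> u1; rewrite -(@ler_pXn2r _ 2)// ?nnegrE// expr1n -normrX ger0_norm ?sqr_ge0//.
rewrite -u1 /dot (bigD1 i)//= -expr2 lerDl; apply: sumr_ge0 => j _.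
by rewrite -expr2 sqr_ge0.
Qed.

Lemma continuous_dot (T : topologicalType) (f g : T -> V) (t : T) :
  {for t, continuous f} -> {for t, continuous g} ->
  {for t, continuous (fun y => dot (f y) (g y))}.
Proof.
move=> cf cg; apply: continuous_for_sum => i; apply: continuousM.
  apply: (@continuous_comp _ _ _ f (fun y : V => y 0 i)) => //.
  exact: coord_continuous.
apply: (@continuous_comp _ _ _ g (fun y : V => y 0 i)) => //.
exact: coord_continuous.
Qed.

Lemma is_derive_rowP (W : normedModType R) (c : W -> V) (y z : W) u :
  is_derive y z c u <-> forall i, is_derive y z (fun y => c y 0 i) (u 0 i).
Proof.
split=> [[dc <-] i|dc].
  split; last by rewrite (derive_coord i dc).
  by move/derivable_mxP: dc; apply.
have D : derivable c y z by apply/derivable_mxP => i j; rewrite ord1; have [] := dc j.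
by split=> //; apply/rowP => i; rewrite (derive_coord i D); have [] := dc i.
Qed.

Lemma is_derive_dot (W : normedModType R) (c d : W -> V) (y z : W) u w :
  is_derive y z c u -> is_derive y z d w ->
  is_derive y z (fun t => dot (c t) (d t)) (dot (c y) w + dot u (d y)).
Proof.
move=> /is_derive_rowP dc /is_derive_rowP dd.
have E : (fun t => dot (c t) (d t)) = \sum_(i < m) (fun t => c t 0 i * d t 0 i).
  by apply/funext => t; rewrite fct_sumE.
rewrite E.
have dcd i : is_derive y z (fun t => c t 0 i * d t 0 i) (c y 0 i * w 0 i + u 0 i * d y 0 i).
  by have := is_deriveM (dc i) (dd i); rewrite /GRing.scale /= [u 0 i * _]mulrC.
have := is_derive_sum dcd; rewrite big_split; exact.
Qed.

End Dot.

(** * Graph charts of a hypersurface *)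

(** [local_def] lets the transverse direction vary with the point; one fixed [e] on all of [U] is
    what turns level sets of [phi] into graphs. *)
Definition frame (R : realType) m (M U : set 'rV[R]_m) (phi : 'rV[R]_m -> R) (e : 'rV[R]_m) :=
  [/\ smooth_on U phi, (forall x, U x -> 'D_e phi x != 0) &
      forall x, U x -> (M x <-> phi x = 0)].

Section LocalGeometry.
Variables (R : realType) (m : nat).
Local Notation V := 'rV[R]_m.
Variables (M U : set V) (phi : V -> R) (e : V).
Hypothesis fr : frame M U phi e.
Implicit Types (f g : V -> R) (u v a b c x y p h : V).

Let sphi : smooth_on U phi. Proof. by case: fr. Qed.
Let e_transverse x : U x -> 'D_e phi x != 0. Proof. by case: fr => _ + _; apply. Qed.
Let M_zero x : U x -> (M x <-> phi x = 0). Proof. by case: fr => _ _; apply. Qed.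
Let oU : open U. Proof. exact: smooth_open sphi. Qed.

(* Near [p], the level sets of [phi] are graphs over the displacements transverse to [e]; [slope v]
   is the derivative of the graph function in direction [v], [lift v] the corresponding tangent
   vector and [nab v] the derivative along it. Note [slope e = -1], hence [lift e = 0]. *)
Definition slope v x : R := - ('D_v phi x / 'D_e phi x).
Definition lift v x : V := v + slope v x *: e.
Definition nab v g x : R := 'D_v g x + slope v x * 'D_e g x.

Lemma slopeE v x : slope v x = - ('D_v phi x / 'D_e phi x). Proof. by []. Qed.

Lemma liftE v x : lift v x = v + slope v x *: e. Proof. by []. Qed.

Lemma smooth_slope v : smooth_on U (slope v).
Proof.
apply: smooth_opp; apply: smooth_mul; first exact: smooth_derive.
exact: smooth_inv e_transverse (smooth_derive e sphi).
Qed.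

Lemma smooth_nab v g : smooth_on U g -> smooth_on U (nab v g).
Proof.
move=> sg; apply: smooth_add; first exact: smooth_derive.
by apply: smooth_mul; [exact: smooth_slope | exact: smooth_derive].
Qed.

Lemma nabE v g x : smooth_on U g -> U x -> nab v g x = 'D_(lift v x) g x.
Proof. by move=> sg Ux; rewrite (derive_dirD _ _ sg)// (derive_dirZ _ _ sg). Qed.

Lemma lift_tangent v x : U x -> 'D_(lift v x) phi x = 0.
Proof. by move=> Ux; rewrite -nabE// /nab /slope mulNr divfK ?subrr// e_transverse. Qed.

Lemma tangent_lift v x : 'D_v phi x = 0 -> lift v x = v.
Proof. by move=> v0; rewrite /lift /slope v0 mul0r oppr0 scale0r addr0. Qed.

Lemma slopeD u v x : U x -> slope (u + v) x = slope u x + slope v x.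
Proof. by move=> Ux; rewrite /slope (derive_dirD _ _ sphi)// mulrDl opprD. Qed.

Lemma slopeZ (k : R) v x : U x -> slope (k *: v) x = k * slope v x.
Proof. by move=> Ux; rewrite /slope (derive_dirZ _ _ sphi)// -mulrA mulrN. Qed.

Lemma slope_sum v x : U x -> slope v x = \sum_i v 0 i * slope 'e_i x.
Proof.
move=> Ux; rewrite /slope (derive_dir_sum v sphi)// mulr_suml -sumrN.
by apply: eq_bigr => i _; rewrite mulrN mulrA.
Qed.

Lemma slope_e x : U x -> slope e x = -1.
Proof. by move=> Ux; rewrite /slope divff// e_transverse. Qed.

Lemma nabDdir u v g x : smooth_on U g -> U x -> nab (u + v) g x = nab u g x + nab v g x.
Proof. by move=> sg Ux; rewrite /nab (derive_dirD _ _ sg)// slopeD// mulrDl addrACA. Qed.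

Lemma nabZdir (k : R) v g x : smooth_on U g -> U x -> nab (k *: v) g x = k * nab v g x.
Proof. by move=> sg Ux; rewrite /nab (derive_dirZ _ _ sg)// slopeZ// -mulrA -mulrDr. Qed.

Lemma nab_e g x : U x -> nab e g x = 0.
Proof. by move=> Ux; rewrite /nab slope_e// mulN1r subrr. Qed.

Lemma nab_sum_dir v g x : smooth_on U g -> U x -> nab v g x = \sum_i v 0 i * nab 'e_i g x.
Proof.
move=> sg Ux; rewrite /nab (derive_dir_sum v sg)// slope_sum// mulr_suml -big_split.
by apply: eq_bigr => i _ /=; ring.
Qed.

Lemma nab_eq v f g x : U x -> (forall y, U y -> f y = g y) -> nab v f x = nab v g x.
Proof.
by move=> Ux fg; rewrite /nab; congr (_ + _ * _); apply: near_eq_derive; apply: near_open Ux _.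
Qed.

Lemma nabD v f g x : smooth_on U f -> smooth_on U g -> U x ->
  nab v (fun y => f y + g y) x = nab v f x + nab v g x.
Proof.
move=> sf sg Ux; have df w := smooth_derivable w sf Ux.
have dg w := smooth_derivable w sg Ux.
by rewrite /nab !derive_funD// mulrDr addrACA.
Qed.

Lemma nabM v f g x : smooth_on U f -> smooth_on U g -> U x ->
  nab v (fun y => f y * g y) x = f x * nab v g x + g x * nab v f x.
Proof.
move=> sf sg Ux; have df w := smooth_derivable w sf Ux.
have dg w := smooth_derivable w sg Ux.
rewrite /nab !derive_funM// !mulrDr addrACA.
by congr (_ + _ + (_ + _)); rewrite mulrCA.
Qed.

Lemma nab_cst v (k : R) x : nab v (fun=> k) x = 0.
Proof. by rewrite /nab !derive_cst mulr0 addr0. Qed.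

Lemma nabZ v (k : R) g x : smooth_on U g -> U x -> nab v (fun y => k * g y) x = k * nab v g x.
Proof.
move=> sg Ux; have sk := smooth_cst k oU.
by rewrite (nabM v sk sg Ux) nab_cst mulr0 addr0.
Qed.

Lemma nabN v g x : smooth_on U g -> U x -> nab v (fun y => - g y) x = - nab v g x.
Proof.
move=> sg Ux; have dg w := smooth_derivable w sg Ux.
by rewrite /nab !derive_funN// mulrN -opprD.
Qed.

Lemma nab_sum v (I : Type) (r : seq I) (F : I -> V -> R) x :
  (forall i, smooth_on U (F i)) -> U x ->
  nab v (fun y => \sum_(i <- r) F i y) x = \sum_(i <- r) nab v (F i) x.
Proof.
move=> sF Ux; elim: r => [|i r IH].
  rewrite big_nil; apply: etrans (nab_cst v 0 x); apply: nab_eq => // y _; by rewrite big_nil.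
have sr := smooth_sum r oU sF.
rewrite big_cons -IH -(nabD v (sF i) sr Ux).
apply: nab_eq => // y _; by rewrite big_cons.
Qed.

Lemma derive_slope u v x : U x -> 'D_u (slope v) x =
    - ('D_u ('D_v phi) x / 'D_e phi x) + 'D_v phi x * 'D_u ('D_e phi) x / 'D_e phi x ^+ 2.
Proof.
move=> Ux; have e0 := e_transverse Ux.
have sv := smooth_derive v sphi; have se := smooth_derive e sphi.
have si := smooth_inv e_transverse se.
have Dn := derive_funN (smooth_derivable u (smooth_mul sv si) Ux).
have Dm := derive_funM (smooth_derivable u sv Ux) (smooth_derivable u si Ux).
have Dv := @derive_funV _ _ ('D_e phi) x u e0 (smooth_derivable u se Ux).
rewrite [LHS]Dn Dm Dv.
move: ('D_u _ _) ('D_v _ _) ('D_u _ _) ('D_e phi x) e0 => A B C D D0.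
by field.
Qed.

(** [slope] is the gradient of the graph function [f], so [nab a (slope b)] is [f_ab] and this is
    the symmetry of its Hessian. *)
Lemma nab_slopeC a b x : U x -> nab a (slope b) x = nab b (slope a) x.
Proof.
move=> Ux.
have alg (Aab Aba Aea Aae Aeb Abe Aee E F G : R) : Aab = Aba -> Aea = Aae -> Aeb = Abe -> G != 0 ->
    - (Aab / G) + F * Aae / G ^+ 2 + - (E / G) * (- (Aeb / G) + F * Aee / G ^+ 2) =
    - (Aba / G) + E * Abe / G ^+ 2 + - (F / G) * (- (Aea / G) + E * Aee / G ^+ 2).
  by move=> -> -> -> G0; field.
rewrite /nab (derive_slope a b Ux) (derive_slope e b Ux) (derive_slope b a Ux).
rewrite (derive_slope e a Ux).
exact: alg (derive_comm a b sphi Ux) (derive_comm e a sphi Ux) (derive_comm e b sphi Ux)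
  (e_transverse Ux).
Qed.

Lemma derive_nab u v g x : smooth_on U g -> U x -> 'D_u (nab v g) x = 'D_u ('D_v g) x +
    (slope v x * 'D_u ('D_e g) x + 'D_e g x * 'D_u (slope v) x).
Proof.
move=> sg Ux; have sv := smooth_derive v sg; have se := smooth_derive e sg.
have ss := smooth_slope v.
have Da := derive_funD (smooth_derivable u sv Ux) (smooth_derivable u (smooth_mul ss se) Ux).
have Dm := derive_funM (smooth_derivable u ss Ux) (smooth_derivable u se Ux).
by rewrite [LHS]Da Dm.
Qed.

(** The first-order terms produced by differentiating the slopes cancel by [nab_slopeC]. As a
    consequence third derivatives may be permuted without curvature terms. *)
Lemma nabC a b g x : smooth_on U g -> U x -> nab a (nab b g) x = nab b (nab a g) x.
Proof.
move=> sg Ux.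
have alg (A1 A1' A2 A2' A3 A3' A4 B1 B2 B3 B4 s1 s2 G : R) :
    A1 = A1' -> A2 = A2' -> A3 = A3' -> B1 + s1 * B2 = B3 + s2 * B4 ->
    A1 + (s2 * A3' + G * B1) + s1 * (A2 + (s2 * A4 + G * B2)) =
    A1' + (s1 * A2' + G * B3) + s2 * (A3 + (s1 * A4 + G * B4)).
  move=> -> -> -> S; have -> : B1 = B3 + s2 * B4 - s1 * B2 by rewrite -S; ring.
  by ring.
have E u v : nab u (nab v g) x =
    'D_u ('D_v g) x + (slope v x * 'D_u ('D_e g) x + 'D_e g x * 'D_u (slope v) x) +
    slope u x * ('D_e ('D_v g) x + (slope v x * 'D_e ('D_e g) x + 'D_e g x * 'D_e (slope v) x)).
  by congr (_ + _ * _); exact: derive_nab.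
rewrite (E a b) (E b a).
exact: alg (derive_comm a b sg Ux) (derive_comm e b sg Ux) (derive_comm e a sg Ux)
  (nab_slopeC a b Ux).
Qed.

(** Along the segment through [p] in direction [e], [phi] has opposite signs at the two ends; nearby
    parallel segments inherit these signs, and the intermediate value theorem yields a zero. *)
Lemma graph_exists p (eps : R) : M p -> U p -> 0 < eps ->
  exists2 r : R, 0 < r & forall h, `|h| < r ->
    exists2 t : R, `|t| <= eps & U (p + h + t *: e) /\ M (p + h + t *: e).
Proof.
move=> Mp Up eps0.
have phip : phi p = 0 by apply/(M_zero Up).
set D := 'D_e phi p; have D0 : D != 0 := e_transverse Up.
have nD : 0 < `|D| by rewrite normr_gt0.
have [d1 d10 H1] := continuous_for_ball (smooth_continuous (smooth_derive e sphi) Up) nD.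
have [d2 d20 H2] := open_ball_sub oU Up.
pose d := Num.min d1 d2; have dpos : 0 < d by rewrite lt_min d10.
pose N := 1 + `|e|; have N0 : 0 < N by rewrite ltr_pwDl.
pose rho := Num.min eps (d / (2 * N)).
have rho0 : 0 < rho by rewrite lt_min eps0 divr_gt0// mulr_gt0.
have box h t : `|h| < d / 2 -> `|t| <= rho -> `|p + h + t *: e - p| < d.
  move=> hd td; rewrite addrC !addrA addNr add0r.
  apply: le_lt_trans (ler_normD _ _) _; rewrite [ltRHS]splitr ltr_leD// normrZ.
  have : `|t| * N <= d / 2.
    rewrite -ler_pdivlMr// -mulrA -invfM; apply: le_trans td _; by rewrite ge_min lexx orbT.
  apply: le_trans; by rewrite ler_wpM2l// /N lerDr.
have bU h t : `|h| < d / 2 -> `|t| <= rho -> U (p + h + t *: e).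
  by move=> hd td; apply/H2/(lt_le_trans (box _ _ hd td)); rewrite ge_min lexx orbT.
have bD h t : `|h| < d / 2 -> `|t| <= rho -> `|'D_e phi (p + h + t *: e) - D| < `|D|.
  by move=> hd td; apply/H1/(lt_le_trans (box _ _ hd td)); rewrite ge_min lexx.
have z0 : `|0 : V| < d / 2 by rewrite normr0 divr_gt0.
have rr : `|rho| <= rho by rewrite gtr0_norm.
have rn : `|- rho| <= rho by rewrite normrN.
(* [t * D] has the sign expected of [phi] at parameter [t], which treats both signs of [D] at
   once. *)
have sg t : `|t| <= rho -> t != 0 -> 0 < phi (p + t *: e) * (t * D).
  move=> td t0.
  have kt k : 0 <= k <= 1 -> `|k * t| <= rho.
    move=> /andP[k0 k1]; rewrite normrM (ger0_norm k0); apply: le_trans td.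
    by rewrite ler_piMl.
  have [|k k01] := @line_MVT _ _ phi p e t.
    move=> k /kt kk; apply: smooth_derivable sphi _.
    by have := bU _ _ z0 kk; rewrite addr0.
  rewrite phip subr0 => ->; rewrite mulrACA mulr_gt0//.
    by rewrite -expr2 exprn_even_gt0.
  have := bD _ _ z0 (kt _ k01); rewrite addr0 ltr_norml.
  have [Dp|Dn] := ltrP 0 D.
    by rewrite gtr0_norm// => /andP[A _]; rewrite mulr_gt0//; lra.
  have {}Dn : D < 0 by rewrite lt_neqAle D0.
  by rewrite ltr0_norm// => /andP[_ A]; rewrite nmulr_lgt0//; lra.
have sp := sg _ rr (lt0r_neq0 rho0).
have sn := sg _ rn; rewrite oppr_eq0 (lt0r_neq0 rho0) in sn; have {}sn := sn isT.
have Uv t : `|t| <= rho -> U (p + t *: e) by move=> td; have := bU _ _ z0 td; rewrite addr0.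
have np t : `|t| <= rho -> 0 < phi (p + t *: e) * (t * D) ->
    exists2 r : R, 0 < r & forall h, `|h| < r -> 0 < phi (p + h + t *: e) * (t * D).
  move=> td s.
  have phi0 : phi (p + t *: e) != 0.
    by apply: contraTneq s => ->; rewrite mul0r ltxx.
  have n0 : 0 < `|phi (p + t *: e)| by rewrite normr_gt0.
  have [r r0 H] := continuous_for_ball (smooth_continuous sphi (Uv _ td)) n0.
  exists r => // h hr.
  have : `|phi (p + h + t *: e) - phi (p + t *: e)| < `|phi (p + t *: e)|.
    by apply: H; rewrite [p + h + _]addrAC [X in `|X|]addrC addKr.
  rewrite ltr_norml.
  have [Pp|Pn] := ltrP 0 (phi (p + t *: e)).
    have tD : 0 < t * D by rewrite -(pmulr_rgt0 _ Pp).
    by rewrite gtr0_norm// => /andP[A _]; rewrite mulr_gt0//; lra.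
  have {}Pn : phi (p + t *: e) < 0 by rewrite lt_neqAle phi0.
  have tD : t * D < 0 by rewrite -(nmulr_rgt0 _ Pn).
  by rewrite ltr0_norm// => /andP[_ A]; rewrite nmulr_lgt0//; lra.
have [r1 r10 K1] := np _ rr sp.
have [r2 r20 K2] := np _ rn sn.
exists (Num.min (d / 2) (Num.min r1 r2)); first by rewrite !lt_min divr_gt0//= r10.
move=> h; rewrite !lt_min => /and3P[hd h1 h2].
have [|||t] := @IVT _ (fun t => phi (p + h + t *: e)) (- rho) rho 0.
- by rewrite ge0_cp// ltW.
- apply: continuous_in_subspaceT => t; rewrite inE /= in_itv /= -ler_norml => td.
  apply: differentiable_continuous; apply/derivable1_diffP.
  by have [] := is_derive_line (smooth_derivable e sphi (bU _ _ hd td)).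
- have {}K1 := K1 _ h1; have {}K2 := K2 _ h2.
  move: K1 K2; set A := phi _; set B := phi _ => K1 K2.
  rewrite ge_min le_max.
  have [Dp|Dn] := ltrP 0 D.
    have : 0 < A by rewrite -(pmulr_lgt0 _ (mulr_gt0 rho0 Dp)).
    have : B < 0 by rewrite mulNr mulrN oppr_gt0 in K2; rewrite -(pmulr_llt0 _ (mulr_gt0 rho0 Dp)).
    by move=> /ltW -> /ltW ->; rewrite orbT.
  have {}Dn : rho * D < 0 by rewrite pmulr_rlt0// lt_neqAle D0.
  have : A < 0 by rewrite -(nmulr_lgt0 _ Dn).
  have : 0 < B by rewrite mulNr mulrN oppr_gt0 in K2; rewrite -(nmulr_llt0 _ Dn).
  by move=> /ltW -> /ltW ->; rewrite orbT.
rewrite in_itv /= -ler_norml => td phit; exists t; first by apply: le_trans td _; rewrite ge_min lexx.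
by split; [exact: bU | apply/M_zero => //; exact: bU].
Qed.

(** An implicit function theorem for [phi]. The parameter [h] ranges over the whole space and not
    over a complement of [e]; [tau] undoes displacements along [e], in accordance with
    [slope e = -1]. *)
Lemma graph p (eta : R) : M p -> U p -> 0 < eta -> exists r : R, exists tau : V -> R,
  [/\ 0 < r,
   (forall h, `|h| < r -> `|tau h| <= eta /\ U (p + h + tau h *: e) /\ M (p + h + tau h *: e)),
   (forall h, `|h| < r -> M (p + h) -> tau h = 0) &
   forall h v, `|h| < r -> is_derive h v tau (slope v (p + h + tau h *: e))].
Proof.
move=> Mp Up eta0.
have [d dpos HU] := open_ball_sub oU Up.
pose N := 1 + `|e|; have N0 : 0 < N by rewrite ltr_pwDl.
pose rho := Num.min eta (d / (2 * N)).
have rho0 : 0 < rho by rewrite lt_min eta0 divr_gt0// mulr_gt0.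
(* Heights are kept below [rho / 2] so that the sum of two of them stays within [rho], where [uniq]
   applies. *)
have rho20 : 0 < rho / 2 by rewrite divr_gt0.
have bU h t : `|h| < d / 2 -> `|t| <= rho -> U (p + h + t *: e).
  move=> hd td; apply: HU; rewrite addrC !addrA addNr add0r.
  apply: le_lt_trans (ler_normD _ _) _; rewrite [ltRHS]splitr ltr_leD// normrZ.
  have : `|t| * N <= d / 2.
    rewrite -ler_pdivlMr// -mulrA -invfM; apply: le_trans td _; by rewrite ge_min lexx orbT.
  apply: le_trans; by rewrite ler_wpM2l// /N lerDr.
have uniq h s t : `|h| < d / 2 -> `|s| <= rho -> `|t| <= rho ->
    M (p + h + s *: e) -> M (p + h + t *: e) -> s = t.
  move=> hd sr tr Ms Mt.
  have st k : 0 <= k <= 1 -> `|s + k * (t - s)| <= rho.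
    move=> /andP[k0 k1]; move: sr tr; rewrite !ler_norml => /andP[s1 s2] /andP[t1 t2].
    have B1 := mulr_ge0 k0; have B2 : 0 <= 1 - k by rewrite subr_ge0.
    by apply/andP; split; nra.
  have [|k k01] := @line_MVT _ _ phi (p + h + s *: e) e (t - s).
    by move=> k /st kk; rewrite -addrA -scalerDl; apply: smooth_derivable sphi (bU _ _ hd kk).
  rewrite -addrA -scalerDl subrKC.
  rewrite (M_zero (bU _ _ hd sr)).1// (M_zero (bU _ _ hd tr)).1// subrr => /esym/eqP.
  rewrite mulf_eq0 -addrA -scalerDl (negPf (e_transverse (bU _ _ hd (st _ k01)))) orbF.
  by rewrite subr_eq0 => /eqP.
have [r0 r00 H0] := graph_exists Mp Up rho20.
pose r := Num.min r0 (d / 2).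
have rpos : 0 < r by rewrite lt_min r00 divr_gt0.
have rr0 h : `|h| < r -> `|h| < r0 by rewrite lt_min => /andP[].
have rd h : `|h| < r -> `|h| < d / 2 by rewrite lt_min => /andP[].
have /choice[tau Htau] : forall h, exists t : R, `|h| < r ->
    `|t| <= rho / 2 /\ U (p + h + t *: e) /\ M (p + h + t *: e).
  move=> h; have [/rr0/H0[t ? ?]|_] := ltP `|h| r; last by exists 0.
  by exists t.
have z0 : `|0 : V| < r by rewrite normr0.
have rho2 : rho / 2 <= rho by rewrite ler_pdivrMr// ler_pMr// ler1n.
have tauz h : `|h| < r -> M (p + h) -> tau h = 0.
  move=> hr Mh; have [tr [_ Mt]] := Htau _ hr.
  apply: (uniq h) => //; first exact: rd.
    exact: le_trans rho2.
    by rewrite normr0 ltW.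
  by rewrite scale0r addr0.
exists r, tau; split=> //.
  move=> h /Htau[tr UM]; split=> //; apply: (le_trans tr); apply: (le_trans rho2).
  by rewrite ge_min lexx.
move=> h v hr.
have [tr [Ut Mt]] := Htau _ hr.
set a := p + h + tau h *: e in Ut Mt *.
suff C : (fun t : R => t^-1 *: (tau (t *: v + h) - tau h)) @ 0^' --> slope v a.
  by split; [exact: cvgP C | exact: cvg_lim C].
apply/cvgrPdist_lt => eps eps0.
have [d1 d10 H1] := continuous_for_ball (smooth_continuous (smooth_slope v) Ut) eps0.
pose eps1 := d1 / (2 * N); have eps10 : 0 < eps1 by rewrite divr_gt0// mulr_gt0.
pose eps2 := Num.min eps1 (rho / 2); have eps20 : 0 < eps2 by rewrite lt_min eps10.
have near_small (c : R) : 0 < c -> \forall t \near (0 : R)^', `|t *: v| < c.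
  move=> c0; have N1 : 0 < `|v| + 1 by rewrite ltr_wpDl.
  near=> t.
  have : `|t| < c / (`|v| + 1).
    near: t; apply: dnbhs0_lt; by rewrite divr_gt0.
  rewrite ltr_pdivlMr// normrZ; apply: le_lt_trans; by rewrite ler_wpM2l// lerDl.
have [r1 r10 K1] := graph_exists Mt Ut eps20.
near=> t.
have t0 : t != 0 by near: t; exact: nbhs_dnbhs_neq.
have tv1 : `|t *: v| < r1 by near: t; exact: near_small.
have tvd : `|t *: v| < d1 / 2 by near: t; apply: near_small; rewrite divr_gt0.
have tvr : `|t *: v| < r - `|h| by near: t; apply: near_small; rewrite subr_gt0.
have hvr k : 0 <= k <= 1 -> `|k *: (t *: v) + h| < r.
  move=> /andP[k0 k1]; apply: le_lt_trans (ler_normD _ _) _.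
  rewrite -ltrBrDr; apply: le_lt_trans tvr; by rewrite normrZ (ger0_norm k0) ler_piMl.
have o01 : 0 <= (1 : R) <= 1 by rewrite ler01 lexx.
have hv1 : `|t *: v + h| < r by have := hvr 1 o01; rewrite scale1r.
have [sr [Us Ms]] := Htau _ hv1.
set s := tau (t *: v + h) in sr Us Ms *.
(* continuity of [tau] at [h]: by uniqueness the graph through [a] is the same *)
have ds : `|s - tau h| <= eps1.
  have [t' t'e [_ Mt']] := K1 _ tv1.
  have t'1 : `|t'| <= eps1 by apply: le_trans t'e _; rewrite ge_min lexx.
  have t'r : `|t'| <= rho / 2 by apply: le_trans t'e _; rewrite ge_min lexx orbT.
  suff -> : s = tau h + t' by rewrite addrC addKr.
  apply: (uniq (t *: v + h)) => //; first exact: rd.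
  - exact: le_trans rho2.
  - by apply: le_trans (ler_normD _ _) _; rewrite [leRHS]splitr lerD.
  - move: Mt'; congr M.
    by apply/rowP => i; rewrite !mxE; ring.
have E : p + (t *: v + h) + s *: e = a + (1 : R) *: (t *: v + (s - tau h) *: e).
  by apply/rowP => i; rewrite !mxE; ring.
have zU k : 0 <= k <= 1 -> `|k *: (t *: v + (s - tau h) *: e)| < d1 /\
    U (a + k *: (t *: v + (s - tau h) *: e)).
  move=> /[dup] k01 /andP[k0 k1]; split.
    rewrite normrZ (ger0_norm k0).
    apply: (@le_lt_trans _ _ `|t *: v + (s - tau h) *: e|); first by rewrite ler_piMl.
    apply: le_lt_trans (ler_normD _ _) _; rewrite [ltRHS]splitr ltr_leD// normrZ.
    have : `|s - tau h| * N <= d1 / 2 by rewrite -ler_pdivlMr// -mulrA -invfM.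
    by apply: le_trans; rewrite ler_wpM2l// /N lerDr.
  have -> : a + k *: (t *: v + (s - tau h) *: e) =
      p + (k *: (t *: v) + h) + (tau h + k * (s - tau h)) *: e.
    by apply/rowP => i; rewrite !mxE; ring.
  apply: bU; first by apply: rd; exact: hvr.
  rewrite (_ : _ + _ = (1 - k) * tau h + k * s); last by ring.
  apply: le_trans (ler_normD _ _) _; rewrite !normrM (ger0_norm k0) ger0_norm ?subr_ge0//.
  have k1' : 1 - k <= 1 by rewrite lerBlDr lerDl.
  rewrite [leRHS]splitr lerD//; [apply: le_trans tr | apply: le_trans sr];
    by rewrite ler_piMl.
(* Both ends lie on [M], so the mean value theorem for [phi] identifies the difference quotient of
   [tau] with the slope at an intermediate point [z]. *)
have [|k k01] := @line_MVT _ _ phi a (t *: v + (s - tau h) *: e) 1.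
  by move=> k k01; rewrite mulr1; apply: smooth_derivable sphi (zU _ k01).2.
rewrite -E (M_zero Us).1// (M_zero Ut).1// subrr mul1r mulr1.
have [zd Uz] := zU _ k01; set z := a + _ in Uz *.
rewrite (derive_dirD _ _ sphi Uz) !(derive_dirZ _ _ sphi Uz) => Ez.
have -> : t^-1 *: (s - tau h) = slope v z.
  have e0 := e_transverse Uz.
  have : (s - tau h) * 'D_e phi z = - (t * 'D_v phi z) by apply/eqP; rewrite -addr_eq0 addrC -Ez.
  move=> /(canRL (mulfK e0)) ->; rewrite /slope /GRing.scale /=; field.
  by rewrite e0.
by rewrite distrC; apply: H1; rewrite /z addrC addKr.
Unshelve. all: by end_near. Qed.

(** Sending [p + h] to [psi h] is a retraction along [e] into [M]. That it fixes the nearby points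
    of [M] is what lets facts along chart lines reach all of them. *)
Lemma chart p (d : R) : M p -> U p -> 0 < d -> exists r : R, exists psi : V -> V,
  [/\ 0 < r, psi 0 = p,
   (forall h, `|h| < r -> [/\ `|psi h - p| < d, U (psi h) & M (psi h)]),
   (forall h, `|h| < r -> M (p + h) -> psi h = p + h) &
   forall h v, `|h| < r -> is_derive h v psi (lift v (psi h))].
Proof.
move=> Mp Up d0; pose N := 1 + `|e|; have N0 : 0 < N by rewrite ltr_pwDl.
have eps0 : 0 < d / (2 * N) by rewrite divr_gt0// mulr_gt0.
have [r [tau [r0 Ht Hz Hd]]] := graph Mp Up eps0.
pose psi h := p + h + tau h *: e.
exists (Num.min r (d / 2)), psi.
have rr h : `|h| < Num.min r (d / 2) -> `|h| < r by rewrite lt_min => /andP[].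
split.
- by rewrite lt_min r0 divr_gt0.
- by rewrite /psi Hz ?addr0 ?scale0r ?addr0// normr0.
- move=> h hr; have [te [Uh Mh]] := Ht _ (rr _ hr); split=> //.
  rewrite /psi addrC !addrA addNr add0r.
  apply: le_lt_trans (ler_normD _ _) _; rewrite [ltRHS]splitr ltr_leD//.
    by move: hr; rewrite lt_min => /andP[].
  rewrite normrZ; have : `|tau h| * N <= d / 2 by rewrite -ler_pdivlMr// -mulrA -invfM.
  by apply: le_trans; rewrite ler_wpM2l// /N lerDr.
- by move=> h /rr hr Mh; rewrite /psi Hz// scale0r addr0.
- move=> h v /rr hr; have [dt Dt] := Hd h v hr.
  have C : (fun t : R => t^-1 *: (psi (t *: v + h) - psi h)) @ 0^' --> lift v (psi h).
    have E : {near (0 : R)^', (fun t : R => v + (t^-1 * (tau (t *: v + h) - tau h)) *: e) =1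
         (fun t : R => t^-1 *: (psi (t *: v + h) - psi h))}.
      near=> t; have t0 : t != 0 by near: t; exact: nbhs_dnbhs_neq.
      by apply/rowP => i; rewrite !mxE; field.
    apply: cvg_trans (near_eq_cvg E) _; apply: cvgD; first exact: cvg_cst.
    by apply: cvgZr_tmp; rewrite -/(psi h) -Dt; exact: dt.
  by split; [exact: cvgP C | exact: cvg_lim C].
Unshelve. all: by end_near. Qed.

Lemma chart_line (psi : V -> V) (r : R) (t : R) v g :
  (forall h v, `|h| < r -> is_derive h v psi (lift v (psi h))) ->
  smooth_on U g -> U (psi (t *: v)) -> `|t *: v| < r ->
  is_derive t (1 : R) (fun s : R => g (psi (s *: v))) (nab v g (psi (t *: v))).
Proof.
move=> Hd sg Ut tr; have := is_derive_comp sg Ut (Hd _ v tr).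
rewrite -(nabE v sg Ut) => -[dg Dg].
have := @is_derive_line _ _ _ (fun h => g (psi h)) 0 v t; rewrite add0r => /(_ dg).
by rewrite Dg; under eq_fun do rewrite add0r.
Qed.

(** The radius is chosen before [g], so that one radius serves a whole family of functions. *)
Lemma nab_locally_cst p (d : R) : M p -> U p -> 0 < d ->
  exists2 r : R, 0 < r & (forall y, M y -> `|y - p| < r -> U y /\ `|y - p| < d) /\
    forall g, smooth_on U g ->
      (forall x v, M x -> U x -> `|x - p| < d -> nab v g x = 0) ->
      forall y, M y -> `|y - p| < r -> g y = g p.
Proof.
move=> Mp Up d0; have [r [psi [r0 psi0 HM Hu Hd]]] := chart Mp Up d0.
exists r => //; split=> [y My yr|g sg g0 y My yr].
  by have := HM _ yr; rewrite Hu// subrKC => // -[].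
set h := y - p in yr.
have <- : psi h = y by rewrite Hu// /h subrKC.
have tr (t : R) : 0 <= t <= 1 -> `|t *: h| < r.
  move=> /andP[t0 t1]; rewrite normrZ (ger0_norm t0).
  by apply: le_lt_trans yr; rewrite ler_piMl.
pose k t := g (psi (t *: h)).
have dk (t : R) : 0 <= t <= 1 -> is_derive t (1 : R) k 0.
  move=> /tr th; have [pd Ut Mt] := HM _ th.
  by rewrite -(g0 _ h Mt Ut pd); exact: chart_line Hd sg Ut th.
by have := is_derive0_segment dk; rewrite /k scale1r scale0r psi0.
Qed.

Lemma tangent_curve p v : M p -> U p -> exists k : R -> V,
  [/\ k 0 = p, is_derive (0 : R) (1 : R) k (lift v p) & \forall t \near (0 : R), M (k t)].
Proof.
move=> Mp Up; have [r [psi [r0 psi0 HM _ Hd]]] := chart Mp Up ltr01.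
exists (fun t => psi (t *: v)); split; first by rewrite scale0r.
  have [|d0 D0] := Hd 0 v; first by rewrite normr0.
  have := @is_derive_line _ _ _ psi 0 v 0; rewrite scale0r addr0 => /(_ d0).
  by rewrite D0 psi0; under eq_fun do rewrite add0r.
near=> t; have [//|_ _ //] := HM (t *: v).
rewrite normrZ; have N1 : 0 < `|v| + 1 by rewrite ltr_wpDl.
have : `|t| < r / (`|v| + 1).
  by near: t; apply: (@nbhs0_lt R R); rewrite divr_gt0.
by rewrite ltr_pdivlMr//; apply: le_lt_trans; rewrite ler_wpM2l// lerDl.
Unshelve. all: by end_near. Qed.

(** Along a curve in [M] with velocity [lift v p] the function is identically zero. Since [U'] is
    unrelated to the frame, this also compares different extensions and different defining
    functions. *)
Lemma tangent_vanish p v g (U' : set V) : M p -> U p -> smooth_on U' g -> U' p ->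
  (forall x, M x -> U' x -> g x = 0) -> 'D_(lift v p) g p = 0.
Proof.
move=> Mp Up sg Up' g0; have [k [k0 dk kM]] := tangent_curve v Mp Up.
have Uk : U' (k 0) by rewrite k0.
have [_] := is_derive_comp sg Uk dk; rewrite k0 => <-.
rewrite -[RHS](derive_cst (0 : R) (0 : R) (1 : R)); apply: near_eq_derive.
have ck : {for 0, continuous k}.
  by have [dk0 _] := dk; apply: differentiable_continuous; apply/derivable1_diffP.
have : nbhs (k 0) U' by apply: open_nbhs_nbhs; split=> //; exact: smooth_open sg.
move=> /ck kU'; near=> t; apply: g0; near: t => //.
Unshelve. all: by end_near. Qed.

Lemma nab_vanish p v g : M p -> U p -> smooth_on U g ->
  (forall x, M x -> U x -> g x = 0) -> nab v g p = 0.
Proof. by move=> Mp Up sg g0; rewrite (nabE v sg Up); exact: (tangent_vanish v Mp Up sg Up g0). Qed.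

Lemma nab_second_max p v g : M p -> U p -> smooth_on U g ->
  (forall x, M x -> g x <= g p) -> nab v (nab v g) p <= 0.
Proof.
move=> Mp Up sg gmax; have [r [psi [r0 psi0 HM _ Hd]]] := chart Mp Up ltr01.
have N1 : 0 < `|v| + 1 by rewrite ltr_wpDl.
pose d := r / (`|v| + 1); have dpos : 0 < d by rewrite divr_gt0.
have tr (t : R) : t \in `]- d, d[ -> `|t *: v| < r.
  rewrite in_itv /= -ltr_norml normrZ ltr_pdivlMr//; apply: le_lt_trans.
  by rewrite ler_wpM2l// lerDl.
pose k t := g (psi (t *: v)); pose k1 t := nab v g (psi (t *: v)).
have dk (t : R) : t \in `]- d, d[ -> is_derive t (1 : R) k (k1 t).
  by move=> /tr th; have [_ Ut Mt] := HM _ th; exact: chart_line Hd sg Ut th.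
have d0 : (0 : R) \in `]- d, d[ by rewrite in_itv /= oppr_lt0 dpos.
have dk1 : is_derive (0 : R) (1 : R) k1 (nab v (nab v g) p).
  have th := tr _ d0; have [_ Ut Mt] := HM _ th.
  by have := chart_line Hd (smooth_nab v sg) Ut th; rewrite scale0r psi0.
have kmax (t : R) : t \in `]- d, d[ -> k t <= k 0.
  by move=> /tr /HM[_ _ Mt]; rewrite /k scale0r psi0; exact: gmax.
exact: second_derive_max dpos dk dk1 kmax.
Qed.

End LocalGeometry.

(** * The Killing equation *)

Section KillingEquation.
Variables (R : realType) (m : nat).
Local Notation V := 'rV[R]_m.
Implicit Types (u v w x y z p : V).

Lemma coord_MVT (c : R -> V) (t : R) i :
  (forall k, 0 <= k <= 1 -> derivable c (k * t) 1) ->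
  exists2 k, 0 <= k <= 1 & c t 0 i - c 0 0 i = t * ('D_1 c (k * t)) 0 i.
Proof.
move=> dc.
have [|k k01] := @line_MVT R R (fun s => c s 0 i) 0 1 t.
  move=> k k01; rewrite add0r [_ *: 1]mulr1.
  by move/derivable_mxP: (dc k k01); apply.
rewrite !add0r [_ *: 1]mulr1 [_ *: 1]mulr1 => E; exists k => //.
by rewrite (derive_coord i (dc k k01)).
Qed.

Lemma norm_convex x y p (d k : R) : 0 <= k <= 1 -> `|x - p| < d -> `|y - p| < d ->
  `|y + k *: (x - y) - p| < d.
Proof.
move=> /andP[k0 k1] xd yd.
have -> : y + k *: (x - y) - p = (1 - k) *: (y - p) + k *: (x - p).
  by apply/rowP => i; rewrite !mxE; ring.
apply: le_lt_trans (ler_normD _ _) _; rewrite !normrZ (ger0_norm k0) ger0_norm ?subr_ge0//.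
have [->|kn0] := eqVneq k 0; first by rewrite subr0 mul1r mul0r addr0.
have {}k0 : 0 < k by rewrite lt_def kn0.
apply: (@lt_le_trans _ _ ((1 - k) * d + k * d)); last by rewrite -mulrDl subrK mul1r.
by apply: ler_ltD; [rewrite ler_wpM2l ?subr_ge0// ltW | rewrite ltr_pM2l].
Qed.

(** Provides the Lipschitz constant for comparing two orbits: the sum of the absolute values of all
    partial derivatives at [p], plus 1 to absorb their variation nearby. *)
Lemma derive_dir_bound (U : set V) (F : V -> V) p :
  smooth_on U F -> U p -> exists2 L : R, 0 < L & exists2 d : R, 0 < d &
    forall z, `|z - p| < d -> U z /\ forall u i, `|'D_u (fun y => F y 0 i) z| <= L * `|u|.
Proof.
move=> sF Up; have sFi i := smooth_row_coord i sF.
pose G z := \sum_i \sum_j `|'D_('e_j) (fun y => F y 0 i) z|.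
have cG : {for p, continuous G}.
  apply: continuous_for_sum => i; apply: continuous_for_sum => j.
  apply: (@continuous_comp _ _ _ ('D_('e_j) (fun y => F y 0 i)) Num.norm).
    exact: smooth_continuous (smooth_derive _ (sFi i)) Up.
  exact: norm_continuous.
have oU : open U by case: sF.
have [d1 d10 H1] := continuous_for_ball cG ltr01.
have [d2 d20 H2] := open_ball_sub oU Up.
have Gp : 0 <= G p by do 2 (apply: sumr_ge0 => ? _).
exists (G p + 1); first by rewrite ltr_wpDl.
exists (Num.min d1 d2); first by rewrite lt_min d10.
move=> z; rewrite lt_min => /andP[z1 z2]; have Uz := H2 _ z2; split=> // u i.
rewrite (derive_dir_sum u (sFi i) Uz).
apply: le_trans (ler_norm_sum _ _ _) _.
apply: (@le_trans _ _ (\sum_j `|u| * `|'D_('e_j) (fun y => F y 0 i) z|)).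
  by apply: ler_sum => j _; rewrite normrM ler_wpM2r// ler_coord_norm.
rewrite -mulr_sumr [leRHS]mulrC ler_wpM2l//.
apply: (@le_trans _ _ (G z)).
  rewrite /G [leRHS](bigD1 i)//= lerDl; apply: sumr_ge0 => k _; exact: sumr_ge0.
by have := H1 _ z1; rewrite ltr_norml => /andP[_ /ltW]; rewrite lerBlDl.
Qed.

Variables (M : set V) (xi : V -> V) (Phi : R -> V -> V).
Hypothesis flow : flow_of M xi Phi.
Hypothesis iso : forall t, isometry_of M (Phi t).
Hypothesis unit_xi : forall p, M p -> dot (xi p) (xi p) = 1.

Lemma flow_M t x : M x -> M (Phi t x). Proof. by move=> /flow[_ []]. Qed.

Lemma flow0 x : M x -> Phi 0 x = x. Proof. by move=> /flow[]. Qed.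

Lemma flow_derive t x : M x -> is_derive t (1 : R) (fun s => Phi s x) (xi (Phi t x)).
Proof. by move=> /flow[_ [_ [_ /(_ t)[d D]]]]; split. Qed.

(** The norm is the maximum of the coordinates, and each coordinate of a unit vector is at most 1 in
    absolute value. *)
Lemma flow_displacement t x : M x -> `|Phi t x - x| <= `|t|.
Proof.
move=> Mx; apply: norm_le_coord => // i; rewrite !mxE.
have [|k k01] := @coord_MVT (fun s => Phi s x) t i.
  by move=> k _; have [] := flow_derive (k * t) Mx.
rewrite flow0// => ->; have [_ ->] := flow_derive (k * t) Mx.
rewrite normrM ler_piMr//; apply: abs_coord_le1; apply: unit_xi; exact: flow_M.
Qed.

Section Separation.
Variables (p : V) (U : set V) (F : V -> V) (L d T : R).
Hypothesis Uext : local_ext M xi p U F.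
Hypothesis L0 : 0 < L.
Hypothesis HL : forall z, `|z - p| < d -> U z /\ forall u i, `|'D_u (fun y => F y 0 i) z| <= L * `|u|.
Hypothesis T0 : 0 < T.
Hypothesis TL : T * L <= 2^-1.

Lemma ext_increment y z i : `|y - p| < d -> `|z - p| < d ->
  `|F y 0 i - F z 0 i| <= L * `|y - z|.
Proof.
move=> yd zd; have [_ [sF _]] := Uext; have sFi := smooth_row_coord i sF.
have [|k k01] := @line_MVT _ _ (fun y => F y 0 i) z (y - z) 1.
  move=> k k01; rewrite mulr1; apply: smooth_derivable sFi _.
  exact: (HL (norm_convex k01 yd zd)).1.
rewrite scale1r subrKC mul1r mulr1 => ->.
exact: (HL (norm_convex k01 yd zd)).2.
Qed.

(** A Gronwall estimate without exponentials: at the time [c] where the separation [D] is largest,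
    [|D c| <= |D 0| + T L |D c|], and [T * L <= 2^-1] absorbs the last term. *)
Lemma flow_separation x y : M x -> M y ->
  (forall t, 0 <= t <= T -> `|Phi t x - p| < d) -> (forall t, 0 <= t <= T -> `|Phi t y - p| < d) ->
  forall t, 0 <= t <= T ->
    `|Phi t x - Phi t y - (x - y)| <= 2 * (T * L) * `|x - y|.
Proof.
move=> Mx My xd yd.
pose D t := Phi t x - Phi t y.
have dD t : is_derive t (1 : R) D (xi (Phi t x) - xi (Phi t y)).
  by apply: is_deriveB; exact: flow_derive.
have D0 : D 0 = x - y by rewrite /D !flow0.
have cD t : {for t, continuous D}.
  by have [dt _] := dD t; apply: differentiable_continuous; apply/derivable1_diffP.
have cn : {within `[0, T], continuous (fun t => `|D t|)}.
  apply: continuous_in_subspaceT => t _.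
  by apply: (@continuous_comp _ _ _ D Num.norm) => //; exact: norm_continuous.
have [c] := EVT_max (ltW T0) cn; rewrite in_itv /= => c0T cmax.
have xiF t z : 0 <= t <= T -> M z -> `|Phi t z - p| < d -> xi (Phi t z) = F (Phi t z).
  move=> tT Mz zd; have [_ [_ ->]] := Uext => //; first exact: flow_M.
  exact: (HL zd).1.
have incr t : 0 <= t <= T -> `|D t - D 0| <= T * L * `|D c|.
  move=> /andP[t0 tT]; apply: norm_le_coord.
    by rewrite mulr_ge0// mulr_ge0 ?ltW.
  move=> i; have [|k /andP[k0 k1]] := @coord_MVT D t i.
    by move=> k _; have [] := dD (k * t).
  rewrite !mxE => ->; have [_ ->] := dD (k * t).
  have kt : 0 <= k * t <= T.
    rewrite mulr_ge0//=; apply: le_trans tT; by rewrite ler_piMl.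
  rewrite !mxE normrM (ger0_norm t0) -mulrA ler_pM//.
  rewrite (xiF _ _ kt Mx (xd _ kt)) (xiF _ _ kt My (yd _ kt)).
  apply: le_trans (ext_increment i (xd _ kt) (yd _ kt)) _.
  by rewrite ler_wpM2l ?(ltW L0)//; apply: cmax; rewrite in_itv.
have Dc : `|D c| <= 2 * `|x - y|.
  have := incr c c0T; have : `|D c| <= `|D c - D 0| + `|D 0|.
    by rewrite -[in leLHS](subrK (D 0) (D c)) ler_normD.
  rewrite D0; have : T * L * `|D c| <= 2^-1 * `|D c| by rewrite ler_wpM2r.
  move: (T * L * _) `|D c - _| `|x - y| => A B C; lra.
move=> t tT; have := incr t tT; rewrite D0 => /le_trans; apply.
by rewrite [2 * _]mulrC -[leRHS]mulrA ler_wpM2l// mulr_ge0 ?ltW.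
Qed.

End Separation.

Lemma cvg_quotient_sq (c : R -> V) u (eps : R) : is_derive (0 : R) (1 : R) c u -> 0 < eps ->
  \forall s \near (0 : R)^', `|dot (s^-1 *: (c s - c 0)) (s^-1 *: (c s - c 0)) - dot u u| < eps.
Proof.
move=> [dc Dc] eps0.
have C : (fun s : R => s^-1 *: (c s - c 0)) @ 0^' --> u.
  rewrite -Dc; have E : (fun s : R => s^-1 *: (c s - c 0)) =
      (fun s : R => s^-1 *: (c (s *: (1 : R) + 0) - c 0)).
    by apply/funext => s; rewrite addr0 [s *: 1]mulr1.
  by rewrite E; exact: dc.
have cd : {for u, continuous (fun w : V => dot w w)}.
  by apply: continuous_dot; exact: cvg_id.
have := cvg_comp _ (fun w : V => dot w w) C cd.
by move=> /cvgrPdist_lt /(_ eps eps0); apply: filterS => s; rewrite distrC.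
Qed.

(* Joint smoothness of the flow is not given, so instead of exchanging derivatives in [t] and in
   space we compare the squared chords [|Phi_t x - Phi_t p|^2] at [t = 0] and at a small time [T]. *)
Lemma killing_equation (U UF : set V) phi e F p v : frame M U phi e -> U p -> M p ->
  local_ext M xi p UF F -> dot (lift phi e v p) ('D_(lift phi e v p) F p) = 0.
Proof.
move=> fr Up Mp extF; have [UFp [sF FE]] := extF.
set u0 := lift phi e v p.
have tan0 : tangent M p u0.
  exists U, phi; split; last exact: lift_tangent fr _ _ Up.
  have [sphi et Mz] := fr; split=> //; split=> //; split=> // x Ux.
  by exists e; exact: et.
have sFi i := smooth_row_coord i sF.
have [k [k0 dk kM]] := tangent_curve fr v Mp Up; rewrite -/u0 in dk.
(* The quadratic form [<w, D_w F>] written in coordinates, which exposes its joint continuity in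
   base point and vector. *)
pose H (zw : V * V) := \sum_i \sum_j zw.2 0 i * (zw.2 0 j * 'D_('e_j) (fun y => F y 0 i) zw.1).
have HE z w : UF z -> dot w ('D_w F z) = H (z, w).
  move=> Uz; apply: eq_bigr => i _.
  rewrite (derive_coord i (proj2 (proj2 sF [::] z Uz) w)) (derive_dir_sum w (sFi i) Uz).
  by rewrite mulr_sumr.
have HZ z w (s : R) : H (z, s *: w) = s ^+ 2 * H (z, w).
  rewrite /H mulr_sumr; apply: eq_bigr => i _; rewrite mulr_sumr; apply: eq_bigr => j _.
  rewrite !mxE; move: ('D_ _ _ _) => A; ring.
have cH : {for (p, u0), continuous H}.
  apply: continuous_for_sum => i; apply: continuous_for_sum => j.
  have cc l : {for (p, u0), continuous (fun zw : V * V => zw.2 0 l)}.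
    apply: (@continuous_comp _ _ _ (fun zw : V * V => zw.2) (fun y : V => y 0 l)).
      exact: cvg_snd.
    exact: coord_continuous.
  apply: continuousM => //; apply: continuousM => //.
  apply: (@continuous_comp _ _ _ (fun zw : V * V => zw.1) ('D_('e_j) (fun y => F y 0 i))).
    exact: cvg_fst.
  exact: smooth_continuous (smooth_derive _ (sFi i)) UFp.
rewrite HE//; apply/eqP; rewrite -normr_le0; apply/ler_addgt0Pl => eps2 eps20; rewrite addr0.
pose eps := eps2 / 2; have eps0 : 0 < eps by rewrite divr_gt0.
have [d1 d10 H1] := continuous_for_ball cH eps0.
have [L L0 [d2 d20 HL2]] := derive_dir_bound sF UFp.
pose d := Num.min d1 d2; have d0 : 0 < d by rewrite lt_min d10.
have HL z : `|z - p| < d -> UF z /\ forall u i, `|'D_u (fun y => F y 0 i) z| <= L * `|u|.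
  by rewrite lt_min => /andP[_]; exact: HL2.
have d20' : 0 < d / 2 by rewrite divr_gt0.
have N0 : 0 < `|u0| + 1 by rewrite ltr_wpDl.
(* The three bounds keep the orbits in the ball of radius [d], make [flow_separation] applicable,
   and hold the rescaled chord [w] within [d] of [u0]. [T] is fixed before the chord shrinks, so
   [T * eps] is an admissible tolerance. *)
pose T := Num.min (d / 2) (Num.min (2 * L)^-1 (d / (4 * L * (`|u0| + 1)))).
have T0 : 0 < T by rewrite !lt_min d20' invr_gt0 divr_gt0 ?mulr_gt0.
have Td : T <= d / 2 by rewrite ge_min lexx.
have TL : T * L <= 2^-1.
  have : T <= (2 * L)^-1 by rewrite !ge_min lexx orbT.
  by rewrite invfM ler_pdivlMr.
have TLu : 2 * (T * L) * (`|u0| + 1) <= d / 2.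
  have : T <= d / (4 * L * (`|u0| + 1)) by rewrite !ge_min lexx !orbT.
  rewrite ler_pdivlMr ?mulr_gt0// => A.
  rewrite (_ : 2 * (T * L) * _ = T * (4 * L * (`|u0| + 1)) / 2); last by field.
  by rewrite ler_pM2r.
have Te : 0 < T * eps by rewrite mulr_gt0.
have [UP [Psi [UPp [sPsi PsiE]]]] := (iso T).2.1 p Mp.
have ck : {for 0, continuous k}.
  by have [dk0 _] := dk; apply: differentiable_continuous; apply/derivable1_diffP.
have dPsi : is_derive (0 : R) (1 : R) (fun s => Psi (k s)) ('D_u0 Psi p).
  have dP : derivable Psi p u0 := proj2 (proj2 sPsi [::] p UPp) u0.
  apply/is_derive_rowP => i; rewrite (derive_coord i dP) -k0.
  apply: is_derive_comp dk; first exact: smooth_row_coord sPsi.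
  by rewrite k0.
have dPhi : is_derive (0 : R) (1 : R) (fun s => Phi T (k s)) ('D_u0 Psi p).
  apply: near_eq_is_derive dPsi.
  have : nbhs (k 0) UP by rewrite k0; apply: open_nbhs_nbhs; split=> //; case: sPsi.
  move=> /ck kU; near=> s; apply: PsiE; by near: s.
(* By isometry the squared difference quotients at times 0 and [T] tend to the same limit. *)
have Diso : dot ('D_u0 Psi p) ('D_u0 Psi p) = dot u0 u0.
  by apply: ((iso T).2.2 p u0 UP Psi) => //; split.
have near1 := cvg_quotient_sq dk Te.
have near2 := cvg_quotient_sq dPhi Te.
rewrite Diso in near2.
have near3 : \forall s \near (0 : R)^', `|s^-1 *: (k s - k 0) - u0| < Num.min 1 (d / 2).
  have [dk0 Dk] := dk.
  have C : (fun s : R => s^-1 *: (k s - k 0)) @ 0^' --> u0.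
    have E : (fun s : R => s^-1 *: (k s - k 0)) =
        (fun s : R => s^-1 *: (k (s *: (1 : R) + 0) - k 0)).
      by apply/funext => s; rewrite addr0 [s *: 1]mulr1.
    by rewrite E -Dk; exact: dk0.
  have mm : 0 < Num.min 1 (d / 2) by rewrite lt_min ltr01.
  by move/cvgrPdist_lt : C => /(_ _ mm); apply: filterS => s; rewrite distrC.
have near4 : \forall s \near (0 : R)^', M (k s) by apply: cvg_within kM.
have near5 : \forall s \near (0 : R)^', `|k s - p| < d / 2.
  apply: cvg_within; move/cvgrPdist_lt : ck => /(_ _ d20').
  by rewrite k0; apply: filterS => s; rewrite distrC.
near (0 : R)^' => s.
have s0 : s != 0 by near: s; exact: nbhs_dnbhs_neq.
have n1 : `|dot (s^-1 *: (k s - k 0)) (s^-1 *: (k s - k 0)) - dot u0 u0| < T * eps.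
  by near: s; exact: near1.
have n2 : `|dot (s^-1 *: (Phi T (k s) - Phi T (k 0))) (s^-1 *: (Phi T (k s) - Phi T (k 0)))
    - dot u0 u0| < T * eps by near: s; exact: near2.
have n3 : `|s^-1 *: (k s - k 0) - u0| < Num.min 1 (d / 2) by near: s; exact: near3.
have n4 : M (k s) by near: s; exact: near4.
have n5 : `|k s - p| < d / 2 by near: s; exact: near5.
rewrite k0 in n1 n2 n3.
set x := k s in n1 n2 n3 n4 n5.
have stay y t : M y -> `|y - p| < d / 2 -> 0 <= t <= T -> `|Phi t y - p| < d.
  move=> My yd /andP[t0 tT]; rewrite -(subrKA y) [ltRHS]splitr.
  apply: le_lt_trans (ler_normD _ _) _; apply: ler_ltD => //.
  by apply: le_trans (flow_displacement t My) _; rewrite ger0_norm// (le_trans tT).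
have xd t := stay x t n4 n5.
have pd t : 0 <= t <= T -> `|Phi t p - p| < d by apply: stay; rewrite ?subrr ?normr0.
have sep := flow_separation extF L0 HL T0 TL n4 Mp xd pd.
pose D t := Phi t x - Phi t p.
have dD t : is_derive t (1 : R) D (xi (Phi t x) - xi (Phi t p)).
  by apply: is_deriveB; exact: flow_derive.
have df t : is_derive t (1 : R) (fun t => dot (D t) (D t))
    (2 * dot (D t) (xi (Phi t x) - xi (Phi t p))).
  have [dd Dd] := is_derive_dot (dD t) (dD t).
  by split=> //; rewrite Dd [X in _ + X]dotC mulr_natl mulr2n.
(* The mean value theorem is used in time for the squared chord and then, with [l], in space for [F]
   along the chord; together they produce [H] at a nearby point and direction. *)
have [|c c01] := @line_MVT R R (fun t => dot (D t) (D t)) 0 1 T.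
  by move=> c _; have [] := df (0 + (c * T) *: 1).
have [_ ->] := df (0 + (c * T) *: 1).
rewrite !add0r [T *: 1]mulr1 [_ *: 1]mulr1.
set t := c * T; have t0T : 0 <= t <= T.
  by case/andP: c01 => c0 c1; rewrite /t mulr_ge0 ?(ltW T0)//= ler_piMl// ltW.
have xiF z : M z -> `|Phi t z - p| < d -> xi (Phi t z) = F (Phi t z).
  move=> Mz zd; symmetry; apply: FE; [exact: flow_M | exact: (HL _ zd).1].
rewrite (xiF _ n4 (xd _ t0T)) (xiF _ Mp (pd _ t0T)).
pose w := s^-1 *: D t; have Dw : D t = s *: w by rewrite /w scalerA divff// scale1r.
have [|l l01] := @line_MVT _ _ (fun z => dot (D t) (F z)) (Phi t p) (D t) 1.
  move=> l l01; rewrite mulr1.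
  have Uz := (HL _ (norm_convex l01 (xd _ t0T) (pd _ t0T))).1.
  have dF := derivableP (proj2 (proj2 sF [::] _ Uz) (D t)).
  by have [] := is_derive_dot (is_derive_cst (D t) _ (D t)) dF.
rewrite scale1r mul1r mulr1.
have Pz := norm_convex l01 (xd _ t0T) (pd _ t0T); rewrite -/(D t) in Pz.
set z := Phi t p + l *: D t in Pz *.
have Uz := (HL _ Pz).1.
have dF := derivableP (proj2 (proj2 sF [::] _ Uz) (D t)).
have [_ ->] := is_derive_dot (is_derive_cst (D t) z (D t)) dF.
rewrite dot0l addr0 /D subrKC -/(D t) -dotBr HE// [in H _]Dw HZ => -> E.
have Hzw : `|H (z, w) - H (p, u0)| < eps.
  apply: H1; rewrite prod_normE /= gt_max; apply/andP; split.
    by apply: lt_le_trans Pz _; rewrite ge_min lexx.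
  move: n3; rewrite lt_min => /andP[n31 n32].
  have -> : w - u0 = s^-1 *: (D t - (x - p)) + (s^-1 *: (x - p) - u0).
    by rewrite /w; move: (D t) => y; apply/rowP => i; rewrite !mxE; ring.
  apply: (@lt_le_trans _ _ d); last by rewrite ge_min lexx.
  rewrite [ltRHS]splitr; apply: le_lt_trans (ler_normD _ _) _; apply: ler_ltD => //.
  rewrite normrZ; apply: le_trans (ler_wpM2l (normr_ge0 _) (sep t t0T)) _.
  rewrite mulrCA -normrZ; apply: le_trans TLu.
  rewrite ler_wpM2l//; first by rewrite !mulr_ge0// ltW.
  rewrite -[s^-1 *: _](subrK u0) addrC; apply: le_trans (ler_normD _ _) _.
  by rewrite lerD2l ltW.
have D0 : D 0 = x - p by rewrite /D !flow0.
have E2 : dot (s^-1 *: (Phi T x - Phi T p)) (s^-1 *: (Phi T x - Phi T p)) -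
    dot (s^-1 *: (x - p)) (s^-1 *: (x - p)) = 2 * T * H (z, w).
  rewrite !dotZl !dotZr -D0 -/(D T) !mulrA -mulrBr E.
  by move: (H _) => A; field.
have : `|2 * T * H (z, w)| < 2 * T * eps.
  rewrite -E2; move: n1 n2; move: (dot (_ *: _) _) (dot (_ *: _) _) (dot u0 u0) => A B C.
  by rewrite !ltr_norml => /andP[? ?] /andP[? ?]; apply/andP; split; lra.
rewrite normrM gtr0_norm ?mulr_gt0// ltr_pM2l ?mulr_gt0// => A.
have : `|H (p, u0)| <= `|H (z, w)| + `|H (z, w) - H (p, u0)|.
  by rewrite -[in leLHS](subKr (H (z, w)) (H (p, u0))) ler_normB.
by move=> /le_trans; apply; rewrite [leRHS]splitr; apply: lerD; exact: ltW.
Unshelve. all: by end_near. Qed.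

End KillingEquation.

(** * Local rigidity *)

Section LinearAlgebra.
Variables (R : realType) (m : nat).
Local Notation V := 'rV[R]_m.

(** Supplies directions that are orthogonal to [e] and conjugate, for the Hessian of [f], to two
    given ones. *)
Lemma exists_dot_orthogonal (r1 r2 r3 : V) : (4 <= m)%N ->
  exists2 b : V, b != 0 & [/\ dot r1 b = 0, dot r2 b = 0 & dot r3 b = 0].
Proof.
move=> m4; pose A := col_mx r1 (col_mx r2 r3).
have : kermx A^T != 0.
  rewrite -mxrank_eq0 mxrank_ker subn_eq0 -ltnNge mxrank_tr.
  by apply: leq_ltn_trans (rank_leq_row _) _.
case/rowV0Pn => b /sub_kermxP bA b0; exists b => //.
have E : A *m b^T = 0 by rewrite -[A]trmxK -trmx_mul bA trmx0.
move: E; rewrite !mul_col_mx => E.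
have E1 : r1 *m b^T = 0 by have := congr1 usubmx E; rewrite col_mxKu => ->; apply/matrixP => i j; rewrite !mxE.
have := congr1 dsubmx E; rewrite col_mxKd => {}E.
have E2 : r2 *m b^T = 0 by have := congr1 usubmx E; rewrite col_mxKu => ->; apply/matrixP => i j; rewrite !mxE.
have E3 : r3 *m b^T = 0 by have := congr1 dsubmx E; rewrite col_mxKd => ->; apply/matrixP => i j; rewrite !mxE.
by rewrite !dot_mx E1 E2 E3 mxE.
Qed.

Lemma unitmx_inj (A : 'M[R]_m) : (forall u : V, u *m A = 0 -> u = 0) -> A \in unitmx.
Proof.
move=> H; rewrite -row_free_unit -kermx_eq0; apply/eqP/row_matrixP => i.
rewrite row0; apply: H; apply/sub_kermxP; exact: row_sub.
Qed.

Lemma continuous_det (T : topologicalType) (A : T -> 'M[R]_m) (t : T) :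
  (forall i j, {for t, continuous (fun s => A s i j)}) ->
  {for t, continuous (fun s => \det (A s))}.
Proof.
move=> cA; apply: continuous_for_sum => s; apply: continuousM; first exact: cst_continuous.
by apply: continuous_for_prod => i; exact: cA.
Qed.

End LinearAlgebra.

Lemma eq_opp_eq0 (R : realType) (x : R) : x = - x -> x = 0.
Proof. lra. Qed.

Section LocalRigidity.
Variables (R : realType) (m : nat).
Local Notation V := 'rV[R]_m.
Variables (M U : set V) (phi : V -> R) (e : V) (F : V -> V).
Hypothesis m4 : (4 <= m)%N.
Hypothesis fr : frame M U phi e.
Hypothesis sF : smooth_on U F.
Hypothesis killF : forall x a, M x -> U x ->
  dot (lift phi e a x) ('D_(lift phi e a x) F x) = 0.
Hypothesis tanF : forall x, M x -> U x -> 'D_(F x) phi x = 0.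
Hypothesis unitF : forall x, M x -> U x -> dot (F x) (F x) = 1.
Implicit Types (a b c d u v x y p : V).

Local Notation nab := (nab phi e).
Local Notation slope := (slope phi e).
Local Notation lift := (lift phi e).

Let oU : open U. Proof. by case: sF. Qed.

(* locked to keep unification from unfolding the derivative *)
Fact dF_key : unit. Proof. exact: tt. Qed.
Definition dF := locked_with dF_key (fun a x => 'D_(lift a x) F x).
Definition component a x := dot a (F x).
Local Notation z := component.
Local Notation w := (component e).

Lemma componentE a x : z a x = dot a (F x). Proof. by []. Qed.

Lemma dFE a x : dF a x = 'D_(lift a x) F x.
Proof. by rewrite /dF unlock. Qed.

Lemma smooth_component a : smooth_on U (z a).
Proof.
apply: smooth_sum => // i; apply: smooth_mul; first exact: smooth_cst.
exact: smooth_row_coord.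
Qed.

Lemma nab_component a b x : U x -> nab b (z a) x = dot a (dF b x).
Proof.
move=> Ux; rewrite (nabE phi e b (smooth_component a) Ux).
have dFx := derivableP (proj2 (proj2 sF [::] x Ux) (lift b x)).
have [_] := is_derive_dot (is_derive_cst a x (lift b x)) dFx.
by rewrite dot0l addr0 dFE.
Qed.

Lemma nab_componentD a b c x : U x -> nab c (z (a + b)) x = nab c (z a) x + nab c (z b) x.
Proof. by move=> Ux; rewrite !nab_component// dotDl. Qed.

Lemma nab_F k b x : U x -> nab b (z 'e_k) x = dF b x 0 k.
Proof. by move=> Ux; rewrite nab_component// dot_delta. Qed.

(** The inner product of [lift a] with the derivative of [F] along [lift b]; its skewness is the
    polarised Killing equation. *)
Definition bend a b x := nab b (z a) x + slope a x * nab b w x.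

Lemma smooth_bend a b : smooth_on U (bend a b).
Proof.
apply: smooth_add; first exact: smooth_nab fr _ _ (smooth_component a).
by apply: smooth_mul; [exact: smooth_slope fr _ | exact: smooth_nab fr _ _ (smooth_component e)].
Qed.

Lemma bend_skew a b x : M x -> U x -> bend a b x + bend b a x = 0.
Proof.
move=> Mx Ux.
have Q c : bend c c x = 0.
  by rewrite /bend !nab_component// -dotZl -dotDl dFE; exact: killF.
have alg (zaa zab zba zbb wa wb sa sb : R) : zaa + sa * wa = 0 -> zbb + sb * wb = 0 ->
    zaa + zba + (zab + zbb) + (sa + sb) * (wa + wb) = 0 ->
    zab + sa * wb + (zba + sb * wa) = 0.
  by move=> H1 H2 <-; rewrite -[LHS]addr0 -[LHS]addr0 -{1}H1 -H2; ring.
apply: (alg (nab a (z a) x) _ _ (nab b (z b) x)); [exact: (Q a) | exact: (Q b) |].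
have := Q (a + b); rewrite /bend (slopeD fr a b Ux).
rewrite (nabDdir fr a b (smooth_component (a + b)) Ux) (nabDdir fr a b (smooth_component e) Ux).
by rewrite (nab_componentD a b a Ux) (nab_componentD a b b Ux).
Qed.

Lemma nab_bend a b c x : U x -> nab c (bend a b) x =
  nab c (nab b (z a)) x + (slope a x * nab c (nab b w) x + nab b w x * nab c (slope a) x).
Proof.
move=> Ux; have S1 := smooth_nab fr b (smooth_component a); have S2 := smooth_slope fr a.
have S3 := smooth_nab fr b (smooth_component e).
by rewrite [LHS](nabD phi e c S1 (smooth_mul S2 S3) Ux) (nabM phi e c S2 S3 Ux).
Qed.

(** The derivative of [bend a b] along [c], with [f_ac w_b] replaced by [f_bc w_a]. These two terms
    trade places when [a] and [b] are swapped, so skewness survives, while symmetry in [b] and [c]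
    is gained. *)
Definition second_bend a b c x :=
  nab c (nab b (z a)) x + (nab c (slope b) x * nab a w x + slope a x * nab c (nab b w) x).

Lemma second_bendC a b c x : U x -> second_bend a b c x = second_bend a c b x.
Proof.
move=> Ux; rewrite /second_bend (nabC fr c b (smooth_component a) Ux) (nab_slopeC fr c b Ux).
by rewrite (nabC fr c b (smooth_component e) Ux).
Qed.

Lemma second_bend_skew a b c x : M x -> U x -> second_bend a b c x = - second_bend b a c x.
Proof.
move=> Mx Ux; apply/eqP; rewrite -addr_eq0; apply/eqP.
have S := smooth_add (smooth_bend a b) (smooth_bend b a).
have := nab_vanish fr c Mx Ux S (fun y My Uy => bend_skew a b My Uy).
rewrite (nabD phi e c (smooth_bend a b) (smooth_bend b a) Ux).
rewrite (nab_bend a b c Ux) (nab_bend b a c Ux) => <-.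
have alg (A1 A2 f1 f2 w1 w2 h1 h2 : R) :
    A1 + (f1 * w1 + h1) + (A2 + (f2 * w2 + h2)) = A1 + (h1 + w2 * f2) + (A2 + (h2 + w1 * f1)).
  by ring.
exact: alg.
Qed.

(* symmetric in the last two arguments and skew in the first two *)
Lemma second_bend0 a b c x : M x -> U x -> second_bend a b c x = 0.
Proof.
move=> Mx Ux; have C := second_bendC _ _ _ Ux; have K a b c := second_bend_skew a b c Mx Ux.
apply: eq_opp_eq0; by rewrite {1}K C K C K C !opprK.
Qed.

Lemma smooth_second_bend a b c : smooth_on U (second_bend a b c).
Proof.
have S g := smooth_nab fr c (smooth_nab fr b (smooth_component g)).
apply: smooth_add (S a) (smooth_add (smooth_mul _ _) (smooth_mul _ (S e))).
- exact: smooth_nab fr _ _ (smooth_slope fr b).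
- exact: smooth_nab fr _ _ (smooth_component e).
- exact: smooth_slope fr a.
Qed.

Lemma nab_second_bend a b c d x : U x -> nab d (second_bend a b c) x =
  nab d (nab c (nab b (z a))) x +
  ((nab c (slope b) x * nab d (nab a w) x + nab a w x * nab d (nab c (slope b)) x) +
   (slope a x * nab d (nab c (nab b w)) x + nab c (nab b w) x * nab d (slope a) x)).
Proof.
move=> Ux; have S g := smooth_nab fr c (smooth_nab fr b (smooth_component g)).
have S1 := smooth_nab fr c (smooth_slope fr b); have S2 := smooth_nab fr a (smooth_component e).
have S3 := smooth_slope fr a.
rewrite [LHS](nabD phi e d (S a) (smooth_add (smooth_mul S1 S2) (smooth_mul S3 (S e))) Ux).
rewrite (nabD phi e d (smooth_mul S1 S2) (smooth_mul S3 (S e)) Ux).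
by rewrite (nabM phi e d S1 S2 Ux) (nabM phi e d S3 (S e) Ux).
Qed.

(** In other words, the first variation of the minor [f_bc f_ad - f_bd f_ac] of the Hessian vanishes
    when [f] moves in the direction [w]. *)
Lemma gauss_bend a b c d x : M x -> U x ->
  nab c (slope b) x * nab d (nab a w) x + nab c (nab b w) x * nab d (slope a) x =
  nab d (slope b) x * nab c (nab a w) x + nab d (nab b w) x * nab c (slope a) x.
Proof.
move=> Mx Ux.
have E k l := nab_vanish fr l Mx Ux (smooth_second_bend a b k)
  (fun y My Uy => second_bend0 a b k My Uy).
have := E c d; have := E d c.
rewrite (nab_second_bend a b c d Ux) (nab_second_bend a b d c Ux).
have C g (sg : smooth_on U g) := nabC fr d c sg Ux.
have alg (A A' B1 B2 B3 B4 K1 K1' K2 K2' wa sa w1 w2 w3 w4 : R) : A = A' -> K1 = K1' -> K2 = K2' ->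
    A' + ((B1 * w1 + wa * K1') + (sa * K2' + w2 * B2)) = 0 ->
    A + ((B3 * w3 + wa * K1) + (sa * K2 + w4 * B4)) = 0 ->
    B3 * w3 + w4 * B4 = B1 * w1 + w2 * B2.
  move=> -> -> -> H1 H2; apply/eqP; rewrite -subr_eq0 -[X in _ == X](subrr 0) -{1}H2 -H1.
  by apply/eqP; ring.
exact: alg (C _ (smooth_nab fr b (smooth_component a))) (C _ (smooth_slope fr b))
  (C _ (smooth_nab fr b (smooth_component e))).
Qed.

Lemma slope_F x : M x -> U x -> slope (F x) x = 0.
Proof. by move=> Mx Ux; rewrite slopeE tanF// mul0r oppr0. Qed.

Lemma sum_F_nab c y : M y -> U y -> \sum_k z 'e_k y * nab c (z 'e_k) y = 0.
Proof.
move=> My Uy; have sz k := smooth_component 'e_k.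
have S k := smooth_mul (sz k) (sz k).
have Ssum := smooth_sum (index_enum 'I_m) oU S.
have E0 : forall x0, M x0 -> U x0 -> (\sum_k z 'e_k x0 * z 'e_k x0) - 1 = 0.
  move=> x0 M0 U0; rewrite -[X in _ - X](unitF M0 U0); apply/eqP; rewrite subr_eq0; apply/eqP.
  by apply: eq_bigr => k _; rewrite /component dot_delta.
have := nab_vanish fr c My Uy (smooth_add Ssum (smooth_cst (-1) oU)) E0.
rewrite (nabD phi e c Ssum (smooth_cst (-1) oU) Uy) nab_cst addr0.
rewrite (nab_sum fr c _ S Uy) => E.
apply: eq_opp_eq0; apply/eqP; rewrite -addr_eq0 -big_split /=; apply/eqP.
by apply: etrans _ E; apply: eq_bigr => k _; rewrite (nabM phi e c (sz k) (sz k) Uy).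
Qed.

Lemma dot_F_dF c y : M y -> U y -> dot (F y) (dF c y) = 0.
Proof.
move=> My Uy; apply: etrans _ (sum_F_nab c My Uy); apply: eq_bigr => k _.
by rewrite (nab_F k c Uy) /component dot_delta.
Qed.

(* differentiating [|F|^2 = 1] twice *)
Lemma dF_gram a b x : M x -> U x ->
  dot (dF a x) (dF b x) = nab b (slope a) x * nab (F x) w x.
Proof.
move=> Mx Ux.
have sz k := smooth_component 'e_k; have sn c k := smooth_nab fr c (sz k).
have S2 k := smooth_mul (sz k) (sn a k).
have := nab_vanish fr b Mx Ux (smooth_sum (index_enum 'I_m) oU S2) (fun y My Uy => sum_F_nab a My Uy).
rewrite (nab_sum fr b _ S2 Ux).
(* [second_bend0] replaces the second derivatives of [F]; weighted by the coordinates of [F], the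
   terms with [slope 'e_k] add up to [slope (F x) x], which is 0 because [F] is tangent. *)
have E k : nab b (fun y => z 'e_k y * nab a (z 'e_k) y) x =
    - (nab b (slope a) x * (F x 0 k * nab 'e_k w x)) - (nab b (nab a w) x * (F x 0 k * slope 'e_k x))
    + dF a x 0 k * dF b x 0 k.
  rewrite (nabM phi e b (sz k) (sn a k) Ux) !nab_F//.
  have := second_bend0 'e_k a b Mx Ux; rewrite /second_bend => /eqP.
  rewrite addr_eq0 => /eqP ->; rewrite {1}/component dot_delta.
  have alg (Fk f wk sk h d1 d2 : R) :
    Fk * - (f * wk + sk * h) + d1 * d2 = - (f * (Fk * wk)) - (h * (Fk * sk)) + d1 * d2 by ring.
  exact: alg.
rewrite (eq_bigr _ (fun k _ => E k)) big_split sumrB !sumrN /= -!mulr_sumr.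
rewrite -(nab_sum_dir fr (F x) (smooth_component e) Ux) -(slope_sum fr (F x) Ux) slope_F//.
by rewrite mulr0 subr0 addrC => /eqP; rewrite subr_eq0 => /eqP.
Qed.

Lemma dF_sum u x k : U x -> dF u x 0 k = \sum_i u 0 i * dF 'e_i x 0 k.
Proof.
move=> Ux; apply: etrans (esym (nab_F k u Ux)) (etrans (nab_sum_dir fr u (smooth_component _) Ux) _).
by apply: eq_bigr => i _; rewrite nab_F.
Qed.

(** Multiples of [e] always lie in the kernel because [lift e] is 0. *)
Definition nondegenerate x := forall u, dF u x = 0 -> exists k : R, u = k *: e.

Lemma dFD a b x : U x -> dF (a + b) x = dF a x + dF b x.
Proof.
move=> Ux; apply/rowP => k; rewrite mxE.
apply: etrans (esym (nab_F k (a + b) Ux)) (etrans (nabDdir fr a b (smooth_component _) Ux) _).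
by congr (_ + _); exact: nab_F.
Qed.

Lemma dFZ (k : R) a x : U x -> dF (k *: a) x = k *: dF a x.
Proof.
move=> Ux; apply/rowP => i; rewrite mxE.
apply: etrans (esym (nab_F i (k *: a) Ux)) (etrans (nabZdir fr k a (smooth_component _) Ux) _).
by congr (_ * _); exact: nab_F.
Qed.

Lemma dF_e x : U x -> dF e x = 0.
Proof. by move=> Ux; apply/rowP => i; rewrite mxE -(nab_F i e Ux) (nab_e fr _ Ux). Qed.

Lemma frame_neq0 x : U x -> e != 0.
Proof. by move=> Ux; case: fr => _ /(_ x Ux) + _; apply: contraNneq => ->; rewrite derive0. Qed.

(** For directions [u], [v] with [f_uv = 0] the Gauss relation reads [f_uu w_vv + f_vv w_uu = 0].
    The three pairs of a conjugate triple give a linear system which forces [w_aa = 0], all [f_uu]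
    being nonzero; two directions would give one equation for two unknowns. *)
Lemma nondegenerate_hessian0 a x : M x -> U x -> nondegenerate x -> nab a (nab a w) x = 0.
Proof.
move=> Mx Ux nd.
have [[k ->]|aNe] := pselect (exists k : R, a = k *: e).
  by rewrite (nabZdir fr k e (smooth_nab fr _ (smooth_component e)) Ux) (nab_e fr)// mulr0.
have f0 u : ~ (exists k : R, u = k *: e) -> nab u (slope u) x != 0.
  move=> uNe; have : dot (dF u x) (dF u x) != 0.
    by apply: contra_notN uNe => /eqP/dot_eq0; exact: nd.
  by rewrite dF_gram//; apply: contraNneq => ->; rewrite mul0r.
have perp b : b != 0 -> dot e b = 0 -> ~ (exists k : R, b = k *: e).
  move=> b0 eb [k bk]; move: eb; rewrite bk dotZr => /eqP; rewrite mulf_eq0.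
  by rewrite (gt_eqF (dot_neq0 (frame_neq0 Ux))) orbF => /eqP k0; move: b0; rewrite bk k0 scale0r eqxx.
have row u b : dot (\row_i nab 'e_i (slope u) x) b = nab b (slope u) x.
  rewrite (nab_sum_dir fr b (smooth_slope fr u) Ux) dotC.
  by apply: eq_bigr => i _; rewrite mxE.
have pair u v : nab v (slope u) x = 0 ->
    nab u (slope u) x * nab v (nab v w) x + nab v (slope v) x * nab u (nab u w) x = 0.
  move=> uv; have := gauss_bend v u u v Mx Ux; rewrite (nab_slopeC fr u v Ux) uv mul0r mulr0 addr0.
  by rewrite [nab u (nab u w) x * _]mulrC.
(* Orthogonality to [e] ensures that [b] and [c] are no multiples of it, so that [f_bb] and [f_cc]
   do not vanish. *)
have [b b0 [eb ab _]] := exists_dot_orthogonal e (\row_i nab 'e_i (slope a) x) 0 m4.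
have [c c0 [ec ac bc]] :=
  exists_dot_orthogonal e (\row_i nab 'e_i (slope a) x) (\row_i nab 'e_i (slope b) x) m4.
rewrite row in ab; rewrite row in ac; rewrite row in bc.
have := pair _ _ bc; have := pair _ _ ac; have := pair _ _ ab.
have := f0 _ aNe; have := f0 _ (perp _ b0 eb); have := f0 _ (perp _ c0 ec).
move: (nab a (slope a) x) (nab b (slope b) x) (nab c (slope c) x) => fa fb fc.
move: (nab a _ x) (nab b _ x) (nab c _ x) => wa wb wc fc0 fb0 fa0 E1 E2 E3.
have : 2 * (fb * fc) * wa = 0.
  have -> : 2 * (fb * fc) * wa = fc * (fa * wb + fb * wa) + fb * (fa * wc + fc * wa)
     - fa * (fb * wc + fc * wb) by ring.
  by rewrite E1 E2 E3 !mulr0 subr0 addr0.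
move=> /eqP; rewrite mulf_eq0 => /orP[|/eqP //].
by rewrite !mulf_eq0 (negPf fb0) (negPf fc0) pnatr_eq0.
Qed.

Lemma nondegenerate_hessian a b x : M x -> U x -> nondegenerate x -> nab b (nab a w) x = 0.
Proof.
move=> Mx Ux nd; have H c := nondegenerate_hessian0 c Mx Ux nd.
have sa := smooth_nab fr a (smooth_component e); have sb := smooth_nab fr b (smooth_component e).
have := H (a + b); have E y : U y -> nab (a + b) w y = nab a w y + nab b w y.
  by move=> Uy; exact: (nabDdir fr a b (smooth_component e) Uy).
rewrite (nab_eq fr _ Ux E) (nabD phi e _ sa sb Ux) (nabDdir fr a b sa Ux) (nabDdir fr a b sb Ux).
rewrite (H a) (H b) (nabC fr a b (smooth_component e) Ux) add0r addr0 => /eqP.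
by rewrite addr_eq0 => /eqP/eq_opp_eq0.
Qed.

Lemma nondegenerate_open p : U p -> nondegenerate p ->
  exists2 d : R, 0 < d & forall x, `|x - p| < d -> U x /\ nondegenerate x.
Proof.
move=> Up nd.
(* The Gram matrix of the derivative always has [e] in its kernel; the added rank one form of [e]
   removes it, and nondegeneracy becomes the nonvanishing of a continuous determinant. *)
pose H x := \matrix_(i, j) (dot (dF 'e_i x) (dF 'e_j x) + e 0 i * e 0 j).
have Hu u x : U x -> forall j, (u *m H x) 0 j = dot (dF u x) (dF 'e_j x) + dot u e * e 0 j.
  move=> Ux j; rewrite !mxE /dot mulr_suml.
  have -> : \sum_i dF u x 0 i * dF 'e_j x 0 i = \sum_i u 0 i * dot (dF 'e_i x) (dF 'e_j x).
    under [RHS]eq_bigr do rewrite mulr_sumr.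
    rewrite exchange_big; apply: eq_bigr => k _ /=.
    rewrite dF_sum// mulr_suml; apply: eq_bigr => i _.
    by rewrite mulrA.
  rewrite -big_split; apply: eq_bigr => i _; by rewrite mxE mulrDr mulrA.
have cH : {for p, continuous (fun x => \det (H x))}.
  apply: continuous_det => i j.
  have S := smooth_sum (index_enum 'I_m) oU (fun k => smooth_mul
    (smooth_nab fr 'e_i (smooth_component 'e_k)) (smooth_nab fr 'e_j (smooth_component 'e_k))).
  have := smooth_continuous (smooth_eq _ (smooth_add S (smooth_cst (e 0 i * e 0 j) oU))) Up.
  apply=> x Ux; rewrite mxE; congr (_ + _); apply: eq_bigr => k _; by rewrite !nab_F.
have Hp : \det (H p) != 0.
  rewrite -unitfE -unitmxE; apply: unitmx_inj => u uH.
  have : dot (u *m H p) u = 0 by rewrite uH dot0l.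
  have -> : dot (u *m H p) u = dot (dF u p) (dF u p) + dot u e ^+ 2.
    rewrite /dot; under eq_bigr do rewrite Hu//.
    under eq_bigr do rewrite mulrDl; rewrite big_split /=; congr (_ + _).
      transitivity (\sum_i \sum_k dF u p 0 k * (u 0 i * dF 'e_i p 0 k)).
        apply: eq_bigr => i _; rewrite mulr_suml; apply: eq_bigr => k _; ring.
      rewrite exchange_big; apply: eq_bigr => k _ /=.
      rewrite -mulr_sumr; congr (_ * _).
      by rewrite [RHS]dF_sum.
    rewrite -/(dot u e); transitivity (\sum_i dot u e * (e 0 i * u 0 i)).
      by apply: eq_bigr => i _; rewrite mulrA.
    by rewrite -mulr_sumr expr2; congr (_ * _); apply: eq_bigr => i _; rewrite mulrC.
  move=> /eqP; rewrite paddr_eq0 ?dot_ge0 ?sqr_ge0// sqrf_eq0 => /andP[/eqP/dot_eq0/nd[k ->]].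
  by rewrite dotZl mulf_eq0 (gt_eqF (dot_neq0 (frame_neq0 Up))) orbF => /eqP ->; rewrite scale0r.
have n0 : 0 < `|\det (H p)| by rewrite normr_gt0.
have [d1 d10 H1] := continuous_for_ball cH n0.
have [d2 d20 H2] := open_ball_sub oU Up.
exists (Num.min d1 d2); first by rewrite lt_min d10.
move=> x; rewrite lt_min => /andP[x1 x2]; have Ux := H2 _ x2; split=> // u u0.
have Hx : H x \in unitmx.
  rewrite unitmxE unitfE; have := H1 _ x1; apply: contraTneq => ->.
  by rewrite sub0r normrN ltxx.
have ee : dot e e != 0 by rewrite gt_eqF// dot_neq0// (frame_neq0 Ux).
(* Subtracting the projection of [u] to [e] does not change [dF] and makes the rank one term
   vanish. *)
exists (dot u e / dot e e); apply/eqP; rewrite -subr_eq0; apply/eqP.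
set k := _ / _; rewrite -scaleNr.
have : (u + (- k) *: e) *m H x = 0.
  apply/rowP => j; rewrite Hu// dFD// dFZ// dF_e// u0 scaler0 addr0 dot0l add0r mxE.
  by rewrite dotDl dotZl /k mulNr divfK// subrr mul0r.
by move=> /(congr1 (mulmx^~ (invmx (H x)))); rewrite mulmxK// mul0mx.
Qed.

(** Three integrations: [w_a] is constant since [w_ab = 0]; then [kap] is constant since its
    derivative is [z_a,bc + w_a f_bc], which is 0 by [second_bend0]; then [F - x B] is constant.
    Each one costs a smaller ball. *)
Lemma local_rigidity p : M p -> U p -> nondegenerate p ->
  exists (B : 'M[R]_m) (c : V) (d : R), [/\ B^T = - B, 0 < d &
    forall y, M y -> `|y - p| < d -> F y = y *m B + c].
Proof.
move=> Mp Up nd; have [d0 d00 ndx] := nondegenerate_open Up nd.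
have sw a := smooth_nab fr a (smooth_component e).
have [d1 d10 [in1 cst1]] := nab_locally_cst fr Mp Up d00.
have wc a y : M y -> `|y - p| < d1 -> nab a w y = nab a w p.
  apply: cst1 => // x v Mx Ux /ndx[_ nx]; exact: nondegenerate_hessian.
have [d2 d20 [in2 cst2]] := nab_locally_cst fr Mp Up d10.
pose kap a b y := nab b (z a) y + nab a w p * slope b y.
have skap a b : smooth_on U (kap a b).
  apply: smooth_add; first exact: smooth_nab fr _ _ (smooth_component a).
  by apply: smooth_mul; [exact: smooth_cst | exact: smooth_slope fr b].
have kc a b y : M y -> `|y - p| < d2 -> kap a b y = kap a b p.
  apply: cst2 => // x v Mx Ux xd.
  have S1 := smooth_nab fr b (smooth_component a); have S2 := smooth_slope fr b.
  rewrite [LHS](nabD phi e v S1 (smooth_mul (smooth_cst (nab a w p) oU) S2) Ux).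
  rewrite (nabZ fr v (nab a w p) S2 Ux) -(wc a _ Mx xd).
  have := second_bend0 a b v Mx Ux; rewrite /second_bend.
  have [_ nx] := ndx _ (in1 _ Mx xd).2.
  by rewrite (nondegenerate_hessian b v Mx Ux nx) mulr0 addr0 [_ * nab a w x]mulrC.
have [d3 d30 [in3 cst3]] := nab_locally_cst fr Mp Up d20.
(* [kap a b + kap b a] equals [bend a b + bend b a] at [p], whence the skewness of [B]. *)
pose B : 'M[R]_m := \matrix_(i, j) kap 'e_j 'e_i p.
have kapB b j : kap 'e_j b p = (b *m B) 0 j.
  rewrite mxE /kap (nab_sum_dir fr b (smooth_component _) Up) (slope_sum fr b Up) mulr_sumr -big_split.
  have alg (b1 n w1 s : R) : b1 * n + w1 * (b1 * s) = b1 * (n + w1 * s) by ring.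
  by apply: eq_bigr => i _; rewrite [in RHS]mxE; exact: alg.
exists B, (F p - p *m B), d3; split=> //.
  apply/matrixP => i j; rewrite !mxE; apply/eqP; rewrite -addr_eq0; apply/eqP.
  have := bend_skew 'e_i 'e_j Mp Up; rewrite /bend /kap.
  have alg (A1 A2 s1 s2 w1 w2 : R) : A1 + s1 * w2 + (A2 + s2 * w1) = 0 ->
      A1 + w1 * s2 + (A2 + w2 * s1) = 0 by move=> <-; ring.
  exact: alg.
have sx i := @smooth_coord R m U i oU.
move=> y My yd; apply/rowP => j.
have Sj : smooth_on U (fun x => z 'e_j x + \sum_i x 0 i * - B i j).
  apply: smooth_add; first exact: smooth_component.
  by apply: smooth_sum => // i; apply: smooth_mul => //; exact: smooth_cst.
suff : z 'e_j y + \sum_i y 0 i * - B i j = z 'e_j p + \sum_i p 0 i * - B i j.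
  have sumN (x : V) : \sum_i x 0 i * - B i j = - (x *m B) 0 j.
    by rewrite mxE -sumrN; apply: eq_bigr => i _; rewrite mulrN.
  rewrite !sumN /component !dot_delta => E.
  by rewrite mxE [X in _ + X]mxE [X in _ + (_ + X)]mxE -E addrCA subrr addr0.
apply: (cst3 _ Sj) => // x v Mx Ux xd.
have Sc i := smooth_mul (sx i) (smooth_cst (- B i j) oU).
rewrite (nabD phi e v (smooth_component 'e_j) (smooth_sum (index_enum 'I_m) oU Sc) Ux).
rewrite (nab_sum fr v _ Sc Ux).
have E i : nab v (fun x => x 0 i * - B i j) x = - (lift v x 0 i * B i j).
  rewrite (nabM phi e v (sx i) (smooth_cst (- B i j) oU) Ux) nab_cst mulr0 add0r.
  rewrite (nabE phi e v (sx i) Ux) mulrC mulrN; congr (- (_ * _)).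
  by have [_ ->] := is_derive_coord i x (lift v x).
rewrite (eq_bigr _ (fun i _ => E i)) sumrN.
have -> : \sum_i lift v x 0 i * B i j = (v *m B) 0 j + slope v x * (e *m B) 0 j.
  rewrite !mxE mulr_sumr -big_split; apply: eq_bigr => i _ /=.
  by rewrite liftE 2!mxE mulrDl mulrA.
(* Along [e] the constant [kap] is [- nab 'e_j w p], which cancels the slope term brought in by
   [lift v]. *)
rewrite -!kapB -(kc _ _ _ Mx xd) /kap (nab_e fr _ Up) (slope_e fr Up).
by move: (nab _ _ _) (nab _ _ _) (slope _ _) => A1 A2 A3; ring.
Qed.

End LocalRigidity.

(** * The field is affine *)

Section AffineField.
Variables (R : realType) (m : nat).
Local Notation V := 'rV[R]_m.
Implicit Types (a b u v x y p c : V) (B : 'M[R]_m).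

(** [F] is a smooth extension that agrees with [xi] on [M] only, so the conditions on it are imposed
    at points of [M] and differentiate it in tangent directions. *)
Definition killing_data (M U : set V) (xi : V -> V) phi (e : V) (F : V -> V) :=
  [/\ frame M U phi e, smooth_on U F,
      (forall x a, M x -> U x -> dot (lift phi e a x) ('D_(lift phi e a x) F x) = 0),
      (forall x, M x -> U x -> 'D_(F x) phi x = 0) &
      (forall x, M x -> U x -> dot (F x) (F x) = 1) /\ forall x, M x -> U x -> F x = xi x].

(** * Nondegeneracy at the farthest point, and the derivative of an affine field *)

Section Local.
Variables (M U : set V) (xi : V -> V) (phi : V -> R) (e : V) (F : V -> V).
Hypothesis kd : killing_data M U xi phi e F.

Local Notation nab := (nab phi e).
Local Notation slope := (slope phi e).
Local Notation lift := (lift phi e).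
Local Notation dF := (dF phi e F).
Local Notation z := (component F).

Let fr : frame M U phi e. Proof. by case: kd. Qed.
Let sF : smooth_on U F. Proof. by case: kd. Qed.
Let killF x a : M x -> U x -> dot (lift a x) ('D_(lift a x) F x) = 0.
Proof. by case: kd => _ _ + _ _; apply. Qed.
Let tanF x : M x -> U x -> 'D_(F x) phi x = 0.
Proof. by case: kd => _ _ _ + _; apply. Qed.
Let unitF x : M x -> U x -> dot (F x) (F x) = 1.
Proof. by case: kd => _ _ _ _ [+ _]; apply. Qed.
Let oU : open U. Proof. by case: sF. Qed.

Lemma nab_coord v x k : U x -> nab v (fun y => y 0 k) x = lift v x 0 k.
Proof.
move=> Ux; rewrite (nabE phi e v (smooth_coord k oU) Ux).
by have [_ ->] := is_derive_coord k x (lift v x).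
Qed.

Lemma lift_coord v x k : lift v x 0 k = v 0 k + slope v x * e 0 k.
Proof. by rewrite liftE 2!mxE. Qed.

Lemma smooth_lift_coord v k : smooth_on U (fun y => lift v y 0 k).
Proof.
apply: (@smooth_eq _ _ U (fun y => v 0 k + slope v y * e 0 k)).
  by move=> y _; rewrite lift_coord.
apply: smooth_add; first exact: smooth_cst.
by apply: smooth_mul; [exact: (smooth_slope fr v) | exact: smooth_cst].
Qed.

Lemma lift_neq0 v x : ~ (exists k : R, v = k *: e) -> lift v x != 0.
Proof.
move=> vNe; apply/eqP => /eqP; rewrite addr_eq0 => /eqP E; apply: vNe.
by exists (- slope v x); rewrite scaleNr.
Qed.

(** A chart line in direction [v] has velocity [lift v] and acceleration [f_vv e]. *)
Lemma nab_nab_sq v x : U x -> nab v (nab v (fun y => dot y y)) x =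
  2 * (dot (lift v x) (lift v x) + nab v (slope v) x * dot x e).
Proof.
move=> Ux; have sc k := @smooth_coord R m U k oU; have sl := smooth_lift_coord v.
have Scc k := smooth_mul (sc k) (sc k).
have Scl k := smooth_add (smooth_mul (sc k) (sl k)) (smooth_mul (sc k) (sl k)).
have E1 y : U y -> nab v (fun y => dot y y) y =
    \sum_k (y 0 k * lift v y 0 k + y 0 k * lift v y 0 k).
  move=> Uy; rewrite (nab_sum fr v (index_enum 'I_m) Scc Uy); apply: eq_bigr => k _.
  by rewrite (nabM phi e v (sc k) (sc k) Uy) nab_coord.
rewrite (nab_eq fr v Ux E1) (nab_sum fr v (index_enum 'I_m) Scl Ux).
have E2 k : nab v (fun y => lift v y 0 k) x = nab v (slope v) x * e 0 k.
  have S1 := smooth_cst (v 0 k) oU; have S2 := smooth_cst (e 0 k) oU.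
  have S3 := smooth_slope fr v.
  rewrite (nab_eq fr v Ux (fun y _ => lift_coord v y k)).
  rewrite (nabD phi e v S1 (smooth_mul S3 S2) Ux) (nabM phi e v S3 S2 Ux) !nab_cst.
  by rewrite add0r mulr0 add0r mulrC.
transitivity (\sum_k 2 * (lift v x 0 k * lift v x 0 k + nab v (slope v) x * (x 0 k * e 0 k))).
  apply: eq_bigr => k _; have S := smooth_mul (sc k) (sl k).
  rewrite (nabD phi e v S S Ux) (nabM phi e v (sc k) (sl k) Ux) E2 nab_coord//.
  by move: (lift v x 0 k) (nab _ _ _) => A C; ring.
by rewrite -mulr_sumr big_split /= -mulr_sumr.
Qed.

(** Maximality gives [|lift v|^2 + f_vv <p, e> <= 0], so [f_vv] is nonzero unless [v] is parallel to
    [e]. A further kernel vector [u] would give [f_uu w_F = 0], hence [w_F = 0], and by [dF_gram]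
    the whole derivative of [F] would vanish at [p]. Differentiating [slope F = 0] then makes [F p]
    a null direction of the Hessian, so parallel to [e]; being tangent it would be 0. *)
Lemma nondegenerate_farthest p : M p -> U p -> (forall x, M x -> dot x x <= dot p p) ->
  nondegenerate phi e F p.
Proof.
move=> Mp Up pmax.
have f0 v : ~ (exists k : R, v = k *: e) -> nab v (slope v) p != 0.
  move=> vNe.
  have S := smooth_sum (index_enum 'I_m) oU
    (fun k => smooth_mul (@smooth_coord R m U k oU) (@smooth_coord R m U k oU)).
  have := nab_second_max fr v Mp Up S pmax.
  rewrite [X in X <= _](nab_nab_sq v Up) pmulr_rle0// => H.
  apply: contraTneq H => ->; rewrite mul0r addr0 -ltNge.
  by apply: dot_neq0; exact: lift_neq0.
move=> u u0; have [//|uNe] := pselect (exists k : R, u = k *: e).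
have gram := dF_gram fr sF killF tanF unitF.
have al0 : nab (F p) (z e) p = 0.
  have := gram u u p Mp Up; rewrite u0 dot0l => /esym/eqP.
  by rewrite mulf_eq0 (negPf (f0 _ uNe)) => /eqP.
have dF0 v : dF v p = 0 by apply: dot_eq0; rewrite gram// al0 mulr0.
pose S x := \sum_k z 'e_k x * slope 'e_k x.
have sz k := smooth_component sF 'e_k; have ss k := smooth_slope fr 'e_k.
have Szs k := smooth_mul (sz k) (ss k).
have S0 x : M x -> U x -> S x = 0.
  move=> Mx Ux; rewrite -(slope_F e tanF Mx Ux) (slope_sum fr (F x) Ux).
  by apply: eq_bigr => k _; rewrite componentE dot_delta.
have fF v : nab (F p) (slope v) p = 0.
  have := nab_vanish fr v Mp Up (smooth_sum (index_enum 'I_m) oU Szs) S0.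
  rewrite (nab_sum fr v (index_enum 'I_m) Szs Up) => E.
  rewrite (nab_sum_dir fr (F p) (smooth_slope fr v) Up); apply: etrans _ E.
  apply: eq_bigr => k _; rewrite (nabM phi e v (sz k) (ss k) Up) (nab_F phi e sF k v Up) dF0 mxE.
  by rewrite mulr0 addr0 (nab_slopeC fr v 'e_k Up) componentE dot_delta.
have [k Fk] : exists k : R, F p = k *: e.
  by apply: contrapT => /f0; rewrite fF eqxx.
have := slope_F e tanF Mp Up; rewrite Fk (slopeZ fr k e Up) (slope_e fr Up) mulrN1 => /eqP.
rewrite oppr_eq0 => /eqP k0; have := unitF Mp Up.
by rewrite Fk k0 scale0r dot0l => /esym/eqP; rewrite oner_eq0.
Qed.

Lemma affine_dF B c x (d : R) b : M x -> U x -> 0 < d ->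
  (forall y, M y -> `|y - x| < d -> xi y = y *m B + c) -> dF b x = lift b x *m B.
Proof.
move=> Mx Ux d0 HB; have [d1 d10 H1] := open_ball_sub oU Ux.
pose U' := ball x (Num.min d d1).
have U'P y : U' y -> U y /\ `|y - x| < d.
  rewrite /U' -ball_normE /= distrC lt_min => /andP[yd yd1]; split=> //; exact: H1.
have oU' : open U' by exact: ball_open.
have Ux' : U' x by apply: ballxx; rewrite lt_min d0.
apply/rowP => j.
have sc k := smooth_mul (@smooth_coord R m U k oU) (smooth_cst (B k j) oU).
have S1 := smooth_sum (index_enum 'I_m) oU sc.
pose g y := z 'e_j y + - (\sum_k y 0 k * B k j) + - c 0 j.
have sg : smooth_on U g.
  apply: smooth_add; last exact: smooth_cst.
  by apply: smooth_add; [exact: smooth_component | exact: smooth_opp].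
have g0 y : M y -> U' y -> g y = 0.
  move=> My /U'P[Uy yd]; rewrite /g componentE dot_delta.
  have -> : F y = xi y by case: kd => _ _ _ _ [_]; apply.
  rewrite HB// mxE; have -> : (y *m B) 0 j = \sum_k y 0 k * B k j by rewrite mxE.
  by rewrite [_ + c 0 j]addrC addrK subrr.
have := tangent_vanish fr b Mx Ux (smooth_sub oU' (fun y Uy => (U'P y Uy).1) sg) Ux' g0.
rewrite -(nabE phi e b sg Ux).
have Sz := smooth_component sF 'e_j.
rewrite (nabD phi e b (smooth_add Sz (smooth_opp S1)) (smooth_cst (- c 0 j) oU) Ux) nab_cst addr0.
rewrite (nabD phi e b Sz (smooth_opp S1) Ux) (nabN phi e b S1 Ux) (nab_F phi e sF j b Ux).
move=> /eqP; rewrite subr_eq0 => /eqP ->; rewrite mxE (nab_sum fr b (index_enum 'I_m) sc Ux).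
apply: eq_bigr => k _.
rewrite (nabM phi e b (@smooth_coord R m U k oU) (smooth_cst (B k j) oU) Ux) nab_cst mulr0 add0r.
by rewrite nab_coord// mulrC.
Qed.

(** The difference vanishes on a tangent hyperplane, so it has rank at most one, and a skew matrix
    of rank at most one is zero. *)
Lemma skew_tangent_unique B1 B2 x : B1^T = - B1 -> B2^T = - B2 ->
  (forall b, lift b x *m B1 = lift b x *m B2) -> B1 = B2.
Proof.
move=> s1 s2 E; apply/eqP; rewrite -subr_eq0; apply/eqP; pose D : 'M[R]_m := B1 - B2; rewrite -/D.
have sD : D^T = - D by rewrite /D linearB /= s1 s2 opprB opprK addrC.
have lD u : u *m D = (- slope u x) *: (e *m D).
  have : lift u x *m D = 0 by rewrite mulmxBr E subrr.
  rewrite liftE mulmxDl -scalemxAl => /eqP; rewrite addr_eq0 => /eqP ->.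
  exact/esym/scaleNr.
have eD : e *m D = 0.
  apply: dot_ext => a; rewrite dotC dot_skew// lD dotZr dotC dot_skew0// mulr0 oppr0 dot0r.
  by [].
apply/row_matrixP => i; by rewrite row0 rowE lD eD scaler0.
Qed.

(** [F B] is normal, since [<F B, u> = - <F, u B> = - <F, d_u F> = 0] for tangent [u], and it is
    nonzero by nondegeneracy. A vector [k] with [k B = 0] is orthogonal to it, hence tangent and
    killed by the derivative of [F], hence 0. *)
Lemma skew_injective B p : M p -> U p -> B^T = - B -> nondegenerate phi e F p ->
  (forall b, dF b p = lift b p *m B) -> forall k : V, k *m B = 0 -> k = 0.
Proof.
move=> Mp Up sB nd dFB k kB.
have lF : lift (F p) p = F p by exact: (tangent_lift e (tanF Mp Up)).
have FB b : dot (F p *m B) (lift b p) = 0.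
  by rewrite dot_skew// -dFB (dot_F_dF fr sF unitF)// oppr0.
have eFB : dot (F p *m B) e != 0.
  apply/eqP => eFB.
  have : F p *m B = 0.
    apply: dot_eq0; have := FB (F p *m B); rewrite liftE dotDr dotZr eFB mulr0 addr0; exact.
  rewrite -lF -dFB => /nd[l Fl].
  have := slope_F e tanF Mp Up; rewrite Fl (slopeZ fr l e Up) (slope_e fr Up) mulrN1 => /eqP.
  rewrite oppr_eq0 => /eqP l0; have := unitF Mp Up.
  by rewrite Fl l0 scale0r dot0l => /esym/eqP; rewrite oner_eq0.
have sk : slope k p = 0.
  have : dot (F p *m B) k = 0 by rewrite dot_skew// kB dot0r oppr0.
  have := FB k; rewrite liftE dotDr dotZr => + kF; rewrite kF add0r => /eqP.
  by rewrite mulf_eq0 (negPf eFB) orbF => /eqP.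
have : dF k p = 0 by rewrite dFB liftE sk scale0r addr0.
move=> /nd[l kl]; move: sk; rewrite kl (slopeZ fr l e Up) (slope_e fr Up) mulrN1 => /eqP.
by rewrite oppr_eq0 => /eqP ->; rewrite scale0r.
Qed.

Lemma affine_nondegenerate B x : (forall k : V, k *m B = 0 -> k = 0) ->
  (forall b, dF b x = lift b x *m B) -> nondegenerate phi e F x.
Proof.
move=> injB dFB u; rewrite dFB => /injB; rewrite liftE => /eqP.
by rewrite addr_eq0 -scaleNr => /eqP ->; exists (- slope u x).
Qed.

Lemma continuous_affine_defect B b x j : U x ->
  {for x, continuous (fun y => dF b y 0 j - (lift b y *m B) 0 j)}.
Proof.
move=> Ux.
have sl k := smooth_mul (smooth_lift_coord b k) (smooth_cst (B k j) oU).
have S := smooth_add (smooth_nab fr b (smooth_component sF 'e_j))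
  (smooth_opp (smooth_sum (index_enum 'I_m) oU sl)).
apply: smooth_continuous (smooth_eq _ S) Ux => y Uy.
by rewrite (nab_F phi e sF j b Uy) mxE.
Qed.

End Local.

(** The set [C] fixes one pair [B], [c]. At a limit point the derivative is still [lift b B] by
    continuity, and injectivity of [B] restores nondegeneracy. The new local pair agrees with the
    old one on tangent vectors, then everywhere by skewness, and in the constant term at a common
    point. *)
Lemma affine_field (M : set V) (xi : V -> V) : (4 <= m)%N -> compact M -> connected M ->
  M !=set0 -> (forall p, M p -> exists U phi e F, U p /\ killing_data M U xi phi e F) ->
  exists B c, [/\ B^T = - B, B \in unitmx & forall x, M x -> xi x = x *m B + c].
Proof.
move=> m4 cM conM M0 loc.
have [p pM pmax] : exists2 p, p \in M & forall x, x \in M -> dot x x <= dot p p.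
  apply: EVT_max_rV => //; apply: continuous_subspaceT => x.
  by apply: continuous_dot; exact: cvg_id.
have Mp : M p by rewrite inE in pM.
have {}pmax x : M x -> dot x x <= dot p p by move=> Mx; apply: pmax; rewrite inE.
have rig U phi e F x (kd : killing_data M U xi phi e F) : M x -> U x -> nondegenerate phi e F x ->
    exists (B : 'M[R]_m) (c : V) (d : R), [/\ B^T = - B, 0 < d &
    forall y, M y -> `|y - x| < d -> xi y = y *m B + c].
  move=> Mx Ux nd; have [fr sF kF tF [uF Fx]] := kd.
  have [B [c [d [sB d0 HB]]]] := local_rigidity m4 fr sF kF tF uF Mx Ux nd.
  have [d1 d10 H1] := open_ball_sub (smooth_open (let: And3 s _ _ := fr in s)) Ux.
  exists B, c, (Num.min d d1); split=> //; first by rewrite lt_min d0.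
  by move=> y My; rewrite lt_min => /andP[yd yd1]; rewrite -Fx ?HB//; exact: H1.
have [U [phi [e [F [Up kd]]]]] := loc p Mp.
have nd := nondegenerate_farthest kd Mp Up pmax.
have [B [c [d [sB d0 HB]]]] := rig _ _ _ _ _ kd Mp Up nd.
have injB := skew_injective kd Mp Up sB nd (fun b => affine_dF kd b Mp Up d0 HB).
exists B, c; split=> //; first exact: unitmx_inj.
pose C := [set y : V | exists2 d : R, 0 < d & forall z, M z -> `|z - y| < d -> xi z = z *m B + c].
have oC : open C.
  rewrite openE => y [dy dy0 Hy]; apply/nbhs_ballP; exists (dy / 2); first by rewrite /= divr_gt0.
  move=> y'; rewrite -ball_normE /= => yy'; exists (dy / 2); first by rewrite divr_gt0.
  move=> w Mw wy'; apply: Hy => //; rewrite -(subrKA y') [ltRHS]splitr.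
  by apply: le_lt_trans (ler_normD _ _) _; rewrite ltrD// distrC.
have CM : M `&` C = M.
  apply: conM.
  - by exists p; split=> //; exists d.
  - by exists C.
  exists (closure (M `&` C)); first exact: closed_closure.
  apply/seteqP; split=> [x MCx|x [Mx clx]].
    by split; [case: MCx | exact: subset_closure].
  split=> //.
  have [Ux [phix [ex [Fx [Uxx kdx]]]]] := loc x Mx.
  have [fr sF kF tF [uF FxE]] := kdx.
  have oUx : open Ux by case: sF.
  have dFB b : dF phix ex Fx b x = lift phix ex b x *m B.
    apply/rowP => j; apply/eqP; rewrite -subr_eq0; apply/negPn/negP => Gx0.
    have n0 : 0 < `|dF phix ex Fx b x 0 j - (lift phix ex b x *m B) 0 j| by rewrite normr_gt0.
    have [d1 d10 H1] := continuous_for_ball (continuous_affine_defect (B := B) (b := b) (j := j) kdx Uxx) n0.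
    have [d2 d20 H2] := open_ball_sub oUx Uxx.
    have m0 : 0 < Num.min d1 d2 by rewrite lt_min d10.
    have [y [[My [dy dy0 Hy]]]] := clx _ (nbhsx_ballx x _ m0).
    rewrite -ball_normE /= distrC lt_min => /andP[yd1 yd2].
    have := H1 _ yd1; rewrite (affine_dF kdx b My (H2 _ yd2) dy0 Hy) subrr sub0r normrN.
    by rewrite ltxx.
  have ndx := affine_nondegenerate injB dFB.
  have [B1 [c1 [d1 [sB1 d10 HB1]]]] := rig _ _ _ _ _ kdx Mx Uxx ndx.
  have EB : B1 = B.
    have EE b : lift phix ex b x *m B1 = lift phix ex b x *m B.
      by rewrite -(affine_dF kdx b Mx Uxx d10 HB1) dFB.
    exact: skew_tangent_unique sB1 sB EE.
  have [y [[My [dy dy0 Hy]]]] := clx _ (nbhsx_ballx x _ d10).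
  rewrite -ball_normE /= distrC => yd1.
  have Ec : c1 = c.
    have := HB1 y My yd1; rewrite (Hy y My) ?subrr ?normr0// EB => /addrI; exact: esym.
  by exists d1 => //; rewrite -EB -Ec.
move=> x Mx; have [_ [dx dx0 Hx]] : (M `&` C) x by rewrite CM.
by apply: Hx => //; rewrite subrr normr0.
Qed.

Lemma local_def_frame (M U : set V) phi p : local_def M p U phi ->
  exists U' e, [/\ frame M U' phi e, U' p & forall x, U' x -> U x].
Proof.
move=> [Up [sphi [nz Mz]]]; have [e e0] := nz p Up.
have n0 : 0 < `|'D_e phi p| by rewrite normr_gt0.
have [d1 d10 H1] := continuous_for_ball (smooth_continuous (smooth_derive e sphi) Up) n0.
have [d2 d20 H2] := open_ball_sub (smooth_open sphi) Up.
pose U' := ball p (Num.min d1 d2).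
have U'P y : U' y -> `|y - p| < d1 /\ U y.
  rewrite /U' -ball_normE /= distrC lt_min => /andP[yd yd1]; split=> //; exact: H2.
have oU' : open U' by exact: ball_open.
exists U', e; split.
- split.
  + by apply: smooth_sub sphi => // x /U'P[].
  + move=> x /U'P[xd _]; have := H1 _ xd; apply: contraTneq => ->.
    by rewrite sub0r normrN ltxx.
  + by move=> x /U'P[_]; exact: Mz.
- by apply: ballxx; rewrite lt_min d10.
- by move=> x /U'P[].
Qed.

(** [tangent] only asks for some defining function. Such a [v] is the velocity of a curve in [M], on
    which every other defining function vanishes. *)
Lemma tangent_frame (M U : set V) phi e x v : frame M U phi e -> U x -> M x ->
  tangent M x v -> 'D_v phi x = 0.
Proof.
move=> [sphi _ Mz] Ux Mx [U' [phi' [ld v0]]].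
have [U2 [e' [fr' U2x _]]] := local_def_frame ld.
have E : lift phi' e' v x = v := tangent_lift e' v0.
rewrite -E; apply: (tangent_vanish fr' v Mx U2x sphi Ux).
by move=> y My Uy; apply/Mz.
Qed.

Lemma killing_data_exists (M : set V) (xi : V -> V) : hypersurface M -> killing M xi ->
  (forall p, M p -> dot (xi p) (xi p) = 1) ->
  forall p, M p -> exists U phi e F, U p /\ killing_data M U xi phi e F.
Proof.
move=> hM [[sxi txi] [Phi [fl iso]]] unit_xi p Mp.
have [U1 [phi ld]] := hM p Mp.
have [U2 [e [fr U2p _]]] := local_def_frame ld.
have [U3 [F [U3p [sF FE]]]] := sxi p Mp.
pose U := U2 `&` U3.
have oU : open U by apply: openI; [case: fr => -[] | case: sF].
have frU : frame M U phi e.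
  have [sphi et Mz] := fr; split.
  - by apply: smooth_sub sphi => // x [].
  - by move=> x [/et].
  - by move=> x [/Mz].
exists U, phi, e, F; split=> //; split=> //.
- by apply: smooth_sub sF => // x [].
- move=> x a Mx Ux.
  have ext : local_ext M xi x U3 F by split; [exact: Ux.2 | split].
  exact: (killing_equation fl iso unit_xi a frU Ux Mx ext).
- move=> x Mx Ux; rewrite FE//; [exact: (tangent_frame frU Ux Mx (txi x Mx)) | exact: Ux.2].
- split=> x Mx Ux; rewrite FE//; [exact: unit_xi | exact: Ux.2 | exact: Ux.2].
Qed.

End AffineField.

(** * Skew normal form and the sphere *)

Section SkewNormalForm.
Variables (R : realType) (m : nat).
Local Notation V := 'rV[R]_m.
Implicit Types (u w x y : V) (B : 'M[R]_m) (v : nat -> V) (om : nat -> R).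

(** The first-order condition at a maximum, tested at [t = a / (|b| + 1)]. *)
Lemma quadratic_le0 (a b : R) : (forall t : R, 2 * t * a + t ^+ 2 * b <= 0) -> a = 0.
Proof.
move=> H; apply/eqP; apply/negPn/negP => a0.
pose s := (`|b| + 1)^-1; have s0 : 0 < s by rewrite invr_gt0 ltr_wpDl.
have sb : - 1 <= s * b.
  have : `|s * b| <= 1.
    by rewrite normrM gtr0_norm// mulrC ler_pdivrMr ?ltr_wpDl// mul1r lerDl.
  by rewrite ler_norml => /andP[].
have := H (a * s); rewrite (_ : _ + _ = s * a ^+ 2 * (2 + s * b)); last by ring.
apply/negP; rewrite -ltNge mulr_gt0//; last by move: (s * b) sb => q; lra.
by rewrite mulr_gt0// exprn_even_gt0.
Qed.

Lemma continuous_row (T : topologicalType) (f : T -> V) (t : T) :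
  (forall i, {for t, continuous (fun s => f s 0 i)}) -> {for t, continuous f}.
Proof.
move=> cf; apply/cvgrPdist_le => eps e0.
have H : \forall s \near t, forall i, `|f t 0 i - f s 0 i| <= eps.
  by apply: filter_forall => i; have /cvgrPdist_le/(_ eps e0) := cf i.
by apply: filterS H => s Hs; apply: norm_le_coord (ltW e0) _ => i; rewrite !mxE.
Qed.

Lemma continuous_mulmx B : continuous (fun x : V => x *m B).
Proof.
move=> x; apply: continuous_row => i.
rewrite (_ : (fun s : V => (s *m B) 0 i) = fun s : V => \sum_k s 0 k * B k i); last first.
  by apply/funext => s; rewrite mxE.
apply: continuous_for_sum => k; apply: continuousM; first exact: coord_continuous.
exact: cst_continuous.
Qed.

Lemma compact_unit_perp k (v : nat -> V) :
  compact [set x : V | dot x x = 1 /\ forall i, (i < k)%N -> dot (v i) x = 0].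
Proof.
apply: bounded_closed_compact.
  exists 1; split=> // c c1 x [x1 _] /=; apply: le_trans (ltW c1).
  by apply: norm_le_coord => // i; exact: abs_coord_le1.
(* A sum of squares presents the set as the zero set of one continuous function, so that it is
   closed. *)
pose g x := (dot x x - 1) ^+ 2 + \sum_(i < k) dot (v i) x ^+ 2.
have -> : [set x : V | dot x x = 1 /\ forall i, (i < k)%N -> dot (v i) x = 0] =
    g @^-1` [set 0].
  apply/seteqP; split=> x /=.
    move=> [x1 x0]; rewrite /g x1 subrr expr0n add0r big1// => i _.
    by rewrite x0// expr0n.
  have sp : 0 <= \sum_(i < k) dot (v i) x ^+ 2 by apply: sumr_ge0 => i _; exact: sqr_ge0.
  move=> /eqP; rewrite paddr_eq0 ?sqr_ge0// sqrf_eq0 subr_eq0 => /andP[/eqP x1 /eqP s0].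
  split=> // i ik; apply/eqP; rewrite -sqrf_eq0; apply/eqP.
  by apply: (psumr_eq0P _ s0 (i := Ordinal ik)) => // j _; exact: sqr_ge0.
apply: closed_comp; last exact: closed_eq.
move=> x _; rewrite /g.
have cd1 : {for x, continuous (fun x : V => dot x x - 1)}.
  apply: continuousB; last exact: cst_continuous.
  by apply: continuous_dot; exact: cvg_id.
have cd2 : {for x, continuous (fun x => \sum_(i < k) dot (v i) x ^+ 2)}.
  apply: continuous_for_sum => i.
  have cd : {for x, continuous (fun x : V => dot (v i) x)}.
    by apply: continuous_dot; [exact: cst_continuous | exact: cvg_id].
  exact: (continuousM cd cd).
exact: (continuousD (continuousM cd1 cd1) cd2).
Qed.

Definition skew_family B k (v : nat -> V) (om : nat -> R) :=
  (forall i j, (i < 2 * k)%N -> (j < 2 * k)%N -> dot (v i) (v j) = (i == j)%:R) /\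
  forall l, (l < k)%N -> [/\ om l != 0, v (2 * l)%N *m B = om l *: v (2 * l).+1 &
     v (2 * l).+1 *m B = (- om l) *: v (2 * l)%N].

Lemma exists_perp k (v : nat -> V) : (k < m)%N ->
  exists2 b : V, dot b b = 1 & forall i, (i < k)%N -> dot (v i) b = 0.
Proof.
move=> km; pose A := \matrix_(i < k) v i.
have : kermx A^T != 0.
  rewrite -mxrank_eq0 mxrank_ker subn_eq0 -ltnNge mxrank_tr.
  by apply: leq_ltn_trans (rank_leq_row _) _.
case/rowV0Pn => b /sub_kermxP bA b0.
have b2 := dot_neq0 b0; pose s := Num.sqrt (dot b b).
have s0 : s != 0 by rewrite gt_eqF// sqrtr_gt0.
exists (s^-1 *: b).
  rewrite dotZl dotZr mulrA -expr2 exprVn sqr_sqrtr ?ltW// mulVf// gt_eqF//.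
move=> i ik; rewrite dotZr.
suff -> : dot (v i) b = 0 by rewrite mulr0.
have := congr1 (fun X : 'rV[R]_k => X 0 (Ordinal ik)) bA.
rewrite !mxE => E; rewrite -[RHS]E dotC; apply: eq_bigr => j _; by rewrite !mxE.
Qed.

Lemma skew_family_perp B k v om u : B^T = - B -> skew_family B k v om ->
  (forall i, (i < 2 * k)%N -> dot (v i) u = 0) ->
  forall i, (i < 2 * k)%N -> dot (v i) (u *m B) = 0.
Proof.
move=> sB [_ vB] u0 i ik.
have E : dot (v i) (u *m B) = - dot (v i *m B) u by rewrite dot_skew// opprK.
rewrite E; have lk : (i./2 < k)%N by rewrite ltn_half_double -mul2n.
have [_ ve vo] := vB _ lk.
have := odd_double_half i; rewrite -mul2n; case: (odd i) => /= Ei.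
  by rewrite -Ei add1n vo dotZl u0 ?mulr0 ?oppr0//; lia.
by rewrite -Ei add0n ve dotZl u0 ?mulr0 ?oppr0//; lia.
Qed.

(** Let [u] maximise [|u B|^2] among unit vectors orthogonal to the family. The defect
    [w = u B^2 + l2 u] is an admissible variation; the first-order condition gives [<u B, w B> = 0],
    and this number is also [- |w|^2]. So [u] and [u B] span an invariant plane, the partner [u B]
    being orthogonal to the family automatically. *)
Lemma skew_family_extend B k v om : B^T = - B -> (forall u, u *m B = 0 -> u = 0) ->
  (2 * k < m)%N -> skew_family B k v om -> exists v' om', skew_family B k.+1 v' om'.
Proof.
move=> sB injB km fam; have [orth vB] := fam.
pose K := [set x : V | dot x x = 1 /\ forall i, (i < 2 * k)%N -> dot (v i) x = 0].
have K0 : K !=set0 by have [b b1 b2] := exists_perp v km; exists b.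
have cq : {within K, continuous (fun x : V => dot (x *m B) (x *m B))}.
  apply: continuous_subspaceT => x.
  by have cB := @continuous_mulmx B x; exact: (continuous_dot cB cB).
have cK : compact K by exact: compact_unit_perp.
have [u] := EVT_max_rV K0 cK cq; rewrite inE => -[u1 u0] umax.
set l2 := dot (u *m B) (u *m B) in umax.
have l20 : 0 < l2.
  apply: dot_neq0; apply: contraTneq isT => /injB uz; move: u1; rewrite uz dot0l => /esym/eqP.
  by rewrite oner_eq0.
have hom x : x != 0 -> (forall i, (i < 2 * k)%N -> dot (v i) x = 0) ->
    dot (x *m B) (x *m B) <= l2 * dot x x.
  move=> x0 xv; have x2 := dot_neq0 x0; pose s := Num.sqrt (dot x x).
  have ss : s ^+ 2 = dot x x by rewrite sqr_sqrtr// ltW.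
  have := umax (s^-1 *: x); rewrite inE => H.
  have {}H : s ^- 2 * dot (x *m B) (x *m B) <= l2.
    have := H _; rewrite -scalemxAl !dotZl !dotZr !mulrA -expr2 exprVn; apply.
    split; first by rewrite dotZl dotZr mulrA -expr2 exprVn ss mulVf// gt_eqF.
    by move=> i ik; rewrite dotZr xv// mulr0.
  by move: H; rewrite ss mulrC ler_pdivrMr.
have uBv := skew_family_perp sB fam u0.
have uBB : u *m B *m B = - l2 *: u.
  have [w wE] : exists w, w = u *m B *m B + l2 *: u by eexists.
  have wu : dot w u = 0.
    by rewrite wE dotDl dotZl u1 mulr1 dot_skew// -/l2 addNr.
  have wv i : (i < 2 * k)%N -> dot (v i) w = 0.
    move=> ik; rewrite wE dotDr dotZr u0// mulr0 addr0.
    exact: (skew_family_perp sB fam uBv).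
  have E : dot (u *m B) (w *m B) = - dot w w.
    have -> : dot (u *m B) (w *m B) = - dot (u *m B *m B) w by rewrite [in RHS]dot_skew// opprK.
    by rewrite {2}wE dotDl dotZl [dot u _]dotC wu mulr0 addr0.
  have : dot (u *m B) (w *m B) = 0.
    apply: (@quadratic_le0 _ (dot (w *m B) (w *m B) - l2 * dot w w)) => t.
    have xd : dot (u + t *: w) (u + t *: w) = 1 + t ^+ 2 * dot w w.
      by rewrite dotDl !dotDr !dotZl !dotZr [dot u w]dotC wu u1; ring.
    have := hom (u + t *: w); rewrite xd mulmxDl -scalemxAl.
    rewrite dotDl !dotDr !dotZl !dotZr -/l2 [dot (w *m B) (u *m B)]dotC => H.
    have : u + t *: w != 0.
      apply: contra_eqN xd => /eqP ->; rewrite dot0l lt_eqF// ltr_wpDr//.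
      by rewrite mulr_ge0 ?sqr_ge0 ?dot_ge0.
    move=> /H{}H; have := H _.
    have H2 : forall i, (i < 2 * k)%N -> dot (v i) (u + t *: w) = 0.
      by move=> i ik; rewrite dotDr dotZr u0// wv// mulr0 addr0.
    move=> /(_ H2); rewrite -subr_le0; apply: le_trans.
    by rewrite le_eqVlt; apply/orP; left; apply/eqP; ring.
  rewrite E => /eqP; rewrite oppr_eq0 => /eqP/dot_eq0/eqP.
  by rewrite wE addr_eq0 -scaleNr => /eqP.
pose om0 := Num.sqrt l2; have om00 : 0 < om0 by rewrite sqrtr_gt0.
have om2 : om0 ^+ 2 = l2 by rewrite sqr_sqrtr// ltW.
pose u' := om0^-1 *: (u *m B).
have u'1 : dot u' u' = 1.
  by rewrite dotZl dotZr mulrA -expr2 exprVn om2 mulVf// gt_eqF.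
have uu' : dot u u' = 0 by rewrite dotC dotZl dot_skew0// mulr0.
have u'v i : (i < 2 * k)%N -> dot (v i) u' = 0.
  by move=> ik; rewrite dotZr uBv// mulr0.
pose v' i := if i == (2 * k)%N then u else if i == (2 * k).+1 then u' else v i.
have v'lt i : (i < 2 * k)%N -> v' i = v i.
  move=> ik; rewrite /v' (ltn_eqF ik) ltn_eqF// ltnS ltnW//.
have v'k : v' (2 * k)%N = u by rewrite /v' eqxx.
have v'k1 : v' (2 * k).+1 = u' by rewrite /v' eqxx gtn_eqF.
exists v', (fun l => if l == k then om0 else om l); split.
  have cases i : (i < 2 * k.+1)%N -> [\/ (i < 2 * k)%N, i = (2 * k)%N | i = (2 * k).+1].
    rewrite mulnS add2n ltnS leq_eqVlt => /orP[/eqP ->|]; first by apply: Or33.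
    by rewrite ltnS leq_eqVlt => /orP[/eqP ->|]; [apply: Or32 | apply: Or31].
  move=> i j /cases[ik|->|->] /cases[jk|->|->].
  - by rewrite !v'lt// orth.
  - by rewrite (v'lt i ik) v'k u0// ltn_eqF.
  - by rewrite (v'lt i ik) v'k1 u'v// ltn_eqF// ltnS ltnW.
  - by rewrite (v'lt j jk) v'k dotC u0// gtn_eqF.
  - by rewrite v'k u1 eqxx.
  - by rewrite v'k v'k1 uu' ltn_eqF.
  - by rewrite (v'lt j jk) v'k1 dotC u'v// gtn_eqF// ltnS ltnW.
  - by rewrite v'k v'k1 dotC uu' gtn_eqF.
  - by rewrite v'k1 u'1 eqxx.
move=> l; rewrite ltnS leq_eqVlt => /orP[/eqP ->|lk].
  rewrite eqxx v'k v'k1; split; first by rewrite gt_eqF.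
    by rewrite scalerA divff ?scale1r// gt_eqF.
  by rewrite -scalemxAl uBB scalerA -om2; congr (_ *: _); field; rewrite gt_eqF.
rewrite (ltn_eqF lk); have [? ? ?] := vB l lk.
have l2k : ((2 * l).+1 < 2 * k)%N by lia.
by rewrite !v'lt// ltnW.
Qed.

Lemma skew_family_exists B k : B^T = - B -> (forall u, u *m B = 0 -> u = 0) ->
  (2 * k <= m.+1)%N -> exists v om, skew_family B k v om.
Proof.
move=> sB injB; elim: k => [|k IH] km.
  by exists (fun=> 0), (fun=> 0); split=> // i j; rewrite muln0.
rewrite mulnS add2n ltnS in km.
have [v [om fam]] := IH (leq_trans (leqnSn _) (leq_trans km (leqnSn _))).
exact: skew_family_extend fam.
Qed.

Lemma skew_family_size B k v om : skew_family B k v om -> (2 * k <= m)%N.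
Proof.
move=> [orth _]; apply: (@mulmx1_min R _ _ (\matrix_(i < 2 * k) v i) (\matrix_(i < 2 * k) v i)^T).
apply/matrixP => i j; transitivity (dot (v i) (v j)); last by rewrite orth// mxE.
by rewrite mxE; apply: eq_bigr => l _; rewrite !mxE.
Qed.

(** For odd [m], [uphalf m] blocks would give [m + 1] orthonormal vectors, which [skew_family_size]
    excludes; this is how the ambient dimension is seen to be even. *)
Lemma skew_family_full B : B^T = - B -> (forall u, u *m B = 0 -> u = 0) ->
  exists N v om, m = (2 * N)%N /\ skew_family B N v om.
Proof.
move=> sB injB.
have [v [om fam]] : exists v om, skew_family B (uphalf m) v om.
  by apply: skew_family_exists => //; rewrite mul2n uphalfE -[leqRHS]odd_double_half leq_addl.
exists (uphalf m), v, om; split=> //; apply/eqP; rewrite eqn_leq (skew_family_size fam) andbT.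
by rewrite mul2n -leq_uphalf_double.
Qed.

End SkewNormalForm.

(** * Connectedness of the unit sphere *)

Section Sphere.
Variables (R : realType) (m : nat).
Local Notation V := 'rV[R]_m.
Implicit Types (x y : V).

(** The arc is the normalised segment, which misses the origin because [y] is not antipodal to
    [x]. *)
Lemma sphere_arc x y : dot x x = 1 -> dot y y = 1 -> y != - x ->
  exists C : set V, [/\ connected C, C x, C y & forall z, C z -> dot z z = 1].
Proof.
move=> x1 y1 yx; pose g (s : R) := (1 - s) *: x + s *: y.
have gE s : dot (g s) (g s) = (1 - s) ^+ 2 + s ^+ 2 + 2 * (s * (1 - s)) * dot x y.
  by rewrite /g dotDl !dotDr !dotZl !dotZr x1 y1 [dot y x]dotC; ring.
have xy : -1 < dot x y.
  have : 0 < dot (x + y) (x + y).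
    by apply: dot_neq0; rewrite addrC addr_eq0.
  by rewrite dotDl !dotDr x1 y1 [dot y x]dotC; lra.
have gpos s : 0 <= s <= 1 -> 0 < dot (g s) (g s).
  move=> /andP[s0 s1]; rewrite gE; have s1' : 0 <= 1 - s by rewrite subr_ge0.
  have ss := mulr_ge0 s0 s1'.
  have [s00|sn0] := eqVneq (s * (1 - s)) 0.
    rewrite s00 mulr0 mul0r addr0; nra.
  have {}ss : 0 < s * (1 - s) by rewrite lt_def sn0.
  have := sqr_ge0 (1 - s - s); nra.
pose c s := (Num.sqrt (dot (g s) (g s)))^-1 *: g s.
have cc s : 0 <= s <= 1 -> {for s, continuous c}.
  move=> s01.
  have cg : {for s, continuous g}.
    apply: continuousD.
      apply: continuousZr_tmp; apply: continuousB; [exact: cst_continuous | exact: cvg_id].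
    by apply: continuousZr_tmp; exact: cvg_id.
  have ci : {for s, continuous (fun s => (Num.sqrt (dot (g s) (g s)))^-1)}.
    apply: continuousV; first by rewrite gt_eqF// sqrtr_gt0 gpos.
    apply: (@continuous_comp _ _ _ (fun s => dot (g s) (g s)) Num.sqrt).
      exact: continuous_dot.
    exact: sqrt_continuous.
  exact: cvgZ ci cg.
exists (c @` `[0, 1]); split.
- apply: connected_continuous_connected; first exact: segment_connected.
  by apply: continuous_in_subspaceT => s; rewrite inE /= in_itv; exact: cc.
- exists 0; first by rewrite /= in_itv /= lexx ler01.
  by rewrite /c /g subr0 scale1r scale0r addr0 x1 sqrtr1 invr1 scale1r.
- exists 1; first by rewrite /= in_itv /= lexx ler01.
  by rewrite /c /g subrr scale0r scale1r add0r y1 sqrtr1 invr1 scale1r.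
move=> z [s]; rewrite /= in_itv /= => s01 <-; have gp := gpos s s01.
have n0 : 0 < Num.sqrt (dot (g s) (g s)) by rewrite sqrtr_gt0.
by rewrite /c dotZl dotZr mulrA -expr2 exprVn sqr_sqrtr ?ltW// mulVf// gt_eqF.
Qed.

(** Arcs from [x] reach every point but [- x]; arcs from a unit vector [z] orthogonal to [x] reach
    that one. *)
Lemma unit_sphere_connected : (2 <= m)%N -> connected (@unit_sphere R m).
Proof.
move=> m2.
have star x : dot x x = 1 -> exists D : set V,
    [/\ connected D, D `<=` @unit_sphere R m & forall y, dot y y = 1 -> y != - x -> D y].
  move=> x1.
  have /choice[C HC] : forall y, exists C : set V, dot y y = 1 /\ y != - x ->
      [/\ connected C, C x, C y & forall z, C z -> dot z z = 1].
    move=> y; have [[y1 yx]|nh] := pselect (dot y y = 1 /\ y != - x); last by exists set0.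
    by have [C HC] := sphere_arc x1 y1 yx; exists C.
  exists (\bigcup_(y in [set y | dot y y = 1 /\ y != - x]) C y); split.
  - apply: bigcup_connected; last by move=> y /HC[].
    by exists x => y /HC[].
  - by move=> z [y /HC[_ _ _ H] /H].
  - by move=> y y1 yx; exists y => //; have [] := HC y.
have [x x1 _] := @exists_perp R m 0 (fun=> 0) (leq_trans (isT : (0 < 2)%N) m2).
have [z z1 zx] := @exists_perp R m 1 (fun=> x) m2.
have {}zx : dot x z = 0 by exact: (zx 0%N).
have [D1 [c1 s1 H1]] := star x x1.
have [D2 [c2 s2 H2]] := star z z1.
have xNx : x != - x.
  apply/eqP => E; have := x1; rewrite {1}E dotNl x1 => /eqP; rewrite eqr_oppLR; move/eqP; lra.
have xNz : x != - z.
  by apply/eqP => E; move: zx; rewrite E dotNl z1 => /eqP; rewrite oppr_eq0 oner_eq0.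
have NxNz : - x != - z.
  by apply/eqP => /oppr_inj E; move: zx; rewrite E z1 => /eqP; rewrite oner_eq0.
have -> : @unit_sphere R m = D1 `|` D2.
  apply/seteqP; split=> [y y1|y [/s1|/s2]//].
  have [->|yx] := eqVneq y (- x); last by left; apply: H1.
  by right; apply: H2 => //; rewrite dotNl dotNr opprK.
apply: connectedU => //; exists x; split; [exact: H1 | exact: H2].
Qed.

End Sphere.

(** * The ellipsoid *)

Section Coordinates.
Variables (R : realType) (n N : nat).
Hypothesis nN : n.+1 = (2 * N)%N.
Local Notation V := 'rV[R]_n.+1.
Implicit Types (x y : V) (om : nat -> R).

Lemma big_pairs (W : zmodType) k (f : nat -> W) :
  \sum_(0 <= i < 2 * k) f i = \sum_(l < k) (f (2 * l)%N + f (2 * l).+1).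
Proof.
elim: k => [|k IH]; first by rewrite muln0 big_geq// big_ord0.
by rewrite mulnS add2n !big_nat_recr//= IH big_ord_recr /= addrA.
Qed.

Lemma coord_ord y (i : 'I_n.+1) : Defs.coord y i = y 0 i.
Proof. by rewrite /Defs.coord ltn_ord inord_val. Qed.

Lemma sum_coord_pairs (W : zmodType) (f : nat -> W) :
  \sum_(i < n.+1) f i = \sum_(l < N) (f (2 * l)%N + f (2 * l).+1).
Proof. by rewrite -(big_mkord xpredT) nN big_pairs. Qed.

Lemma dot_pairs x y : dot x y = \sum_(l < N)
  (Defs.coord x (2 * l) * Defs.coord y (2 * l) + Defs.coord x (2 * l).+1 * Defs.coord y (2 * l).+1).
Proof.
rewrite -(sum_coord_pairs (fun i => Defs.coord x i * Defs.coord y i)).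
by apply: eq_bigr => i _; rewrite !coord_ord.
Qed.

Lemma coord_rot om y i : (i < n.+1)%N -> Defs.coord (rot_field om y) i =
  if odd i then om i./2 * Defs.coord y i.-1 else - (om i./2 * Defs.coord y i.+1).
Proof. by move=> iN; rewrite {1}/Defs.coord iN mxE inordK. Qed.

Lemma coord_rot_even om y (l : 'I_N) :
  Defs.coord (rot_field om y) (2 * l) = - (om l * Defs.coord y (2 * l).+1).
Proof.
have lN := ltn_ord l; rewrite coord_rot; last by rewrite nN ltn_mul2l.
by rewrite mul2n odd_double doubleK.
Qed.

Lemma coord_rot_odd om y (l : 'I_N) :
  Defs.coord (rot_field om y) (2 * l).+1 = om l * Defs.coord y (2 * l).
Proof.
have lN := ltn_ord l; rewrite coord_rot; last by rewrite nN; lia.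
by rewrite mul2n /= odd_double /= uphalf_double.
Qed.

Lemma dot_rot om y : dot (rot_field om y) (rot_field om y) =
  \sum_(l < N) om l ^+ 2 * (Defs.coord y (2 * l) ^+ 2 + Defs.coord y (2 * l).+1 ^+ 2).
Proof.
rewrite dot_pairs; apply: eq_bigr => l _; rewrite coord_rot_even coord_rot_odd; ring.
Qed.

(** The ellipsoid is the locus where its rotation field has unit length, which ties it to
    [|(x - b) B| = 1]. *)
Lemma cellipsoidE om y : cellipsoid N om y = (dot (rot_field om y) (rot_field om y) = 1).
Proof. by rewrite dot_rot. Qed.

Lemma mulmx_rows (v : nat -> V) y :
  y *m (\matrix_(i < n.+1) v i) =
  \sum_(l < N) (Defs.coord y (2 * l) *: v (2 * l)%N + Defs.coord y (2 * l).+1 *: v (2 * l).+1).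
Proof.
rewrite mulmx_sum_row -(sum_coord_pairs (fun i => Defs.coord y i *: v i)).
by apply: eq_bigr => i _; rewrite coord_ord rowK.
Qed.

Lemma rot_field_mulmx B (v : nat -> V) om y : skew_family B N v om ->
  y *m (\matrix_(i < n.+1) v i) *m B = rot_field om y *m (\matrix_(i < n.+1) v i).
Proof.
move=> [_ vB]; rewrite !mulmx_rows mulmx_suml; apply: eq_bigr => l _.
have [_ ve vo] := vB l (ltn_ord l).
rewrite mulmxDl -!scalemxAl ve vo coord_rot_even coord_rot_odd !scalerA addrC.
by congr (_ *: _ + _ *: _); ring.
Qed.

Lemma skew_family_orthogonal B (v : nat -> V) om : skew_family B N v om ->
  (\matrix_(i < n.+1) v i) *m (\matrix_(i < n.+1) v i)^T = 1%:M.
Proof.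
move=> [orth _]; apply/matrixP => i j; transitivity (dot (v i) (v j)).
  by rewrite mxE; apply: eq_bigr => l _; rewrite !mxE.
by rewrite orth ?mxE// -nN.
Qed.

End Coordinates.

(** * The hypersurface fills the whole ellipsoid; the shape operator along the field *)

Section Ellipsoid.
Variables (R : realType) (m : nat).
Local Notation V := 'rV[R]_m.
Implicit Types (A B : 'M[R]_m) (b c x y p : V).

Lemma is_derive_affine A c x v : is_derive x v (fun y : V => y *m A + c) (v *m A).
Proof.
have C : (fun h : R => h^-1 *: (((h *: v + x) *m A + c) - (x *m A + c))) @ 0^' --> v *m A.
  have E : {near (0 : R)^', (fun=> v *m A) =1
      (fun h : R => h^-1 *: (((h *: v + x) *m A + c) - (x *m A + c)))}.
    near=> h; have h0 : h != 0 by near: h; exact: nbhs_dnbhs_neq.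
    by rewrite mulmxDl -scalemxAl opprD addrACA subrr addr0 addrK scalerA mulVf// scale1r.
  by apply: cvg_trans (near_eq_cvg E) _; exact: cvg_cst.
by split; [exact: cvgP C | exact: cvg_lim C].
Unshelve. all: by end_near. Qed.

Lemma smooth_affine A c : smooth_on setT (fun y : V => y *m A + c).
Proof.
split; first exact: openT.
move=> vs x _.
suff : vs = [::] \/ exists d, Defs.iterD vs (fun y : V => y *m A + c) = cst d.
  case=> [->|[d ->]]; split => /=.
  - by apply: continuousD; [exact: continuous_mulmx | exact: cst_continuous].
  - by move=> v; have [] := is_derive_affine A c x v.
  - exact: cst_continuous.
  - by move=> v; exact: derivable_cst.
case/lastP: vs => [|vs v]; [by left | right].
rewrite iterD_rcons (_ : 'D_v _ = cst (v *m A)); last first.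
  by apply/funext => y; have [_ ->] := is_derive_affine A c y v.
elim: vs (v *m A) => [|u vs IH] d; first by exists d.
have [d' /= ->] := IH d; exists 0.
by apply/funext => y; rewrite derive_cst.
Qed.

Lemma smooth_map_affine (S : set V) A c : smooth_map_on S (fun y : V => y *m A + c).
Proof.
move=> p _; exists setT, (fun y : V => y *m A + c).
by split=> //; split=> //; exact: smooth_affine.
Qed.

Section Filling.
Variables (M : set V) (xi : V -> V) (B : 'M[R]_m) (b : V).
Hypothesis m2 : (2 <= m)%N.
Hypothesis cM : compact M.
Hypothesis M0 : M !=set0.
Hypothesis loc : forall p, M p -> exists U phi e F, U p /\ killing_data M U xi phi e F.
Hypothesis sB : B^T = - B.
Hypothesis uB : B \in unitmx.
Hypothesis xiE : forall x, M x -> xi x = (x - b) *m B.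

Let E := [set x : V | dot ((x - b) *m B) ((x - b) *m B) = 1].

Lemma xi_unit x : M x -> dot (xi x) (xi x) = 1.
Proof.
by move=> Mx; have [U [phi [e [F [Ux [_ _ _ _ [uF FE]]]]]]] := loc Mx; rewrite -FE// uF.
Qed.

Lemma ellipsoid_sub x : M x -> E x.
Proof. by move=> Mx; rewrite /E /= -xiE//; exact: xi_unit. Qed.

Lemma tangent_mulmx U phi e F p v : killing_data M U xi phi e F -> U p -> M p ->
  dot (xi p) (lift phi e v p *m B) = 0.
Proof.
move=> kd Up Mp; have [fr sF _ _ [uF FE]] := kd.
have aff y : M y -> `|y - p| < 1 -> xi y = y *m B + - (b *m B).
  by move=> My _; rewrite xiE// mulmxBl.
rewrite -(affine_dF kd v Mp Up ltr01 aff) -FE//.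
exact: (dot_F_dF fr sF uF).
Qed.

(** For [z] in [E] near [p], [graph_exists] gives a small [t] with [z + t e] in [M], hence in [E].
    Then [t (c z + t q) = 0], where [c z] is close to the nonzero [c p] and [|t q|] is at most half
    of [|c p|], so [t] is 0. *)
Lemma ellipsoid_local p : M p -> exists2 d : R, 0 < d & forall z, E z -> `|z - p| < d -> M z.
Proof.
move=> Mp; have [U [phi [e [F [Up kd]]]]] := loc Mp.
have [fr sF _ _ _] := kd.
pose c z := 2 * dot ((z - b) *m B) (e *m B).
(* Otherwise [xi p] would be orthogonal to [u B] for tangent [u] and for [u = e], so to everything,
   [B] being invertible. *)
have cp0 : c p != 0.
  rewrite /c mulf_neq0 ?pnatr_eq0// -xiE//; apply/eqP => eB.
  have uB0 u : dot (xi p) (u *m B) = 0.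
    have -> : u = lift phi e u p + (- slope phi e u p) *: e.
      by rewrite liftE -addrA -scalerDl subrr scale0r addr0.
    by rewrite mulmxDl -scalemxAl dotDr dotZr eB mulr0 addr0 (tangent_mulmx _ kd).
  have := xi_unit Mp; have := uB0 (xi p *m invmx B); rewrite mulmxKV// => ->.
  by move=> /esym/eqP; rewrite oner_eq0.
have cc : {for p, continuous c}.
  have cf : {for p, continuous (fun z : V => (z - b) *m B)}.
    rewrite (_ : (fun z : V => _) = fun z => z *m B + - (b *m B)); last first.
      by apply/funext => z; rewrite mulmxBl.
    by apply: continuousD; [exact: continuous_mulmx | exact: cst_continuous].
  have ce : {for p, continuous (fun=> e *m B : V)} by exact: cst_continuous.
  have c2 : {for p, continuous (fun=> 2 : R)} by exact: cst_continuous.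
  exact: (continuousM c2 (continuous_dot cf ce)).
have c0 : 0 < `|c p| / 2 by rewrite divr_gt0// normr_gt0.
have [d1 d10 H1] := continuous_for_ball cc c0.
pose q := dot (e *m B) (e *m B); have q0 : 0 <= q by exact: dot_ge0.
have q1 : 0 < q + 1 by rewrite ltr_wpDl.
have eps0 : 0 < `|c p| / 2 / (q + 1) by rewrite divr_gt0.
have [r r0 Hr] := graph_exists fr Mp Up eps0.
exists (Num.min d1 r); first by rewrite lt_min d10.
move=> z Ez; rewrite lt_min => /andP[z1 zr].
have [t te [_ Mt]] := Hr _ zr; rewrite subrKC in Mt.
have [t0|tn0] := eqVneq t 0; first by move: Mt; rewrite t0 scale0r addr0.
exfalso.
have := ellipsoid_sub Mt; rewrite /E /= addrAC mulmxDl -scalemxAl.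
rewrite dotDl !dotDr !dotZl !dotZr [dot (e *m B) ((z - b) *m B)]dotC.
have -> : dot ((z - b) *m B) ((z - b) *m B) = 1 by exact: Ez.
rewrite -/q; set a := dot _ _ => Eq.
have {}Eq : t * (2 * a + t * q) = 0 by apply: (addrI 1); rewrite addr0 -[RHS]Eq; ring.
move: Eq => /eqP; rewrite mulf_eq0 (negPf tn0) /= => /eqP Eq.
have cz : c z = - (t * q) by apply/eqP; rewrite -addr_eq0; apply/eqP.
have := H1 _ z1; rewrite cz => H.
have tq : `|t * q| <= `|c p| / 2.
  rewrite normrM (ger0_norm q0); apply: (@le_trans _ _ (`|t| * (q + 1))).
    by rewrite ler_wpM2l// lerDl.
  by rewrite -ler_pdivlMr.
have : `|c p| <= `|- (t * q) - c p| + `|t * q|.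
  have -> : `|c p| = `|(- (t * q) - c p) + t * q| by rewrite addrAC addNr add0r normrN.
  exact: ler_normD.
by move=> A; have := le_lt_trans A (ltr_leD H tq); rewrite -splitr ltxx.
Qed.

Lemma ellipsoid_connected : connected E.
Proof.
have -> : E = (fun y : V => y *m invmx B + b) @` @unit_sphere R m.
  apply/seteqP; split=> [x Ex|_ [y y1 <-]].
    by exists ((x - b) *m B) => //; rewrite mulmxK// subrK.
  by rewrite /E /= addrK mulmxKV.
apply: connected_continuous_connected; first exact: unit_sphere_connected.
apply: continuous_subspaceT => y.
suff : {for y, continuous (fun y : V => y *m invmx B + b)} by [].
by apply: continuousD; [exact: continuous_mulmx | exact: cst_continuous].
Qed.

Lemma ellipsoid_eq : M = E.
Proof.
apply: ellipsoid_connected => //; last first.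
- exists M; first by apply: compact_closed => //; exact: norm_hausdorff.
  by apply/seteqP; split=> [x Mx|x []//]; split=> //; exact: ellipsoid_sub.
- exists [set x | exists2 d : R, 0 < d & forall z, E z -> `|z - x| < d -> M z].
    rewrite openE => y [dy dy0 Hy]; apply/nbhs_ballP; exists (dy / 2); first by rewrite /= divr_gt0.
    move=> y'; rewrite -ball_normE /= => yy'; exists (dy / 2); first by rewrite divr_gt0.
    move=> w Mw wy'; apply: Hy => //; rewrite -(subrKA y') [ltRHS]splitr.
    by apply: le_lt_trans (ler_normD _ _) _; rewrite ltrD// distrC.
  apply/seteqP; split=> [x Mx|x [Ex [d d0 Hd]]].
    by split; [exact: ellipsoid_sub | exact: ellipsoid_local].
  by apply: Hd => //; rewrite subrr normr0.
Qed.

Lemma ellipsoid_diffeomorphic : diffeomorphic M (@unit_sphere R m).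
Proof.
exists (fun x => x *m B + - (b *m B)), (fun y => y *m invmx B + b).
have TE x : x *m B + - (b *m B) = (x - b) *m B by rewrite mulmxBl.
split; first by move=> x /ellipsoid_sub; rewrite TE.
split; first by move=> y y1; rewrite ellipsoid_eq /E /= addrK mulmxKV.
split; first by move=> x _; rewrite TE mulmxK// subrK.
split; first by move=> y _; rewrite TE addrK mulmxKV.
by split; exact: smooth_map_affine.
Qed.

(** Differentiating [<nu, xi> = 0] along [xi] gives [<nu, xi B> = - <D_xi nu, xi> = k], and [xi B]
    is normal, so its squared length is [k^2]. *)
Lemma shape_xi_const_norm nu : unit_normal M nu -> shape_xi_const M nu xi ->
  exists k : R, forall p, M p -> dot (xi p *m B) (xi p *m B) = k.
Proof.
move=> [snu nuP] [k Hk]; exists (k ^+ 2) => p Mp.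
have [U [phi [e [F [Up kd]]]]] := loc Mp.
have [fr sF _ tF [uF FE]] := kd.
have [U' [G [U'p [sG GE]]]] := snu p Mp.
have sh := Hk p U' G Mp (conj U'p (conj sG GE)).
have tanl x v : M x -> U x -> tangent M x (lift phi e v x).
  move=> Mx Ux; exists U, phi; split; last exact: (lift_tangent fr).
  have [sphi et Mz] := fr; split=> //; split=> //; split=> // y Uy.
  by exists e; exact: et.
have lxi x : M x -> U x -> lift phi e (xi x) x = xi x.
  by move=> Mx Ux; apply: tangent_lift; rewrite -FE//; exact: tF.
(* The affine formula extends [xi] off [M], so it can be differentiated together with the extension
   [G] of [nu]. *)
pose g x := dot (G x) (x *m B + - (b *m B)).
have sA i : smooth_on U' (fun x => (x *m B + - (b *m B)) 0 i).
  apply: smooth_row_coord; apply: (@smooth_sub R _ _ setT) => //; last exact: smooth_affine.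
  by case: sG.
have oUU : open (U `&` U') by apply: openI; [case: sF | case: sG].
have sg : smooth_on (U `&` U') g.
  apply: smooth_sum => // i; apply: smooth_mul.
    by apply: smooth_sub (smooth_row_coord i sG) => // x [].
  by apply: smooth_sub (sA i) => // x [].
have g0 x : M x -> (U `&` U') x -> g x = 0.
  move=> Mx [Ux U'x]; rewrite /g GE// -mulmxBl -xiE//.
  by apply: (nuP x Mx).2; rewrite -(lxi x Mx Ux); exact: tanl.
have := tangent_vanish fr (xi p) Mp Up sg (conj Up U'p) g0.
rewrite lxi//.
have dG : is_derive p (xi p) G ('D_(xi p) G p).
  exact: derivableP (proj2 (proj2 sG [::] p U'p) (xi p)).
have [_ ->] := is_derive_dot dG (is_derive_affine B (- (b *m B)) p (xi p)).
rewrite -mulmxBl -xiE// GE// => Eg.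
have nk : dot (nu p) (xi p *m B) = k.
  by rewrite -sh; apply/eqP; rewrite -addr_eq0; apply/eqP.
have [nu1 nuT] := nuP p Mp.
pose r := xi p *m B - k *: nu p.
have rT v : dot r (lift phi e v p) = 0.
  rewrite dotBl dotZl (nuT _ (tanl p v Mp Up)) mulr0 subr0 dot_skew//.
  by rewrite (tangent_mulmx _ kd)// oppr0.
have dec v : v = lift phi e v p - slope phi e v p *: e.
  by rewrite liftE -addrA subrr addr0.
(* [xi p *m B - k *: nu p] is orthogonal to the tangent space and to the normal *)
have re : dot r e = 0.
  have : dot r (nu p) = 0.
    by rewrite dotBl dotZl nu1 mulr1 dotC nk subrr.
  rewrite [X in dot r X](dec (nu p)) dotBr rT sub0r dotZr => /eqP.
  rewrite oppr_eq0 mulf_eq0 => /orP[/eqP s0|/eqP //].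
  have := nu1; rewrite [X in dot _ X](dec (nu p)) s0 scale0r subr0 (nuT _ (tanl p _ Mp Up)).
  by move=> /esym/eqP; rewrite oner_eq0.
have : r = 0.
  by apply: dot_eq0; rewrite [X in dot r X](dec r) dotBr rT dotZr re mulr0 subr0.
move=> /eqP; rewrite subr_eq0 => /eqP ->; by rewrite dotZl dotZr nu1 mulr1 expr2.
Qed.

End Filling.
End Ellipsoid.

Theorem theorem1 (R : realType) (n : nat) (M : set 'rV[R]_n.+1)
    (xi : 'rV[R]_n.+1 -> 'rV[R]_n.+1) :
  (3 <= n)%N ->
  hypersurface M -> compact M -> connected M -> M !=set0 ->
  killing M xi -> (forall p, M p -> dot (xi p) (xi p) = 1) ->
  exists (N : nat) (Q : 'M[R]_n.+1) (b : 'rV[R]_n.+1) (omega : nat -> R),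
    n.+1 = (2 * N)%N /\
    diffeomorphic M ((@unit_sphere R n.+1)) /\
    Q *m Q^T = 1%:M /\
    (forall k, (k < N)%N -> omega k != 0) /\
    M = [set y *m Q + b | y in cellipsoid N omega] /\
    (forall y, cellipsoid N omega y -> xi (y *m Q + b) = rot_field omega y *m Q) /\
    (forall nu : 'rV[R]_n.+1 -> 'rV[R]_n.+1,
          unit_normal M nu -> shape_xi_const M nu xi ->
          (forall k, (k < N)%N -> omega k ^+ 2 = omega 0%N ^+ 2) /\
          M = [set y *m Q + b | y in
                 [set y | dot y y = (omega 0%N ^+ 2)^-1]]).
Proof.
move=> n3 hM cM conM M0 kM unit_xi.
have loc := killing_data_exists hM kM unit_xi.
have n4 : (4 <= n.+1)%N by rewrite ltnS.
have [B [c [sB uB xiB]]] := affine_field n4 cM conM M0 loc.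
(* The zero of the affine field, which becomes the centre of the ellipsoid. *)
pose b := - (c *m invmx B).
have xiE x : M x -> xi x = (x - b) *m B.
  by move=> Mx; rewrite xiB// mulmxBl mulNmx opprK mulmxKV.
have injB (u : 'rV[R]_n.+1) : u *m B = 0 -> u = 0.
  by move=> /(congr1 (mulmx^~ (invmx B))); rewrite mulmxK// mul0mx.
have [N [v [om [nN fam]]]] := skew_family_full sB injB.
pose Q := \matrix_(i < n.+1) v i.
have QQ : Q *m Q^T = 1%:M := skew_family_orthogonal nN fam.
have QTQ : Q^T *m Q = 1%:M by exact: mulmx1C.
have m2 : (2 <= n.+1)%N by lia.
have ME := ellipsoid_eq m2 cM M0 loc uB xiE.
have rotE y : (y *m Q + b - b) *m B = rot_field om y *m Q.
  by rewrite addrK (rot_field_mulmx nN _ fam).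
have dotQ (x : 'rV[R]_n.+1) : dot (x *m Q) (x *m Q) = dot x x.
  by rewrite dot_mulmxl -mulmxA QQ mulmx1.
have ellE : M = [set y *m Q + b | y in cellipsoid N om].
  rewrite ME; apply/seteqP; split=> [x Ex|_ [y + <-]].
    exists ((x - b) *m Q^T); last by rewrite -mulmxA QTQ mulmx1 subrK.
    rewrite (cellipsoidE nN) -dotQ -rotE addrK -[_ *m Q^T *m Q]mulmxA QTQ mulmx1; exact: Ex.
  by rewrite (cellipsoidE nN) /= rotE dotQ.
exists N, Q, b, om; split=> //; split; first exact: (ellipsoid_diffeomorphic m2 cM M0 loc uB xiE).
split=> //; split; first by move=> k kN; have [_ /(_ k kN)[]] := fam.
split=> //; split.
  move=> y ye; rewrite xiE; first exact: rotE.
  by rewrite ellE; exists y.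
move=> nu nuN nuS; have [k Hk] := shape_xi_const_norm loc sB xiE nuN nuS.
have [orth vB] := fam.
have omk l : (l < N)%N -> om l ^+ 2 = k.
  move=> lN; have [om0 ve vo] := vB l lN.
  have l1 : ((2 * l).+1 < 2 * N)%N by lia.
  have l0 : (2 * l < 2 * N)%N by lia.
  (* The end of a semi-axis in the [l]-th plane: there [xi] is [v (2 * l).+1], and [|xi B|^2] is the
     square of [om l]. *)
  pose p := (om l)^-1 *: v (2 * l)%N + b.
  have pB : (p - b) *m B = v (2 * l).+1.
    by rewrite addrK -scalemxAl ve scalerA mulVf// scale1r.
  have Mp : M p by rewrite ME /= pB orth// eqxx.
  by rewrite -(Hk p Mp) xiE// pB vo dotZl dotZr orth// eqxx mulr1 mulrNN.
have N0 : (0 < N)%N by lia.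
have omE l : (l < N)%N -> om l ^+ 2 = om 0%N ^+ 2 by move=> lN; rewrite !omk.
split=> //; rewrite ellE; congr ((fun y => y *m Q + b) @` _).
have om00 : om 0%N ^+ 2 != 0 by rewrite sqrf_eq0; have [] := vB 0%N N0.
have dE (y : 'rV[R]_n.+1) : dot (rot_field om y) (rot_field om y) = om 0%N ^+ 2 * dot y y.
  rewrite (dot_rot nN) (dot_pairs nN) mulr_sumr; apply: eq_bigr => l _.
  by rewrite (omE l (ltn_ord l)) -!expr2.
apply/seteqP; split=> y; rewrite (cellipsoidE nN) dE /=.
  by move=> E; apply: (mulfI om00); rewrite E divff.
by move=> ->; rewrite divff.
Qed.
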